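(* Let $\Lambda$ be a $\tau$-tilting finite algebra and let $\mathcal W\subseteq\mathrm{mod}\,\Lambda$ be a wide subcategory. Then there is a bijection $\rho$ from the set of $\tau$-exceptional sequences in $\mathcal W$ to the set of $\kappa^d$-exceptional sequences in the lattice $\mathrm{tors}(\mathcal W)$, given as follows. Let $(M_k,\dots,M_1)$ be a $\tau$-exceptional sequence in $\mathcal W$, put $\mathcal W_0=\mathcal W$ and $\mathcal W_i=\mathcal J_{\mathcal W_{i-1}}(M_i)$, and for $1\le i\le k$ let $\mathcal T_i=\mathrm{Gen}_{\mathcal W_{i-1}}M_i\in\mathrm{tors}(\mathcal W_{i-1})$. Then $\rho(M_k,\dots,M_1)=(\mathcal T_k,\dots,\mathcal T_1)$, where $\mathcal T_i$ (a completely join-irreducible element of $\mathrm{tors}(\mathcal W_{i-1})$) is regarded as an element of $\mathrm{tors}(\mathcal W)$ by identifying completely join-irreducible torsion classes having the same brick, i.e. $\mathcal T_i$ is identified with $\mathrm{Filt}(\mathrm{Gen}_{\mathcal W}\,\beta(M_i))$. Moreover, for each $1\le i\le k$, the brick label of the cover relation $(\mathcal T_i)_*\lessdot\mathcal T_i$ in $\mathrm{tors}(\mathcal W_{i-1})$ is $\beta(M_i)$, where $(\mathcal T_i)_*$ is the unique element covered by $\mathcal T_i$ in $\mathrm{tors}(\mathcal W_{i-1})$.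
   Context: $\Lambda$ is a finite-dimensional basic algebra over a field; $\mathrm{mod}\,\Lambda$ is the category of finitely generated left modules; subcategories are full and closed under isomorphism. A wide subcategory is one closed under kernels, cokernels and extensions. For a wide subcategory $\mathcal V$ and a class $\mathcal C\subseteq\mathcal V$, $\mathrm{Gen}_{\mathcal V}\,\mathcal C$ is the class of modules in $\mathcal V$ that are quotients of finite direct sums of modules in $\mathcal C$; $\mathrm{Filt}\,\mathcal C$ is the class of modules with a finite filtration with subquotients in $\mathcal C$. A torsion class of $\mathcal V$ is a subcategory $\mathcal T\subseteq\mathcal V$ closed under extensions with $\mathcal T=\mathrm{Gen}_{\mathcal V}\mathcal T$; $\mathrm{tors}(\mathcal V)$ is the lattice of these under inclusion. $\Lambda$ is $\tau$-tilting finite if $\mathrm{tors}(\mathrm{mod}\,\Lambda)$ is finite; then each $\mathrm{tors}(\mathcal V)$ is a finite semidistributive lattice and every wide subcategory $\mathcal V$ is equivalent to the category of finitely generated modules over a finite-dimensional algebra. Let $\tau_{\mathcal V}$ be the Auslander-Reiten translate of $\mathcal V$. A basic $M\in\mathcal V$ is $\tau$-rigid in $\mathcal V$ if $\mathrm{Hom}_\Lambda(M,\tau_{\mathcal V}M)=0$, and then $\mathcal J_{\mathcal V}(M)=\{X\in\mathcal V\mid\mathrm{Hom}_\Lambda(M,X)=0=\mathrm{Hom}_\Lambda(X,\tau_{\mathcal V}M)\}$ is wide. A sequence $(M_k,\dots,M_1)$ of (isomorphism classes of) indecomposable modules is a $\tau$-exceptional sequence in $\mathcal V$ if $M_1$ is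 $\tau$-rigid in $\mathcal V$ and $(M_k,\dots,M_2)$ is a $\tau$-exceptional sequence in $\mathcal J_{\mathcal V}(M_1)$ (the empty sequence is $\tau$-exceptional). A brick is a module whose endomorphism ring is a division algebra. For $M$ indecomposable and $\tau$-rigid in $\mathcal V$, $\beta(M)=M/\sum_g\mathrm{im}\,g$ over all endomorphisms $g$ of $M$ with $0\ne g(M)\ne M$; it is a brick with $\mathrm{Filt}(\mathrm{Gen}_{\mathcal V}\beta(M))=\mathrm{Gen}_{\mathcal V}M$. The map $B\mapsto\mathrm{Filt}(\mathrm{Gen}_{\mathcal V}B)$ is a bijection from bricks in $\mathcal V$ to completely join-irreducible elements of $\mathrm{tors}(\mathcal V)$. Let $L$ be a finite semidistributive lattice. For a cover $u\lessdot v$ let $\mathrm{j\text{-}label}[u,v]=\min\{y\in L\mid y\vee u=v\}$, a join-irreducible element; for $x\le y$ let $\mathrm{j\text{-}label}[x,y]=\{\mathrm{j\text{-}label}[u,v]\mid x\le u\lessdot v\le y\}$. The brick label of a cover $\mathcal U\lessdot\mathcal T$ in $\mathrm{tors}(\mathcal V)$ is the brick $B\in\mathcal V$ with $\mathrm{Filt}(\mathrm{Gen}_{\mathcal V}B)=\mathrm{j\text{-}label}[\mathcal U,\mathcal T]$. Let $\mathrm{pop}_\uparrow(x)$ be the join of $x$ with all elements covering $x$. A sequence $(j_k,\dots,j_1)$ of join-irreducible elements of $L$ is a $\kappa^d$-exceptional sequence, recursively, if $j_i\in\mathrm{j\text{-}label}[j_1,\mathrm{pop}_\uparrow(j_1)]$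 for all $i>1$, and $(j_k\vee j_1,\dots,j_2\vee j_1)$ is a $\kappa^d$-exceptional sequence in the lattice $[j_1,\mathrm{pop}_\uparrow(j_1)]$ (again a finite semidistributive lattice, in which these elements are join-irreducible); the empty sequence is $\kappa^d$-exceptional. *)

(* Defs.v *)
From mathcomp Require Import all_boot all_order all_algebra all_field.
From mathcomp Require Import boolp.

Set Implicit Arguments.
Unset Strict Implicit.
Unset Printing Implicit Defensive.

Import Order.TTheory GRing.Theory.
Local Open Scope ring_scope.

Section Modules.
Context {F : fieldType} {A : falgType F}.
Implicit Types (M N K Q X Y P B : lmodType A).

Definition modclass := lmodType A -> Prop.

Definition fin_gen : modclass := fun M =>
  exists (n : nat) (g : 'I_n -> M),
    forall x, exists c : 'I_n -> A, x = \sum_i c i *: g i.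

Definition surj M N (f : M -> N) := forall y, exists x, f x = y.

Definition mod_iso M N := exists f : {linear M -> N}, bijective f.

Definition is_zero M := forall x : M, x = 0.

Definition hom_zero M N := forall f : {linear M -> N}, forall x, f x = 0.

Definition is_ker M N (f : {linear M -> N}) K :=
  exists i : {linear K -> M},
    injective i /\ forall x, f x = 0 <-> exists k, i k = x.

Definition is_coker M N (f : {linear M -> N}) Q :=
  exists q : {linear N -> Q},
    surj q /\ forall y, q y = 0 <-> exists x, f x = y.

Definition is_ext K M Q :=
  exists (i : {linear K -> M}) (q : {linear M -> Q}),
    [/\ injective i, surj q & forall x, q x = 0 <-> exists k, i k = x].

Definition zero_mod : lmodType A := 'rV[A]_0.

Definition dsum (s : seq (lmodType A)) : lmodType A :=
  foldr (fun M N : lmodType A => (M * N)%type : lmodType A) zero_mod s.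

Definition indecomposable M :=
  ~ is_zero M /\
  forall X Y, mod_iso M (X * Y)%type -> is_zero X \/ is_zero Y.

Definition basic_module M :=
  exists s : seq (lmodType A),
    [/\ mod_iso M (dsum s),
        forall i, (i < size s)%N -> indecomposable (nth zero_mod s i)
      & forall i j, (i < size s)%N -> (j < size s)%N ->
          mod_iso (nth zero_mod s i) (nth zero_mod s j) -> i = j].

(* The zero module is required because the closure conditions alone also
   hold for the empty class. *)
Record is_wide (V : modclass) : Prop := IsWide {
  wide_fin_gen : forall M, V M -> fin_gen M;
  wide_iso : forall M N, mod_iso M N -> V M -> V N;
  wide_zero : V zero_mod;
  wide_ker : forall M N (f : {linear M -> N}) K,
    V M -> V N -> is_ker f K -> V K;
  wide_coker : forall M N (f : {linear M -> N}) Q,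
    V M -> V N -> is_coker f Q -> V Q;
  wide_ext : forall K M Q, is_ext K M Q -> V K -> V Q -> V M
}.

Definition Gen (V C : modclass) : modclass := fun X =>
  V X /\ exists s : seq (lmodType A),
    (forall i, (i < size s)%N -> C (nth zero_mod s i)) /\
    exists f : {linear dsum s -> X}, surj f.

Inductive Filt (C : modclass) : modclass :=
| Filt_zero M : is_zero M -> Filt C M
| Filt_step K M Q : is_ext K M Q -> Filt C K -> C Q -> Filt C M.

Definition Gen1 (V : modclass) M : modclass := Gen V (mod_iso M).

Definition FiltGen (V : modclass) M : modclass := Filt (Gen1 V M).

Definition is_torsion (V T : modclass) :=
  [/\ forall M, T M -> V M,
      forall K M Q, is_ext K M Q -> T K -> T Q -> T M
    & forall M, T M <-> Gen V T M].

Definition tau_tilting_finite :=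
  exists (n : nat) (t : 'I_n -> modclass),
    forall T, is_torsion fin_gen T -> exists i, forall M, T M <-> t i M.

Definition basic_algebra := basic_module (A^o : lmodType A).

Definition brick B :=
  ~ is_zero B /\
  forall f : {linear B -> B}, (forall x, f x = 0) \/ bijective f.

(* B is M / sum of im g, g ranging over the endomorphisms of M with
   0 <> g(M) <> M; this determines B up to isomorphism. *)
Definition is_beta M B :=
  exists q : {linear M -> B}, surj q /\
    forall m, q m = 0 <->
      exists (n : nat) (g : 'I_n -> {linear M -> M}) (x : 'I_n -> M),
        (forall i, (exists y, g i y <> 0) /\ ~ surj (g i)) /\
        m = \sum_i g i (x i).

Definition projective (V : modclass) P :=
  V P /\ forall X Y (g : {linear X -> Y}) (f : {linear P -> Y}),
    V X -> V Y -> surj g ->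
    exists h : {linear P -> X}, forall x, g (h x) = f x.

Definition progenerator (V : modclass) P :=
  projective V P /\ forall X, V X -> Gen1 V P X.

(* p, corestricted to its image, is a projective cover in V: an essential
   epimorphism from a projective object. *)
Definition proj_cover (V : modclass) P Q (p : {linear P -> Q}) :=
  projective V P /\
  forall X (h : {linear X -> P}), V X ->
    (forall y, exists x, p (h x) = p y) -> surj h.

Definition min_proj_pres (V : modclass) P1 P0 M
    (p1 : {linear P1 -> P0}) (p0 : {linear P0 -> M}) :=
  [/\ proj_cover V p0, surj p0, proj_cover V p1
    & forall x, p0 x = 0 <-> exists y, p1 y = x].

(* F-linear functionals on Hom(P, Q); F acts through a |-> a%:A. *)
Definition hom_dual P Q (psi : {linear P -> Q} -> F) :=
  forall (a : F) (h h' h'' : {linear P -> Q}),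
    (forall x, h'' x = a%:A *: h x + h' x) -> psi h'' = a * psi h + psi h'.

(* Let P be a progenerator of V, so that Hom(P, -) is an equivalence from V to
   the finitely generated right modules over E = End(P).  For a minimal
   projective presentation P1 -> P0 -> M -> 0 in V, the transpose of M is the
   left E-module Tr M = coker(Hom(P0, P) -> Hom(P1, P)).  N is the translate
   of M in V when Hom(P, N) is isomorphic, as a right E-module, to D Tr M,
   i.e. to the space of functionals on Hom(P1, P) vanishing on the h0 \o p1;
   phi is this isomorphism. *)
Definition is_AR_translate (V : modclass) M N :=
  V N /\
  exists P P1 P0 (p1 : {linear P1 -> P0}) (p0 : {linear P0 -> M}),
    [/\ progenerator V P, min_proj_pres V p1 p0 &
    exists phi : {linear P -> N} -> {linear P1 -> P} -> F,
      [/\ forall (a : F) (f f' f'' : {linear P -> N}),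
            (forall x, f'' x = a%:A *: f x + f' x) ->
            forall h, phi f'' h = a * phi f h + phi f' h,
          forall (f : {linear P -> N}) (e : {linear P -> P})
              (h : {linear P1 -> P}), phi (f \o e) h = phi f (e \o h),
          forall f, (forall h, phi f h = 0) -> forall x, f x = 0
        & forall psi : {linear P1 -> P} -> F,
            (exists f, forall h, phi f h = psi h) <->
            (hom_dual psi /\
             forall h0 : {linear P0 -> P}, psi (h0 \o p1) = 0)]].

Definition tau_rigid (V : modclass) M :=
  [/\ V M, basic_module M
    & exists2 N, is_AR_translate V M N & hom_zero M N].

Definition Jperp (V : modclass) M : modclass := fun X =>
  [/\ V X, hom_zero M X & exists2 N, is_AR_translate V M N & hom_zero X N].

(* A sequence (M_k, ..., M_1) is encoded by the list [:: M_1; ...; M_k]. *)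
Fixpoint tau_exceptional (V : modclass) (s : seq (lmodType A)) : Prop :=
  if s is M :: s' then
    [/\ indecomposable M, tau_rigid V M & tau_exceptional (Jperp V M) s']
  else True.

Definition iso_seq (s s' : seq (lmodType A)) :=
  size s = size s' /\
  forall i, (i < size s)%N -> mod_iso (nth zero_mod s i) (nth zero_mod s' i).

End Modules.

Arguments modclass {F} A.
Arguments fin_gen {F A} M.
Arguments zero_mod {F A}.
Arguments tau_tilting_finite {F} A.
Arguments basic_algebra {F} A.

Record wide_subcat {F : fieldType} (A : falgType F) := WideSubcat {
  wide_class :> lmodType A -> Prop;
  wide_classP : is_wide wide_class
}.

Record tors {F : fieldType} {A : falgType F} (V : wide_subcat A) := Tors {
  tors_class :> lmodType A -> Prop;
  tors_classP : is_torsion V tors_class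
}.

Section TorsLattice.
Context {F : fieldType} {A : falgType F} (V : wide_subcat A).
Implicit Types (T U S : tors V) (M X : lmodType A).

Lemma tors_ext T U : (forall X, T X <-> U X) -> T = U.
Proof.
case: T U => [T hT] [U hU] /= /predeqP eTU; subst U.
by rewrite (Prop_irrelevance hT hU).
Qed.

Definition tors_le T U := forall X, T X -> U X.

Fact tors_le_refl T : tors_le T T.
Proof. by []. Qed.

Fact tors_le_anti T U : tors_le T U -> tors_le U T -> T = U.
Proof. by move=> TU UT; apply: tors_ext => X; split; [apply: TU | apply: UT]. Qed.

Fact tors_le_trans U T S : tors_le T U -> tors_le U S -> tors_le T S.
Proof. by move=> TU US X /TU /US. Qed.

Lemma Gen_self (C : modclass A) M : V M -> C M -> Gen V C M.
Proof.
move=> VM CM; split=> //; exists [:: M]; split; first by case.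
by exists (@fst M (@zero_mod F A)) => y; exists (y, 0).
Qed.

Lemma Gen_mono (C D : modclass A) M :
  (forall X, C X -> D X) -> Gen V C M -> Gen V D M.
Proof.
move=> CD [VM [s [Cs f]]]; split=> //; exists s; split=> // i /Cs.
exact: CD.
Qed.

Lemma tors_inter_subproof (I : tors V -> Prop) T0 : I T0 ->
  is_torsion V (fun M => forall T, I T -> T M).
Proof.
move=> IT0; split=> [M /(_ _ IT0)|K M Q e hK hQ T IT|M].
- by case: (tors_classP T0) => + _ _; apply.
- by case: (tors_classP T) => _ + _ => /(_ _ _ _ e); apply; [apply: hK|apply: hQ].
split=> [h|h T IT].
  apply: Gen_self => //; case: (tors_classP T0) => + _ _; apply; exact: h.
case: (tors_classP T) => _ _ ->; apply: Gen_mono h => X; exact.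
Qed.

Lemma tors_top_subproof : is_torsion V V.
Proof.
split=> // [K M Q e|M]; first exact: (wide_ext (wide_classP V) e).
by split=> [VM|[]//]; apply: Gen_self.
Qed.

Definition tors_top := Tors tors_top_subproof.

Lemma tors_bot_subproof : is_torsion V (fun M => is_zero M).
Proof.
have V0 := wide_zero (wide_classP V).
have zV M : is_zero M -> V M.
  move=> M0; apply: (wide_iso (wide_classP V) _ V0).
  exists (GRing.null_fun M : {linear zero_mod -> M}).
  exists (fun=> 0) => x; last by rewrite (M0 x).
  by apply/rowP => -[].
split=> // [K M Q [i [q [_ _ ex]]] K0 Q0 x|M].
  by have [k <-] := (ex x).1 (Q0 _); rewrite (K0 k) linear0.
split=> [M0|[_ [s [s0 [f fs]]] x]]; first exact: Gen_self (zV _ M0) M0.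
have [y <-] := fs x.
suff -> : y = 0 by rewrite linear0.
elim: s s0 {f fs} y => [_ y|N s IHs s0 [y1 y2]]; first by apply/rowP => -[].
rewrite (s0 0%N isT y1) (IHs _ y2) // => i; exact: (s0 i.+1).
Qed.

Definition tors_bot := Tors tors_bot_subproof.

Definition tors_meet T U : tors V :=
  Tors (@tors_inter_subproof (fun S => S = T \/ S = U) T (or_introl erefl)).

Definition tors_join T U : tors V :=
  Tors (@tors_inter_subproof
    (fun S => (forall X, T X -> S X) /\ (forall X, U X -> S X)) tors_top
    (conj (fun X TX => let: And3 s _ _ := tors_classP T in s X TX)
          (fun X UX => let: And3 s _ _ := tors_classP U in s X UX))).

Fact tors_lexI S T U : tors_le S (tors_meet T U) <-> tors_le S T /\ tors_le S U.
Proof.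
split=> [h|[ST SU] X SX S' [->|->]]; [|exact: ST|exact: SU].
by split=> X /h /=; apply; [left|right].
Qed.

Fact tors_leUx T U S : tors_le (tors_join T U) S <-> tors_le T S /\ tors_le U S.
Proof.
split=> [h|[TS US] X]; last by apply.
by split=> X hX; apply: h => S' [TS' US']; [apply: TS'|apply: US'].
Qed.

Fact tors_le0x T : tors_le tors_bot T.
Proof.
move=> X X0; case: (tors_classP T) => _ _ ->.
split; first by have [+ _ _] := tors_bot_subproof; apply.
exists [::]; split=> //; exists (GRing.null_fun X : {linear zero_mod -> X}) => y.
by exists 0; rewrite (X0 y).
Qed.

Fact tors_lex1 T : tors_le T tors_top.
Proof. by move=> X; case: (tors_classP T) => + _ _; apply. Qed.

End TorsLattice.

(* MathComp's latticeType cannot be used, because tors V is too large to be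
    the carrier of an eqType.  The notions for the interval [a, b] are relative
    to the bounds a and b; joins in [a, b] are those of the whole lattice. *)

Section LatticeNotions.
Context {L : Type} (le : L -> L -> Prop) (join : L -> L -> L).
Implicit Types (a b u v x y j p : L) (s : seq L).

Definition within a b x := le a x /\ le x b.

Definition cover u v :=
  [/\ le u v, u <> v & forall w, within u v w -> w = u \/ w = v].

Definition join_irreducible a b x :=
  [/\ within a b x, x <> a
    & forall y z, within a b y -> within a b z -> x = join y z ->
        x = y \/ x = z].

Definition completely_join_irreducible x :=
  forall S : L -> Prop,
    (forall y, S y -> le y x) ->
    (forall z, (forall y, S y -> le y z) -> le x z) -> S x.

Definition is_jlabel a b u v j :=
  [/\ within a b j, join j u = v
    & forall y, within a b y -> join y u = v -> le j y].

Definition jlabels a b x y j :=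
  exists u v, [/\ le x u, le v y, cover u v & is_jlabel a b u v j].

(* p is the join of x with all the elements covering x in [a, b], x >= a. *)
Definition is_pop b x p :=
  [/\ le x p, forall y, cover x y -> le y b -> le y p
    & forall z, le x z -> (forall y, cover x y -> le y b -> le y z) -> le p z].

(* A sequence (j_k, ..., j_1) is encoded by the list [:: j_1; ...; j_k]. *)
Inductive kappa_exceptional : L -> L -> seq L -> Prop :=
| kappa_nil a b : kappa_exceptional a b [::]
| kappa_cons a b j s p :
    (forall i, (i <= size s)%N -> join_irreducible a b (nth a (j :: s) i)) ->
    is_pop b j p ->
    (forall i, (i < size s)%N -> jlabels a b j p (nth a s i)) ->
    kappa_exceptional j p [seq join i j | i <- s] ->
    kappa_exceptional a b (j :: s).

End LatticeNotions.

Section TorsNotions.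
Context {F : fieldType} {A : falgType F} {V : wide_subcat A}.

Definition tors_cover : tors V -> tors V -> Prop := cover (@tors_le F A V).

Definition tors_cji : tors V -> Prop :=
  completely_join_irreducible (@tors_le F A V).

Definition tors_kappa_exceptional : seq (tors V) -> Prop :=
  kappa_exceptional (@tors_le F A V) (@tors_join F A V)
    (tors_bot V) (tors_top V).

(* For T completely join-irreducible: B is the brick corresponding to T. *)
Definition is_brick_of (T : tors V) (B : lmodType A) :=
  [/\ brick B, V B & forall X, T X <-> FiltGen V B X].

Definition brick_label (U T : tors V) (B : lmodType A) :=
  exists2 j, is_jlabel (@tors_le F A V) (@tors_join F A V)
               (tors_bot V) (tors_top V) U T j
           & is_brick_of j B.

End TorsNotions.

(* Main.v *)
(* Write ^T(M) for the class of Y in V with Hom(Y, tau_V M) = 0.  For M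
   indecomposable and tau-rigid in V, Gen M is join-irreducible with brick
   beta(M), pop_up(Gen M) = ^T(M), and U |-> {Y in ^T(M) | every quotient of Y
   lying in J(M) lies in U} is an isomorphism of tors(J(M)) onto the interval
   [Gen M, ^T(M)].  The labels of this interval are the bricks B of J(M), and
   Filt(Gen_V B) \/ Gen M corresponds to Filt(Gen_J(M) B).  So the first step
   of a kappa^d-exceptional sequence is the same as the first step of a
   tau-exceptional sequence, with tors(J(M)) as the remaining interval, and
   induction on the length finishes the proof.

   The class ^T(M) replaces tau M: membership of Y means that all extensions
   of M by quotients of Y split. Finiteness of tors(mod A) enters through
   mutation: a torsion class T that is minimal among those above a given one
   and generated by a single module has a two-term silting generator, and
   dropping one of its indecomposable summands yields a strictly smaller
   such class unless T is the given one. Hence every torsion class of V is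
   Gen of an Ext-projective, and every wide subcategory has a progenerator. *)

From HB Require Import structures.
Require Import Defs.
From mathcomp Require Import all_boot all_order all_algebra all_field.
From mathcomp Require Import boolp.

Set Implicit Arguments.
Unset Strict Implicit.
Unset Printing Implicit Defensive.

Import GRing.Theory.
Local Open Scope ring_scope.

(** * Submodules, quotients and finite products *)

(** The obstacle is that the translate in a wide subcategory is defined through a progenerator,
    whose existence is not part of the definition of a wide subcategory and must be proved before
    J(M) can be handled. Splitting of extensions and lifting of maps make sense without it, so
    [Dtau], Ext-projectivity and torsion pairs come before the translate; the two sides meet in the
    Auslander-Reiten duality [AR_Dtau]. The induction needs progenerators for all the W_i at once,
    hence for arbitrary wide subcategories. Dimension counts take the place of composition series:
    torsion parts, projective covers, minimal approximations and bricks are all found as objects of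
    extremal dimension. Nakayama's lemma over the endomorphism ring of a module, rather than over
    the algebra, is the source of every statement about radicals, of the brick property of beta(M),
    and of the fact that Gen M determines an indecomposable [M]. *)

Section Toolkit.
Context {F : fieldType} {A : falgType F}.
Implicit Types (M N K Q X Y Z P B : lmodType A).

Section MkLinear.
Context {M N : lmodType A} (f : M -> N) (fL : linear f).
Definition mklin_fun of linear f := f.
HB.instance Definition _ := GRing.isLinear.Build A M N *:%R (mklin_fun fL) fL.
Definition mklin : {linear M -> N} := mklin_fun fL.
Lemma mklin_funE x : mklin_fun fL x = f x. Proof. by []. Qed.
End MkLinear.

Lemma lin_ext M N (f g : {linear M -> N}) : f =1 g -> f = g.
Proof.
case: f => f [[fa] [fb]]; case: g => g [[ga] [gb]] /= /funext efg.
move: fa fb ga gb; rewrite efg => fa fb ga gb.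
by rewrite (Prop_irrelevance fa ga) (Prop_irrelevance fb gb).
Qed.

(** Membership is [Prop]-valued because it is mostly an existential condition; a boolean predicate
    is derived classically where a carrier type is built. *)
Record smod M := Smod {
  smod_in :> M -> Prop;
  smod0 : smod_in 0;
  smodL : forall a x y, smod_in x -> smod_in y -> smod_in (a *: x + y) }.

Lemma smodD M (S : smod M) x y : S x -> S y -> S (x + y).
Proof. by move=> Sx Sy; rewrite -[x]scale1r; apply: smodL. Qed.
Lemma smodZ M (S : smod M) a x : S x -> S (a *: x).
Proof. by move=> Sx; rewrite -[_ *: _]addr0; apply: smodL => //; apply: smod0. Qed.
Lemma smodN M (S : smod M) x : S x -> S (- x).
Proof. by move=> Sx; rewrite -scaleN1r; apply: smodZ. Qed.
Lemma smodB M (S : smod M) x y : S x -> S y -> S (x - y).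
Proof. by move=> Sx Sy; apply: smodD => //; apply: smodN. Qed.
Lemma smod_sum M (S : smod M) n (f : 'I_n -> M) :
  (forall i, S (f i)) -> S (\sum_i f i).
Proof. by move=> Sf; elim/big_ind: _ => //; [apply: smod0|apply: smodD]. Qed.

Section SubModule.
Context {M : lmodType A} (S : smod M).
Definition sub_pred : pred M := fun x => `[< S x >].
Fact sub_pred_closed : submod_closed sub_pred.
Proof.
split; first by apply/asboolP; apply: smod0.
move=> a x y; rewrite !unfold_in => /asboolP Sx /asboolP Sy; apply/asboolP; exact: smodL.
Qed.
Definition sub_type := {x : M | sub_pred x}.
HB.instance Definition _ := SubChoice.on sub_type.
HB.instance Definition _ :=
  GRing.SubChoice_isSubLmodule.Build A M sub_pred sub_type sub_pred_closed.
Definition sub : lmodType A := sub_type.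
Fact incl_linear : linear (fun x : sub => val (x : sub_type)).
Proof. by move=> a x y; rewrite linearP. Qed.
Definition incl : {linear sub -> M} := mklin incl_linear.
Lemma incl_inj : injective incl.
Proof. exact: val_inj. Qed.
Lemma inclP x : S (incl x).
Proof. exact/asboolP/(valP (x : sub_type)). Qed.
Lemma incl_onto x : S x -> exists y, incl y = x.
Proof.
move=> Sx; have Sx' : sub_pred x by apply/asboolP.
by exists (exist _ x Sx').
Qed.
End SubModule.

Lemma corestrict M N (S : smod M) (f : {linear N -> M}) :
  (forall x, S (f x)) -> exists g : {linear N -> sub S}, forall x, incl S (g x) = f x.
Proof.
move=> h; have Sf x : sub_pred S (f x) by apply/asboolP.
pose g x : sub S := exist _ (f x) (Sf x).
have gL : linear g by move=> a x y; apply: incl_inj; rewrite [RHS]linearP; exact: (linearP f).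
by exists (mklin gL).
Qed.

Section Quotient.
Context {M : lmodType A} (S : smod M).

Fact crep_ex (x : M) : exists y, sub_pred S (x - y).
Proof. by exists x; rewrite subrr; apply/asboolP; apply: smod0. Qed.
(* The carrier of the quotient consists of chosen coset representatives. *)
Definition crep x := xchoose (crep_ex x).
Lemma crepP x : S (x - crep x).
Proof. exact/asboolP/(xchooseP (crep_ex x)). Qed.
Lemma crep_eq x y : S (x - y) -> crep x = crep y.
Proof.
move=> Sxy; apply: eq_xchoose => z; apply/asboolP/asboolP => [Sx|Sy].
  have -> : y - z = x - z - (x - y) by rewrite opprB [RHS]addrC subrKA.
  exact: smodB.
have -> : x - z = x - y + (y - z) by rewrite subrKA.
exact: smodD.
Qed.
Lemma crepK x : crep (crep x) = crep x.
Proof. by apply: crep_eq; rewrite -opprB; apply/smodN/crepP. Qed.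

Definition quo_type := {x : M | crep x == x}.
HB.instance Definition _ := Choice.on quo_type.
Definition qcls x : quo_type := exist _ (crep x) (introT eqP (crepK x)).
Lemma qcls_val (u : quo_type) : qcls (val u) = u.
Proof. by apply: val_inj; apply/eqP: (valP u). Qed.
Lemma qcls_eq x y : qcls x = qcls y <-> S (x - y).
Proof.
split=> [/(congr1 val) /= e|/crep_eq e]; last exact: val_inj.
rewrite -(subrKA (crep x)) {2}e; apply: smodD; first exact: crepP.
by rewrite -opprB; apply/smodN/crepP.
Qed.
Definition qadd (u v : quo_type) := qcls (val u + val v).
Definition qopp (u : quo_type) := qcls (- val u).
Definition qscale (a : A) (u : quo_type) := qcls (a *: val u).
Lemma qclsD x y : qadd (qcls x) (qcls y) = qcls (x + y).
Proof.
apply/qcls_eq => /=; rewrite -opprB; apply: smodN; rewrite opprD addrACA.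
by apply: smodD; apply: crepP.
Qed.
Lemma qclsN x : qopp (qcls x) = qcls (- x).
Proof. by apply/qcls_eq; rewrite /= opprK addrC; apply: crepP. Qed.
Lemma qclsZ a x : qscale a (qcls x) = qcls (a *: x).
Proof.
by apply/qcls_eq; rewrite /= -scalerBr -opprB; apply/smodZ/smodN/crepP.
Qed.
Lemma qcls_ind (Pr : quo_type -> Prop) : (forall x, Pr (qcls x)) -> forall u, Pr u.
Proof. by move=> h u; rewrite -(qcls_val u). Qed.
Fact qaddA : associative qadd.
Proof.
by elim/qcls_ind=> x; elim/qcls_ind=> y; elim/qcls_ind=> z; rewrite !qclsD addrA.
Qed.
Fact qaddC : commutative qadd.
Proof. by elim/qcls_ind=> x; elim/qcls_ind=> y; rewrite !qclsD addrC. Qed.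
Fact qadd0 : left_id (qcls 0) qadd.
Proof. by elim/qcls_ind=> x; rewrite !qclsD add0r. Qed.
Fact qaddN : left_inverse (qcls 0) qopp qadd.
Proof. by elim/qcls_ind=> x; rewrite qclsN qclsD addNr. Qed.
HB.instance Definition _ := GRing.isZmodule.Build quo_type qaddA qaddC qadd0 qaddN.
Fact qscaleA a b v : qscale a (qscale b v) = qscale (a * b) v.
Proof. by elim/qcls_ind: v => x; rewrite !qclsZ scalerA. Qed.
Fact qscale1 : left_id 1 qscale.
Proof. by elim/qcls_ind=> x; rewrite !qclsZ scale1r. Qed.
Fact qscaleDr : right_distributive qscale +%R.
Proof.
move=> a; elim/qcls_ind=> x; elim/qcls_ind=> y.
by rewrite [qcls x + _]qclsD !qclsZ [RHS]qclsD scalerDr.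
Qed.
Fact qscaleDl v : {morph qscale^~ v : a b / a + b}.
Proof. by move=> a b; elim/qcls_ind: v => x; rewrite !qclsZ [RHS]qclsD scalerDl. Qed.
HB.instance Definition _ :=
  GRing.Zmodule_isLmodule.Build A quo_type qscaleA qscale1 qscaleDr qscaleDl.
Definition quo : lmodType A := quo_type.
Fact qcls_linear : linear (qcls : M -> quo).
Proof. by move=> a x y; rewrite -qclsD -qclsZ. Qed.
Definition pr : {linear M -> quo} := mklin qcls_linear.
Lemma pr_surj : surj pr.
Proof. by move=> u; exists (val (u : quo_type)); apply: qcls_val. Qed.
Lemma prP x : pr x = 0 <-> S x.
Proof. by rewrite -[S x](congr1 S (subr0 x)) -qcls_eq. Qed.
Lemma pr_eq x y : pr x = pr y <-> S (x - y).
Proof. exact: qcls_eq. Qed.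
End Quotient.

Lemma factor_surj M Q N (q : {linear M -> Q}) (f : {linear M -> N}) :
  surj q -> (forall x, q x = 0 -> f x = 0) ->
  exists g : {linear Q -> N}, forall x, g (q x) = f x.
Proof.
move=> qs kqf; have [r rK] := choice qs.
have fr x : f (r (q x)) = f x.
  by apply/eqP; rewrite -subr_eq0 -linearB kqf // linearB rK subrr.
have gL : linear (fun y => f (r y)).
  move=> a y z; rewrite -{1}(rK y) -{1}(rK z) -linearP fr linearP.
  by [].
by exists (mklin gL).
Qed.

Lemma lift_inj M K N (i : {linear K -> M}) (f : {linear N -> M}) :
  injective i -> (forall x, exists k, i k = f x) ->
  exists g : {linear N -> K}, forall x, i (g x) = f x.
Proof.
move=> inji /choice [g gK].
have gL : linear g by move=> a x y; apply: inji; rewrite linearP !gK linearP.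
by exists (mklin gL).
Qed.

Fact kerm_subproof M N (f : {linear M -> N}) a x y :
  f x = 0 -> f y = 0 -> f (a *: x + y) = 0.
Proof. by move=> fx fy; rewrite linearP fx fy scaler0 addr0. Qed.
Definition kerm M N (f : {linear M -> N}) :=
  @Smod M (fun x => f x = 0) (linear0 f) (@kerm_subproof M N f).

Fact imm_subproof0 M N (f : {linear M -> N}) : exists x, f x = 0.
Proof. by exists 0; rewrite linear0. Qed.
Fact imm_subproof M N (f : {linear M -> N}) a x y :
  (exists z, f z = x) -> (exists z, f z = y) -> exists z, f z = a *: x + y.
Proof. by move=> [u <-] [v <-]; exists (a *: u + v); rewrite linearP. Qed.
Definition imm M N (f : {linear M -> N}) :=
  @Smod N (fun x => exists z, f z = x) (imm_subproof0 f) (@imm_subproof M N f).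

Fact preim_subproof0 M N (f : {linear M -> N}) (S : smod N) : S (f 0).
Proof. by rewrite linear0; apply: smod0. Qed.
Fact preim_subproof M N (f : {linear M -> N}) (S : smod N) a x y :
  S (f x) -> S (f y) -> S (f (a *: x + y)).
Proof. by rewrite linearP; apply: smodL. Qed.
Definition preim M N (f : {linear M -> N}) (S : smod N) :=
  @Smod M (fun x => S (f x)) (preim_subproof0 f S) (@preim_subproof M N f S).

Lemma add_ker0_inj M N (f : {linear M -> N}) :
  (forall x, f x = 0 -> x = 0) -> injective f.
Proof. by move=> f0 x y e; apply/eqP; rewrite -subr_eq0 (f0 (x - y)) ?linearB ?e ?subrr. Qed.

Lemma inj_ker0 M N (f : {linear M -> N}) x : injective f -> f x = 0 -> x = 0.
Proof. by move=> fi fx; apply: fi; rewrite fx linear0. Qed.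

Lemma bij_inj_surj M N (f : {linear M -> N}) : injective f -> surj f -> bijective f.
Proof.
move=> fi /choice [g gK]; exists g => // x; exact/fi/gK.
Qed.

Lemma bij_surj M N (f : {linear M -> N}) : bijective f -> surj f.
Proof. by move=> [g _ gK] y; exists (g y). Qed.

Lemma lin_inv M N (f : {linear M -> N}) : bijective f ->
  exists g : {linear N -> M}, cancel f g /\ cancel g f.
Proof.
move=> [g fK gK]; have gL : linear g.
  by move=> a x y; apply: (can_inj fK); rewrite linearP !gK.
by exists (mklin gL).
Qed.

Lemma mod_iso_refl M : mod_iso M M.
Proof. by exists (idfun : {linear M -> M}); exists idfun. Qed.
Lemma mod_iso_sym M N : mod_iso M N -> mod_iso N M.
Proof. by move=> [f /lin_inv [g [fK gK]]]; exists g; exists f. Qed.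

Lemma mod_iso_sub_imm K M (i : {linear K -> M}) : injective i -> mod_iso K (sub (imm i)).
Proof.
move=> ii; have [g gE] := @corestrict _ _ (imm i) i (fun x => ex_intro _ x erefl).
exists g; apply: bij_inj_surj => [x y e|y].
  by apply: ii; rewrite -!gE e.
by have [x xE] := inclP y; exists x; apply: incl_inj; rewrite gE.
Qed.

Lemma mod_iso_quo M Q (q : {linear M -> Q}) (S : smod M) :
  surj q -> (forall x, q x = 0 <-> S x) -> mod_iso (quo S) Q.
Proof.
move=> qs kq; have [x /prP/kq//|g gE] := @factor_surj _ _ _ (pr S) q (@pr_surj _ S).
exists g; apply: bij_inj_surj => [|y].
  apply: add_ker0_inj => u; have [x <-] := pr_surj u; rewrite gE => /kq.
  by move/prP.
by have [x <-] := qs y; exists (pr S x); rewrite gE.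
Qed.

Lemma mod_iso_eq M (S S' : smod M) : (forall x, S x <-> S' x) -> mod_iso (sub S) (sub S').
Proof.
move=> e; have [g gE] := @corestrict _ _ S' (incl S) (fun x => (e _).1 (inclP x)).
exists g; apply: bij_inj_surj => [x y h|y].
  by apply: incl_inj; rewrite -!gE h.
have [x xE] := incl_onto ((e _).2 (inclP y)).
by exists x; apply: incl_inj; rewrite gE.
Qed.

Lemma is_ext_smod K M Q : is_ext K M Q ->
  exists S : smod M, mod_iso K (sub S) /\ mod_iso (quo S) Q.
Proof.
move=> [i [q [ii qs ex]]]; exists (imm i); split; first exact: mod_iso_sub_imm.
exact: mod_iso_quo.
Qed.

Lemma smod_is_ext M (S : smod M) : is_ext (sub S) M (quo S).
Proof.
exists (incl S), (pr S); split=> [||x]; [exact: incl_inj|exact: pr_surj|].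
split=> [/prP/incl_onto//|[y <-]]; exact/prP/inclP.
Qed.

Lemma ext_ker M N (g : {linear M -> N}) : surj g -> is_ext (sub (kerm g)) M N.
Proof.
move=> gs; exists (incl (kerm g)), g; split=> // [|x]; first exact: incl_inj.
split=> [/(@incl_onto _ (kerm g))//|[y <-]]; exact: (inclP y).
Qed.

Section LinCombo.
Context {I : finType} {M N : lmodType A} (f : I -> {linear M -> N}).
Fact linsum_linear : linear (fun x => \sum_i f i x).
Proof.
move=> a x y; rewrite scaler_sumr -big_split; apply: eq_bigr => i _ /=.
by rewrite linearP.
Qed.
Definition linsum : {linear M -> N} := mklin linsum_linear.
End LinCombo.

Definition pow M n : lmodType A := {ffun 'I_n -> M}.

Section Pow.
Context {n : nat} {M N : lmodType A}.
Fact pproj_linear (i : 'I_n) : linear (fun x : pow M n => (x : {ffun 'I_n -> M}) i).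
Proof. by move=> a x y; rewrite !ffunE. Qed.
Definition pproj i : {linear pow M n -> M} := mklin (pproj_linear i).
Fact pinj_linear (i : 'I_n) :
  linear (fun x => [ffun j => if j == i then x else 0] : pow M n).
Proof.
by move=> a x y; apply/ffunP => j; rewrite !ffunE; case: eqP => // _; rewrite scaler0 addr0.
Qed.
Definition pinj i : {linear M -> pow M n} := mklin (pinj_linear i).
Fact pout_linear (f : 'I_n -> {linear M -> N}) :
  linear (fun x : pow M n => \sum_i f i ((x : {ffun 'I_n -> M}) i)).
Proof.
move=> a x y; rewrite scaler_sumr -big_split; apply: eq_bigr => i _ /=.
by rewrite !ffunE linearP.
Qed.
Definition pout f : {linear pow M n -> N} := mklin (pout_linear f).
Fact pin_linear (f : 'I_n -> {linear N -> M}) :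
  linear (fun x => [ffun i => f i x] : pow M n).
Proof. by move=> a x y; apply/ffunP => i; rewrite !ffunE linearP. Qed.
Definition pin f : {linear N -> pow M n} := mklin (pin_linear f).
Lemma pinE f x i : pproj i (pin f x) = f i x.
Proof. exact: (ffunE (fun i => f i x) i). Qed.
Lemma poutE f x : pout f x = \sum_i f i (pproj i x). Proof. by []. Qed.
Lemma pow_ext (x y : pow M n) : (forall i, pproj i x = pproj i y) -> x = y.
Proof. by move=> e; apply/ffunP. Qed.
Lemma pow_mk (g : 'I_n -> M) : exists x : pow M n, forall i, pproj i x = g i.
Proof. by exists [ffun i => g i] => i; exact: (ffunE g i). Qed.
End Pow.

Lemma pow_decomp n M (z : pow M n) : z = \sum_i pinj i (pproj i z).
Proof.
apply/ffunP => i; rewrite sum_ffunE (bigD1 i) //= big1 => [|j ji].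
  by rewrite ffunE eqxx addr0.
by rewrite ffunE eq_sym (negbTE ji).
Qed.

Lemma pproj_pinj n M (i : 'I_n) (x : M) : pproj i (pinj i x) = x.
Proof.
transitivity ([ffun j => if j == i then x else 0] i); first by [].
by rewrite ffunE eqxx.
Qed.
Lemma pproj_pinj_ne n M (i j : 'I_n) (x : M) : i != j -> pproj i (pinj j x) = 0.
Proof.
move=> /negbTE ne; transitivity ([ffun k => if k == j then x else 0] i); first by [].
by rewrite ffunE ne.
Qed.

Section Pairs.
Context {M N K : lmodType A}.
Fact pair_linear (f : {linear K -> M}) (g : {linear K -> N}) :
  linear (fun x => (f x, g x) : (M * N)%type).
Proof. by move=> a x y; rewrite !linearP. Qed.
Definition lpair f g : {linear K -> (M * N)%type} := mklin (pair_linear f g).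
Fact copair_linear (f : {linear M -> K}) (g : {linear N -> K}) :
  linear (fun x : (M * N)%type => f x.1 + g x.2).
Proof. by move=> a x y; rewrite /= !linearP scalerDr addrACA. Qed.
Definition lcopair f g : {linear (M * N)%type -> K} := mklin (copair_linear f g).
End Pairs.

Definition lfst M N : {linear (M * N)%type -> M} := fst.
Definition lsnd M N : {linear (M * N)%type -> N} := snd.

Fact scal_linear M (c : F) : linear (fun x : M => c%:A *: x).
Proof.
move=> a x y; rewrite scalerDr !scalerA; congr (_ *: _ + _).
by rewrite -scalerAl mul1r -scalerAr mulr1.
Qed.
Definition scal M c : {linear M -> M} := mklin (@scal_linear M c).
Lemma scalE M c x : scal M c x = c%:A *: x. Proof. by []. Qed.
Lemma linsumE (I : finType) M N (f : I -> {linear M -> N}) x : linsum f x = \sum_i f i x.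
Proof. by []. Qed.
Lemma lpairE M N K (f : {linear K -> M}) (g : {linear K -> N}) x :
  lpair f g x = (f x, g x).
Proof. by []. Qed.
Lemma lcopairE M N K (f : {linear M -> K}) (g : {linear N -> K}) x :
  lcopair f g x = f x.1 + g x.2.
Proof. by []. Qed.
End Toolkit.

Arguments incl : simpl never.
Arguments pr : simpl never.
Arguments scal : simpl never.
Arguments linsum : simpl never.
Arguments pproj : simpl never.
Arguments pinj : simpl never.
Arguments pout : simpl never.
Arguments pin : simpl never.
Arguments lpair : simpl never.
Arguments lcopair : simpl never.

Import VectorInternalTheory.

(** * Dimension *)

Section FiniteDimension.
Context {F : fieldType} {A : falgType F}.
Implicit Types (M N K Q X Y Z P B : lmodType A).

(** Take a matrix of maximal rank among those whose row space lies in [S]: a vector of [S] outside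
    its row space would raise the rank. *)
Lemma rowspace n (S : 'rV[F]_n -> Prop) : S 0 ->
  (forall a u v, S u -> S v -> S (a *: u + v)) ->
  exists m : 'M[F]_n, forall u, S u <-> (u <= m)%MS.
Proof.
move=> S0 SL.
pose Pr r := `[< exists2 B : 'M[F]_n, (forall u : 'rV_n, (u <= B)%MS -> S u) & \rank B = r >].
have ex0 : exists r, Pr r.
  exists 0%N; apply/asboolP; exists 0; last by rewrite mxrank0.
  by move=> u; rewrite submx0 => /eqP ->.
have ub r : Pr r -> (r <= n)%N by move=> /asboolP[B _ <-]; apply: rank_leq_row.
case: (ex_maxnP ex0 ub) => r /asboolP[B BS Br] rmax; exists B => u.
split=> [Su|/BS//]; apply: contraT => uB.
have lt : (B < B + u)%MS.
  rewrite /ltmx addsmxSl /=; apply: contraNN uB => h.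
  exact: submx_trans (addsmxSr _ _) h.
suff /rmax : Pr (\rank (B + u)%MS) by rewrite leqNgt -Br (rank_ltmx lt).
apply/asboolP; exists (B + u)%MS => // v /sub_addsmxP[[w1 w2] /= ->].
rewrite addrC [w2]mx11_scalar mul_scalar_mx; apply: SL => //; exact/BS/submxMl.
Qed.

(* F acts on M through a |-> a%:A, so an F-linear map to 'rV[F]_d has no
   linear structure in MathComp's sense. *)
Definition fcoord d M (c : M -> 'rV[F]_d) :=
  injective c /\ forall a x y, c (a%:A *: x + y) = a *: c x + c y.

Section FCoord.
Context {d : nat} {M : lmodType A} {c : M -> 'rV[F]_d} (cP : fcoord c).
Lemma fcoord0 : c 0 = 0.
Proof.
have := cP.2 1 0 0; rewrite !scale1r addr0 => /eqP.
by rewrite -{1}[c 0]add0r (inj_eq (addIr _)) => /eqP.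
Qed.
Lemma fcoord_sum n (w : 'I_n -> F) (x : 'I_n -> M) :
  c (\sum_i (w i)%:A *: x i) = \sum_i w i *: c (x i).
Proof.
elim/big_rec2: _ => [|i u v _ <-]; first exact: fcoord0.
by rewrite cP.2.
Qed.
End FCoord.

(** This bounds the dimension of [M] over [F] by [d]. The least such [d], taken by [mdim], is the
    dimension itself, with value 0 by convention when [M] is not finitely generated. *)
Definition hasdim M d := exists c : M -> 'rV[F]_d, fcoord c.

Lemma fcoord_space d M (c : M -> 'rV[F]_d) (S : smod M) : fcoord c ->
  exists m : 'M[F]_d, forall u, (exists2 x, S x & c x = u) <-> (u <= m)%MS.
Proof.
move=> cP; apply: rowspace => [|a u v [x Sx <-] [y Sy <-]].
  by exists 0; [apply: smod0|apply: fcoord0].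
by exists (a%:A *: x + y); [apply: smodL|rewrite cP.2].
Qed.

Lemma hasdim_sub d n M (c : M -> 'rV[F]_d) (m : 'M[F]_(n, d)) : fcoord c ->
  (forall x, (c x <= m)%MS) -> hasdim M (\rank m).
Proof.
move=> cP cm; exists (fun x => c x *m pinvmx (row_base m)); split=> [x y e|a x y].
  apply: cP.1; have h z : c z *m pinvmx (row_base m) *m row_base m = c z.
    by apply: mulmxKpV; rewrite eq_row_base.
  by rewrite -(h x) -(h y) e.
by rewrite cP.2 mulmxDl scalemxAl.
Qed.

Lemma hasdim_fin_gen M d : hasdim M d -> fin_gen M.
Proof.
move=> [c cP].
pose top : smod M := @Smod _ _ M (fun _ => True) I (fun _ _ _ _ _ => I).
have [m mP] := fcoord_space top cP.
have rowm i : exists y, c y = row i m.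
  by have [y _ yE] := (mP (row i m)).2 (row_sub i m); exists y.
have [y yE] := choice rowm; exists d, y => x.
have cx : (c x <= m)%MS by apply/mP; exists x.
have /submxP[w we] := cx.
exists (fun i => (w 0 i)%:A); apply: cP.1; rewrite fcoord_sum // we mulmx_sum_row.
by apply: eq_bigr => i _; rewrite yE.
Qed.

(** [M] is an [F]-quotient of a coordinate space of dimension [n * dim A]. A set-theoretic section
    [r] becomes [F]-linear and injective once it is followed by the cokernel matrix of the
    kernel. *)
Lemma fin_gen_hasdim M : fin_gen M -> exists d, hasdim M d.
Proof.
move=> [n [g gP]]; pose D := dim A.
pose phi (u : 'rV[F]_(n * D)) : M := \sum_i @r2v F A (row i (vec_mx u)) *: g i.
have phiL a u v : phi (a *: u + v) = a%:A *: phi u + phi v.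
  rewrite /phi scaler_sumr -big_split; apply: eq_bigr => i _ /=.
  by rewrite !linearP /= scalerDl scalerA mulr_algl.
have phiS x : exists u, phi u = x.
  have [k ->] := gP x; exists (mxvec (\matrix_i v2r (k i))).
  by apply: eq_bigr => i _; rewrite mxvecK rowK v2rK.
have [r rK] := choice phiS.
have phi0 : phi 0 = 0.
  by rewrite /phi big1 // => i _; rewrite !linear0 scale0r.
have [|a u v pu pv|m mP] := @rowspace _ (fun u => phi u = 0); first exact: phi0.
  by rewrite phiL pu pv scaler0 addr0.
have phiB u v : phi (u - v) = phi u - phi v.
  by have := phiL (-1) v u; rewrite !scaleN1r ![- _ + _]addrC.
have cE u v : phi u = phi v -> u *m cokermx m = v *m cokermx m.
  move=> e; apply/eqP; rewrite -subr_eq0 -mulmxBl -submxE; apply/mP.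
  by rewrite phiB e subrr.
exists (n * D)%N, (fun x => r x *m cokermx m); split=> [x y e|a x y].
  rewrite -(rK x) -(rK y); apply/eqP; rewrite -subr_eq0 -phiB.
  by apply/eqP/mP; rewrite submxE mulmxBl e subrr.
by rewrite scalemxAl -mulmxDl; apply: cE; rewrite phiL !rK.
Qed.

Lemma hasdim_ex M : fin_gen M -> exists d, `[< hasdim M d >].
Proof. by move=> /fin_gen_hasdim[d hd]; exists d; apply/asboolP. Qed.

Definition mdim M : nat :=
  if pselect (fin_gen M) is left h then ex_minn (hasdim_ex h) else 0%N.

Lemma mdimP M : fin_gen M -> hasdim M (mdim M).
Proof.
rewrite /mdim; case: pselect => // h _; by case: ex_minnP => d /asboolP.
Qed.

Lemma mdim_le M d : hasdim M d -> (mdim M <= d)%N.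
Proof.
move=> hd; rewrite /mdim; case: pselect => // h.
by case: ex_minnP => n _; apply; apply/asboolP.
Qed.

Lemma fin_gen_inj K M (i : {linear K -> M}) : injective i -> fin_gen M -> fin_gen K.
Proof.
move=> ii /fin_gen_hasdim[d [c cP]]; apply: (@hasdim_fin_gen _ d); exists (c \o i).
by split=> [|a x y] /=; [exact: inj_comp cP.1 ii|rewrite linearP cP.2].
Qed.

Lemma fin_gen_surj M Q (q : {linear M -> Q}) : surj q -> fin_gen M -> fin_gen Q.
Proof.
move=> qs [n [g gP]]; exists n, (q \o g) => y; have [x <-] := qs y.
have [k ->] := gP x; exists k; rewrite linear_sum; apply: eq_bigr => i _.
by rewrite linearZ.
Qed.

Lemma mdim_inj K M (i : {linear K -> M}) : injective i -> fin_gen M ->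
  (mdim K <= mdim M)%N.
Proof.
move=> ii /mdimP[c cP]; apply: mdim_le; exists (c \o i).
by split=> [|a x y] /=; [exact: inj_comp cP.1 ii|rewrite linearP cP.2].
Qed.

Lemma mdim_inj_lt K M (i : {linear K -> M}) : injective i -> fin_gen M ->
  ~ surj i -> (mdim K < mdim M)%N.
Proof.
move=> ii fM nsi; have [c cP] := mdimP fM.
have ciP : fcoord (c \o i).
  by split=> [|a x y] /=; [exact: inj_comp cP.1 ii|rewrite linearP cP.2].
have [m mP] := fcoord_space (imm i) cP.
have /mdim_le le : hasdim K (\rank m).
  by apply: hasdim_sub ciP _ => x /=; apply/mP; exists (i x) => //; exists x.
apply: leq_ltn_trans le _; rewrite ltn_neqAle rank_leq_row andbT; apply/negP => /eqP full.
apply: nsi => y; have := submx_full (c y); have fm : row_full m by rewrite /row_full full.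
by move=> /(_ _ m fm)/mP[x [k <-] /cP.1 <-]; exists k.
Qed.

(** [r] is the dimension of ker q: coordinates of preimages, read modulo the kernel, lie in a space
    of rank [mdim M - r]. *)
Lemma quo_hasdim M Q (q : {linear M -> Q}) : surj q -> fin_gen M ->
  exists2 r, hasdim Q (mdim M - r) & (exists2 x, q x = 0 & x <> 0) -> (0 < r)%N.
Proof.
move=> /choice[s sK] /mdimP[c cP]; have [m mP] := fcoord_space (kerm q) cP.
have cE x y : q x = q y <-> c x *m cokermx m = c y *m cokermx m.
  have cB : c (x - y) = c x - c y by have := cP.2 (-1) y x; rewrite !scaleN1r ![- _ + _]addrC.
  split=> [e|/eqP].
    apply/eqP; rewrite -subr_eq0 -mulmxBl -submxE; apply/mP; exists (x - y) => //=.
    by rewrite linearB e subrr.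
  rewrite -subr_eq0 -mulmxBl -cB -submxE => /mP[z /= qz /cP.1 zE].
  by apply/eqP; rewrite -subr_eq0 -linearB -zE qz.
exists (\rank m) => [|[x qx nx]].
  rewrite -mxrank_coker; apply: (@hasdim_sub _ _ _ (fun y => c (s y) *m cokermx m)).
    split=> [x y /cE|a x y]; first by rewrite !sK.
    by rewrite scalemxAl -mulmxDl -cP.2; apply/cE; rewrite linearP !sK.
  by move=> x; apply: submxMl.
rewrite lt0n mxrank_eq0; apply/eqP => m0; apply: nx; apply: cP.1.
rewrite (fcoord0 cP); apply/eqP; rewrite -submx0 -m0; apply/mP; by exists x.
Qed.

Lemma mdim_surj M Q (q : {linear M -> Q}) : surj q -> fin_gen M ->
  (mdim Q <= mdim M)%N.
Proof.
by move=> qs fM; have [r /mdim_le h _] := quo_hasdim qs fM; apply: leq_trans h (leq_subr _ _).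
Qed.

Lemma mdim_surj_lt M Q (q : {linear M -> Q}) : surj q -> fin_gen M ->
  (exists2 x, q x = 0 & x <> 0) -> (mdim Q < mdim M)%N.
Proof.
move=> qs fM [x qx nx]; have [r /mdim_le h] := quo_hasdim qs fM.
move=> /(_ (ex_intro2 _ _ x qx nx)) r0; apply: leq_ltn_trans h _.
rewrite ltn_subrL r0 lt0n; apply/eqP => M0.
have [c cP] := mdimP fM; apply: nx; apply: cP.1.
by move: (c x) (c 0); rewrite M0 => u v; rewrite (thinmx0 u) (thinmx0 v).
Qed.

Lemma inj_surj M (f : {linear M -> M}) : fin_gen M -> injective f -> surj f.
Proof.
move=> fM fi; apply: contrapT => ns; have := mdim_inj_lt fi fM ns; by rewrite ltnn.
Qed.

Lemma surj_inj M (f : {linear M -> M}) : fin_gen M -> surj f -> injective f.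
Proof.
move=> fM fs; apply: add_ker0_inj => x fx; apply: contrapT => nx.
have := mdim_surj_lt fs fM (ex_intro2 _ _ x fx nx); by rewrite ltnn.
Qed.

Lemma surj_bij M (f : {linear M -> M}) : fin_gen M -> surj f -> bijective f.
Proof. by move=> fM fs; apply: bij_inj_surj => //; apply: surj_inj. Qed.

Lemma surj_dim_bij M N (f : {linear M -> N}) : fin_gen M -> surj f ->
  (mdim M <= mdim N)%N -> bijective f.
Proof.
move=> fM fs le; apply: bij_inj_surj => //; apply: add_ker0_inj => x fx.
apply: contrapT => nx; have := mdim_surj_lt fs fM (ex_intro2 _ _ x fx nx).
by rewrite ltnNge le.
Qed.

Lemma inj_dim_bij M N (f : {linear M -> N}) : fin_gen N -> injective f ->
  (mdim N <= mdim M)%N -> bijective f.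
Proof.
move=> fN fi le; apply: bij_inj_surj => //; apply: contrapT => ns.
by have := mdim_inj_lt fi fN ns; rewrite ltnNge le.
Qed.

(** * Hom spaces as finite-dimensional spaces over [F] *)

Section HomCoordinates.
Context {M N : lmodType A}.
(** [F] acts on the values of a map through [a%:A], so [F]-linearity of coordinates on Hom(M, N) is
    expressed pointwise. *)
Definition hcoord D (H : {linear M -> N} -> 'rV[F]_D) :=
  (forall f g, H f = H g -> f = g) /\
  forall a (f g h : {linear M -> N}), (forall x, h x = a%:A *: f x + g x) -> H h = a *: H f + H g.

Lemma hcoord_ex : fin_gen M -> fin_gen N -> exists D (H : {linear M -> N} -> 'rV[F]_D), hcoord H.
Proof.
move=> [n [g gP]] /fin_gen_hasdim[d [c cP]].
exists (n * d)%N, (fun f => mxvec (\matrix_i c (f (g i)))); split=> [f h e|a f h k kE].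
  apply: lin_ext => x; have [w ->] := gP x; rewrite !linear_sum; apply: eq_bigr => i _.
  rewrite !linearZ; congr (_ *: _); apply: cP.1.
  by move/(can_inj mxvecK)/(congr1 (row i)): e; rewrite !rowK.
rewrite -linearP; congr mxvec; apply/row_matrixP => i.
by rewrite linearP /= !rowK kE cP.2.
Qed.

Definition hlin (a : F) (f g : {linear M -> N}) : {linear M -> N} := scal N a \o f \+ g.

Definition hcomb n (w : 'I_n -> F) (f : 'I_n -> {linear M -> N}) : {linear M -> N} :=
  linsum (fun i => scal N (w i) \o f i).

Lemma hcombE n (w : 'I_n -> F) (f : 'I_n -> {linear M -> N}) x :
  hcomb w f x = \sum_i (w i)%:A *: f i x.
Proof. by []. Qed.

Section HC.
Context {D : nat} {H : {linear M -> N} -> 'rV[F]_D} (HP : hcoord H).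

Lemma hcoord_null (f : {linear M -> N}) : (forall x, f x = 0) -> H f = 0.
Proof.
move=> f0; have := HP.2 1 f f f; rewrite !scale1r.
have e x : f x = 1 *: f x + f x by rewrite f0 scaler0 addr0.
by move=> /(_ e)/eqP; rewrite -{1}[H f]add0r (inj_eq (addIr _)) => /eqP.
Qed.

Lemma hcoord_comb n (w : 'I_n -> F) (f : 'I_n -> {linear M -> N}) :
  H (hcomb w f) = \sum_i w i *: H (f i).
Proof.
elim: n w f => [|n IH] w f.
  by rewrite big_ord0; apply: hcoord_null => x; rewrite hcombE big_ord0.
rewrite big_ord_recl -IH; apply: HP.2 => x.
by rewrite !hcombE big_ord_recl.
Qed.

Lemma hcoord_space (S : {linear M -> N} -> Prop) :
  (exists f, S f) ->
  (forall a (f g h : {linear M -> N}), S f -> S g -> (forall x, h x = a%:A *: f x + g x) -> S h) ->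
  exists m : 'M[F]_D, forall u, (exists2 f, S f & H f = u) <-> (u <= m)%MS.
Proof.
move=> [f0 Sf0] SL.
apply: rowspace => [|a u v [f Sf <-] [g Sg <-]].
  exists (hlin (-1) f0 f0).
    by apply: (SL (-1) f0 f0).
  by apply: hcoord_null => x; rewrite /= scalE !scaleN1r addNr.
exists (hlin a f g); first exact: (SL a f g).
exact: HP.2.
Qed.

Lemma hcoord_span (S : {linear M -> N} -> Prop) :
  (exists f, S f) ->
  (forall a (f g h : {linear M -> N}), S f -> S g -> (forall x, h x = a%:A *: f x + g x) -> S h) ->
  exists n (f : 'I_n -> {linear M -> N}), (forall i, S (f i)) /\
    forall g, S g -> exists w : 'I_n -> F, g = hcomb w f.
Proof.
move=> Sn SL; have [m mP] := hcoord_space Sn SL.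
have /choice[f fE] : forall i, exists f, S f /\ H f = row i m.
  by move=> i; have [f] := (mP (row i m)).2 (row_sub i m); exists f.
exists D, f; split=> [i|g Sg]; first by have [] := fE i.
have /submxP[w wE] : (H g <= m)%MS by apply/mP; exists g.
exists (fun i => w 0 i); apply: HP.1; rewrite hcoord_comb wE mulmx_sum_row.
by apply: eq_bigr => i _; have [_ ->] := fE i.
Qed.

End HC.

Lemma hom_span : fin_gen M -> fin_gen N ->
  exists n (f : 'I_n -> {linear M -> N}),
    forall g, exists w : 'I_n -> F, g = hcomb w f.
Proof.
move=> fM fN; have [D [H HP]] := hcoord_ex fM fN.
have [||n [f [_ fP]]] := @hcoord_span _ _ HP (fun _ => True) => //.
  by exists (GRing.null_fun N).
by exists n, f => g; apply: fP.
Qed.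

End HomCoordinates.
End FiniteDimension.

(** * Wide subcategories and torsion classes *)

Section WideTorsion.
Context {F : fieldType} {A : falgType F}.
Implicit Types (M N K Q X Y Z P B : lmodType A).

Fact add_subproof0 M (S T : smod M) : exists s t, [/\ S s, T t & 0 = s + t].
Proof. by exists 0, 0; split; rewrite ?addr0 //; apply: smod0. Qed.
Fact add_subproof M (S T : smod M) a x y :
  (exists s t, [/\ S s, T t & x = s + t]) -> (exists s t, [/\ S s, T t & y = s + t]) ->
  exists s t, [/\ S s, T t & a *: x + y = s + t].
Proof.
move=> [s [t [Ss Tt ->]]] [s' [t' [Ss' Tt' ->]]].
exists (a *: s + s'), (a *: t + t'); split; try exact: smodL.
by rewrite scalerDr addrACA.
Qed.
Definition sadd M (S T : smod M) :=
  @Smod _ _ M (fun x => exists s t, [/\ S s, T t & x = s + t])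
    (add_subproof0 S T) (@add_subproof M S T).

Lemma is_zero_iso M N : is_zero M -> is_zero N -> mod_iso M N.
Proof.
move=> M0 N0; exists (GRing.null_fun N : {linear M -> N}); exists (fun _ => 0) => x.
  by rewrite (M0 x).
by rewrite (N0 x).
Qed.

Lemma zero_mod_zero : is_zero (@zero_mod F A).
Proof. by move=> x; apply/rowP => -[]. Qed.

Section Wide.
Context {V : modclass A} (Vw : is_wide V).

Lemma wide_fg M : V M -> fin_gen M. Proof. by case: Vw => + _ _ _ _ _; apply. Qed.
Lemma wide_of_zero M : is_zero M -> V M.
Proof.
by move=> M0; apply: wide_iso Vw _ _ (is_zero_iso zero_mod_zero M0) (wide_zero Vw).
Qed.
Lemma wide_kerm M N (f : {linear M -> N}) : V M -> V N -> V (sub (kerm f)).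
Proof.
move=> VM VN; apply: (wide_ker Vw VM VN (f := f)); exists (incl (kerm f)).
split=> [|x]; first exact: incl_inj.
split=> [/(@incl_onto _ _ _ (kerm f))//|[y <-]]; exact: (inclP y).
Qed.
Lemma wide_quo_imm M N (f : {linear M -> N}) : V M -> V N -> V (quo (imm f)).
Proof.
move=> VM VN; apply: (wide_coker Vw VM VN (f := f)); exists (pr (imm f)).
by split=> [|x]; [exact: pr_surj|exact: prP].
Qed.
Lemma wide_sub_eq M (S S' : smod M) : (forall x, S x <-> S' x) -> V (sub S) -> V (sub S').
Proof. by move=> e; apply: (wide_iso Vw); apply: mod_iso_eq. Qed.
Lemma wide_imm M N (f : {linear M -> N}) : V M -> V N -> V (sub (imm f)).
Proof.
move=> VM VN; apply: (@wide_sub_eq _ (kerm (pr (imm f)))); first by move=> x; apply: prP.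
exact/wide_kerm/wide_quo_imm.
Qed.
Lemma wide_quo M (S : smod M) : V (sub S) -> V M -> V (quo S).
Proof.
move=> VS VM; apply: (wide_coker Vw VS VM (f := incl S)); exists (pr S).
split=> [|x]; first exact: pr_surj.
split=> [/prP/incl_onto//|[y <-]]; exact/prP/inclP.
Qed.
Lemma wide_prod M N : V M -> V N -> V (M * N)%type.
Proof.
apply: (wide_ext Vw); exists (lpair (idfun : {linear M -> M}) (GRing.null_fun N : {linear M -> N})).
exists (lsnd M N); split=> [x y []//|y|[x y]]; first by exists (0, y).
by split=> /= [->|[k [_ ->]]//]; exists x.
Qed.
Lemma pow0_zero M : is_zero (pow M 0).
Proof. by move=> x; apply: pow_ext => -[]. Qed.
Lemma powS_iso M n : mod_iso (M * pow M n)%type (pow M n.+1).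
Proof.
pose f : {linear (M * pow M n)%type -> pow M n.+1} :=
  pin (fun i : 'I_n.+1 => if unlift ord0 i is Some j then pproj j \o lsnd M (pow M n)
                 else lfst M (pow M n)).
have f0 x : pproj ord0 (f x) = x.1 by rewrite pinE unlift_none.
have fS x j : pproj (lift ord0 j) (f x) = pproj j x.2 by rewrite pinE liftK.
exists f; apply: bij_inj_surj => [[x x'] [y y'] e|y].
  congr pair; first by have := f0 (x, x'); rewrite e f0.
  by apply: pow_ext => j; have := fS (x, x') j; rewrite e fS.
have [z zE] := pow_mk (fun j => pproj (lift ord0 j) y).
exists (pproj ord0 y, z); apply: pow_ext => i.
case: (unliftP ord0 i) => [j|] ->; last by rewrite f0.
by rewrite fS; apply: zE.
Qed.
Lemma wide_pow M n : V M -> V (pow M n).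
Proof.
move=> VM; elim: n => [|n IH]; first exact/wide_of_zero/pow0_zero.
exact: wide_iso Vw _ _ (powS_iso M n) (wide_prod VM IH).
Qed.
End Wide.

Lemma fin_gen_wide : is_wide (@fin_gen F A).
Proof.
have isoP M N : mod_iso M N -> fin_gen M -> fin_gen N.
  by move=> [f /bij_surj fs]; apply: fin_gen_surj fs.
split=> //.
- by exists 0%N, (fun _ => 0) => x; exists (fun _ => 0); rewrite big_ord0 (zero_mod_zero x).
- by move=> M N f K fM _ [i [ii _]]; apply: fin_gen_inj ii fM.
- by move=> M N f Q _ fN [q [qs _]]; apply: fin_gen_surj qs fN.
move=> K M Q [i [q [ii qs ex]]] [n [g gP]] [m [h hP]].
have [r rK] := choice qs.
exists (n + m)%N, (fun j => match split j with inl a => i (g a) | inr b => r (h b) end).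
move=> x; have [d dE] := hP (q x).
have /ex[k kE] : q (x - \sum_j d j *: r (h j)) = 0.
  rewrite linearB linear_sum dE -sumrB big1 // => j _.
  by rewrite linearZ /= rK subrr.
have [c cE] := gP k.
exists (fun j => match split j with inl a => c a | inr b => d b end).
rewrite big_split_ord /=.
under eq_bigr => j _ do rewrite (unsplitK (inl j)).
under [X in _ + X]eq_bigr => j _ do rewrite (unsplitK (inr j)).
apply/eqP; rewrite -subr_eq -kE cE linear_sum; apply/eqP/eq_bigr => j _.
by rewrite linearZ.
Qed.

Section Torsion.
Context {V : modclass A} (Vw : is_wide V).

Lemma dsum_family (C : modclass A) (s : seq (lmodType A)) :
  (forall i, (i < size s)%N -> C (nth zero_mod s i)) -> C zero_mod ->
  (forall M N, C M -> C N -> C (M * N)%type) -> C (dsum s).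
Proof.
move=> + C0 CP; elim: s => //= M s IH h; apply: CP; first exact: (h 0%N).
by apply: IH => i; apply: (h i.+1).
Qed.

Lemma mk_torsion (T : modclass A) :
  (forall X, T X -> V X) -> T zero_mod ->
  (forall X Y (f : {linear X -> Y}), T X -> V Y -> surj f -> T Y) ->
  (forall X (S : smod X), V X -> T (sub S) -> T (quo S) -> T X) ->
  is_torsion V T.
Proof.
move=> TV T0 Tq Text.
have Tiso M N : mod_iso M N -> T M -> T N.
  move=> iMN TM; have [f /bij_surj fs] := iMN; apply: Tq fs => //.
  exact: wide_iso Vw _ _ iMN (TV _ TM).
have Te K M Q : is_ext K M Q -> T K -> T Q -> T M.
  move=> e TK TQ; have VM : V M := wide_ext Vw e (TV _ TK) (TV _ TQ).
  have [S [iK iQ]] := is_ext_smod e; apply: (Text _ S) => //; first exact: Tiso iK TK.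
  exact: Tiso (mod_iso_sym iQ) TQ.
split=> // M; split=> [TM|[VM [s [sT [f fs]]]]]; first exact: (Gen_self (V := WideSubcat Vw)) (TV _ TM) TM.
apply: Tq fs => //; apply: (dsum_family sT) => // X Y TX TY; apply: Te TX TY.
exists (lpair (idfun : {linear X -> X}) (GRing.null_fun Y : {linear X -> Y})).
exists (lsnd X Y); split=> [x y []//|y|[x y]]; first by exists (0, y).
by split=> /= [->|[k [_ ->]]//]; exists x.
Qed.

Section Facts.
Context {T : modclass A} (Tt : is_torsion V T).
Lemma torsion_in X : T X -> V X. Proof. by case: Tt => + _ _; apply. Qed.
Lemma torsion_is_ext K M Q : is_ext K M Q -> T K -> T Q -> T M. Proof. by case: Tt => _ + _; apply. Qed.
Lemma torsion_ext X (S : smod X) : T (sub S) -> T (quo S) -> T X.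
Proof. exact: torsion_is_ext (smod_is_ext S). Qed.
Lemma torsion_surj X Y (f : {linear X -> Y}) : T X -> V Y -> surj f -> T Y.
Proof.
move=> TX VY fs; case: Tt => _ _ ->; split=> //; exists [:: X]; split; first by case.
exists (f \o lfst X zero_mod) => y; have [x <-] := fs y; by exists (x, 0).
Qed.
Lemma torsion_iso X Y : mod_iso X Y -> T X -> T Y.
Proof.
move=> iXY TX; have [f /bij_surj fs] := iXY; apply: torsion_surj fs => //.
exact: wide_iso Vw _ _ iXY (torsion_in TX).
Qed.
Lemma torsion_zero X : is_zero X -> T X.
Proof. exact: (@tors_le0x _ _ (WideSubcat Vw) (Tors (V := WideSubcat Vw) Tt) X). Qed.
Lemma torsion_prod X Y : T X -> T Y -> T (X * Y)%type.
Proof.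
apply: torsion_is_ext; exists (lpair (idfun : {linear X -> X}) (GRing.null_fun Y : {linear X -> Y})).
exists (lsnd X Y); split=> [x y []//|y|[x y]]; first by exists (0, y).
by split=> /= [->|[k [_ ->]]//]; exists x.
Qed.
Lemma torsion_pow X n : T X -> T (pow X n).
Proof.
move=> TX; elim: n => [|n IH]; first exact/torsion_zero/pow0_zero.
by apply: (torsion_iso (powS_iso X n)); apply: torsion_prod.
Qed.
Lemma imm_corestrict X Y (f : {linear X -> Y}) :
  exists2 g : {linear X -> sub (imm f)}, surj g & forall x, incl _ (g x) = f x.
Proof.
have [g gE] := @corestrict _ _ _ _ (imm f) f (fun x => ex_intro _ x erefl).
exists g => // y; have [x xE] := inclP y; exists x; apply: incl_inj.
by rewrite gE.
Qed.
Lemma torsion_imm X Y (f : {linear X -> Y}) : T X -> V Y -> T (sub (imm f)).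
Proof.
move=> TX VY; have [g gs _] := imm_corestrict f; apply: torsion_surj gs => //.
exact: wide_imm Vw _ _ f (torsion_in TX) VY.
Qed.
Lemma torsion_sub_eq M (S S' : smod M) : (forall x, S x <-> S' x) -> T (sub S) -> T (sub S').
Proof. by move=> e; apply: torsion_iso; apply: mod_iso_eq. Qed.
Lemma torsion_add M (S S' : smod M) : V M -> T (sub S) -> T (sub S') -> T (sub (sadd S S')).
Proof.
move=> VM TS TS'; apply: (@torsion_sub_eq _ (imm (lcopair (incl S) (incl S')))); last first.
  by apply: torsion_imm => //; apply: torsion_prod.
move=> x; split=> [[[s t] <-]|[s [t [/incl_onto[s' <-] /incl_onto[t' <-] ->]]]].
  by exists (incl S s), (incl S' t); split=> //; apply: inclP.
by exists (s', t').
Qed.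

(** [S] is a submodule of [X] lying in [T], of maximal dimension. For a nonzero map from [T] to X /
    S, the preimage of its image would be a larger one, being an extension of two members of [T]. *)
Lemma torsion_pair X : V X -> exists S : smod X,
  [/\ T (sub S), V (quo S) & forall Y, T Y -> hom_zero Y (quo S)].
Proof.
move=> VX; pose Pr n := `[< exists S : smod X, T (sub S) /\ mdim (sub S) = n >].
have fX := wide_fg Vw VX.
have ex0 : exists n, Pr n.
  pose S := imm (GRing.null_fun X : {linear zero_mod -> X}).
  exists (mdim (sub S)); apply/asboolP; exists S; split=> //; apply: torsion_zero => x.
  by apply: incl_inj; have [z <-] := inclP x; rewrite linear0.
have ub n : Pr n -> (n <= mdim X)%N.
  by move=> /asboolP[S [_ <-]]; apply: mdim_inj (@incl_inj _ _ _ S) fX.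
case: (ex_maxnP ex0 ub) => d /asboolP[S [TS dS]] dmax; exists S.
have VQ : V (quo S) := wide_quo Vw (torsion_in TS) VX.
split=> // Y TY f y; apply: contrapT => fy.
pose S' := preim (pr S) (imm f).
have SS' x : S x -> S' x by move=> /prP Sx; rewrite /S' /= Sx; exists 0; rewrite linear0.
have [i iE] := @corestrict _ _ _ _ S' (incl S) (fun x => SS' _ (inclP x)).
have [q qE] := @corestrict _ _ _ _ (imm f) (pr S \o incl S') (fun x => inclP x).
have ii : injective i by move=> a b e; apply: (@incl_inj _ _ _ S); rewrite -!iE e.
have TS' : T (sub S').
  apply: (@torsion_is_ext (sub S) _ (sub (imm f))) TS (torsion_imm f TY VQ).
  exists i, q; split=> // [z|x].
    have [u uE] := pr_surj (incl _ z).
    have [x xE] : exists x, incl S' x = u.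
      by apply: incl_onto; rewrite /S' /= uE; exact: (inclP z).
    by exists x; apply: incl_inj; rewrite qE /= xE.
  split=> [qx|[k <-]].
    have : pr S (incl S' x) = 0 by rewrite -[LHS](qE x) qx linear0.
    by move=> /prP/incl_onto[k kE]; exists k; apply: incl_inj; rewrite iE.
  by apply: incl_inj; rewrite qE /= iE linear0; apply/prP/inclP.
have : (mdim (sub S') <= d)%N by apply: dmax; apply/asboolP; exists S'.
rewrite leqNgt -dS (mdim_inj_lt ii) //.
  by apply: (wide_fg Vw); apply: torsion_in.
have [u uE] := pr_surj (f y).
have [x xE] : exists x, incl S' x = u by apply: incl_onto; rewrite /S' /= uE; exists y.
move=> /(_ x)[k kx]; apply: fy; rewrite -uE -xE -kx iE; exact/prP/inclP.
Qed.
End Facts.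

End Torsion.

(** * Minimal torsion classes with a given property *)

Section Finiteness.
Context {V : modclass A} (Vw : is_wide V).

(* This recovers U on V, so torsion classes of V embed in those of mod A and
   are finite in number as well. *)
Definition hom_hull (U : modclass A) : modclass A := fun X => fin_gen X /\
  forall Y, V Y -> (forall Z, U Z -> hom_zero Z Y) -> hom_zero X Y.

Lemma hom_hull_torsion U : is_torsion fin_gen (hom_hull U).
Proof.
have fw := fin_gen_wide.
have zP X : is_zero X -> hom_hull U X.
  by move=> X0; split; [exact: wide_of_zero fw _ X0|move=> Y _ _ f x; rewrite (X0 x) linear0].
have qP X Y (f : {linear X -> Y}) : hom_hull U X -> fin_gen Y -> surj f -> hom_hull U Y.
  move=> [_ h] fY fs; split=> // Z VZ hZ g y; have [x <-] := fs y.
  exact: (h Z VZ hZ (g \o f) x).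
have eP X (S : smod X) : fin_gen X -> hom_hull U (sub S) -> hom_hull U (quo S) -> hom_hull U X.
  move=> fX [_ hS] [_ hQ]; split=> // Y VY hY f x.
  have fS z : pr S z = 0 -> f z = 0.
    by move=> /prP/incl_onto[s <-]; apply: (hS Y VY hY (f \o incl S)).
  have [g gE] := factor_surj (@pr_surj _ _ _ S) fS.
  by rewrite -gE; apply: hQ.
have z0 : hom_hull U zero_mod by apply/zP/zero_mod_zero.
have sf X : hom_hull U X -> fin_gen X by case.
exact: (mk_torsion fw).
Qed.

Lemma hom_hull_wide U X : is_torsion V U -> V X -> (hom_hull U X <-> U X).
Proof.
move=> Ut VX; split=> [[_ h]|UX].
  have [S [US VQ hQ]] := torsion_pair Vw Ut VX.
  have z x : S x by apply/prP; apply: (h (quo S) VQ hQ (pr S) x).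
  apply: torsion_surj Ut _ _ (incl S) US VX _ => x; exact/incl_onto/z.
by split=> [|Y VY]; [exact: wide_fg Vw _ VX|apply].
Qed.

(** [ms U] counts the indices of hulls of torsion classes of [V] contained in [U]. It is strictly
    monotone in [U], so descent along it terminates. *)
Lemma tors_min (C : modclass A -> Prop) : tau_tilting_finite A ->
  (exists T, is_torsion V T /\ C T) ->
  exists T, [/\ is_torsion V T, C T & forall T', is_torsion V T' -> C T' ->
    (forall X, T' X -> T X) -> forall X, T X -> T' X].
Proof.
move=> [n [t tP]] [T0 [T0t CT0]].
pose ix U i := exists U', [/\ is_torsion V U', forall X, U' X -> U X & forall M, hom_hull U' M <-> t i M].
pose ms U := #|[pred i | `[< ix U i >]]|.
have mono U1 U2 : is_torsion V U1 -> is_torsion V U2 -> (forall X, U1 X -> U2 X) ->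
    ~ (forall X, U2 X -> U1 X) -> (ms U1 < ms U2)%N.
  move=> U1t U2t U12 nU; apply: proper_card; apply/properP; split.
    apply/subsetP => i; rewrite !inE => /asboolP[U' [h1 h2 h3]].
    by apply/asboolP; exists U'; split=> // X /h2/U12.
  have [i iP] := tP _ (hom_hull_torsion U2); exists i; rewrite !inE.
    by apply/asboolP; exists U2.
  apply/asboolP => -[U' [h1 h2 h3]]; apply: nU => X U2X; apply: h2.
  have VX := torsion_in U2t U2X; apply/(hom_hull_wide h1 VX)/h3/iP/hom_hull_wide => //.
have [m] := ubnP (ms T0); elim: m T0 T0t CT0 => // m IH T Tt CT /ltnSE le.
have [[T' [T't CT' T'T nT]]|no] := pselect (exists T', [/\ is_torsion V T', C T',
    forall X, T' X -> T X & ~ forall X, T X -> T' X]).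
  by apply: (IH T') => //; apply: leq_trans le; apply: mono.
exists T; split=> // T' T't CT' T'T; apply: contrapT => nT; apply: no.
by exists T'; split.
Qed.
End Finiteness.
End WideTorsion.

(** * Jacobson radical and decomposition into indecomposables *)

Section Radical.
Context {F : fieldType} {A : falgType F}.
Implicit Types (M N K Q X Y Z P B : lmodType A).

Inductive gspan_in M (S : M -> Prop) : M -> Prop :=
| gspan0 : gspan_in S 0
| gspanD a y x : S y -> gspan_in S x -> gspan_in S (a *: y + x).

Fact gspan_subproof M (S : M -> Prop) a x y :
  gspan_in S x -> gspan_in S y -> gspan_in S (a *: x + y).
Proof.
move=> + Sy; elim=> [|b z u Sz _ IH]; first by rewrite scaler0 add0r.
by rewrite scalerDr scalerA -addrA; apply: gspanD.
Qed.
Definition gspan M (S : M -> Prop) :=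
  @Smod _ _ M (gspan_in S) (gspan0 S) (@gspan_subproof M S).

Lemma gspan_sub M (S : M -> Prop) x : S x -> gspan S x.
Proof.
by move=> Sx; rewrite -[x]scale1r -[1 *: x]addr0; apply: gspanD => //; apply: gspan0.
Qed.

Lemma gspan_min M (S : M -> Prop) (T : smod M) :
  (forall x, S x -> T x) -> forall x, gspan S x -> T x.
Proof. by move=> ST x; elim=> [|a y z /ST Ty _ Tz]; [apply: smod0|apply: smodL]. Qed.

Lemma gspan_img M N (f : {linear M -> N}) (S : M -> Prop) (T : smod N) :
  (forall x, S x -> T (f x)) -> forall x, gspan S x -> T (f x).
Proof. by move=> ST; apply: (@gspan_min _ _ (preim f T)). Qed.

Lemma mdim_smod_lt M (S S' : smod M) : fin_gen M -> (forall x, S x -> S' x) ->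
  ~ (forall x, S' x -> S x) -> (mdim (sub S) < mdim (sub S'))%N.
Proof.
move=> fM SS' nS; have [i iE] := @corestrict _ _ _ _ S' (incl S) (fun x => SS' _ (inclP x)).
have fS' : fin_gen (sub S') := fin_gen_inj (@incl_inj _ _ _ S') fM.
apply: (mdim_inj_lt (i := i)) => // [x y e|si].
  by apply: (@incl_inj _ _ _ S); rewrite -!iE e.
apply: nS => x /incl_onto[y <-]; have [z <-] := si y.
by rewrite iE; apply: inclP.
Qed.

Lemma chain_up M (N : nat -> smod M) : fin_gen M ->
  (forall n x, N n x -> N n.+1 x) -> exists n, forall x, N n.+1 x -> N n x.
Proof.
move=> fM mono; apply: contrapT => no.
have h n : (n <= mdim (sub (N n)))%N.
  elim: n => // n IH; apply: leq_ltn_trans IH _; apply: mdim_smod_lt => //; first exact: mono.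
  by move=> h; apply: no; exists n.
by have := leq_trans (h (mdim M).+1) (mdim_inj (@incl_inj _ _ _ _) fM); rewrite ltnn.
Qed.

Lemma chain_down M (N : nat -> smod M) : fin_gen M ->
  (forall n x, N n.+1 x -> N n x) -> exists n, forall x, N n x -> N n.+1 x.
Proof.
move=> fM mono; apply: contrapT => no.
have h n : (n + mdim (sub (N n)) <= mdim (sub (N 0%N)))%N.
  elim: n => // n; apply: leq_trans; rewrite addSn -addnS leq_add2l.
  apply: mdim_smod_lt => //; first exact: mono.
  by move=> h; apply: no; exists n.
have := leq_trans (leq_addr _ _) (h (mdim (sub (N 0%N))).+1); by rewrite ltnn.
Qed.

(* j lies in the radical of End M: by linearity this says that 1 - e j is
   injective, hence bijective for M finitely generated, for every e. *)
Definition jac M (j : {linear M -> M}) :=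
  forall (e : {linear M -> M}) x, x = e (j x) -> x = 0.

Section Jac.
Context {M : lmodType A}.
Lemma jac_comp_l (e j : {linear M -> M}) : jac j -> jac (e \o j).
Proof. by move=> h e' x; apply: (h (e' \o e)). Qed.
Lemma jac_comp_r (e j : {linear M -> M}) : jac j -> jac (j \o e).
Proof. by move=> h e' x xE; rewrite xE /= (h (e \o e') (e x)) ?linear0 //= -{1}xE. Qed.
Lemma jac0 : jac (GRing.null_fun M : {linear M -> M}).
Proof. by move=> e x ->; rewrite linear0. Qed.

Lemma jac_inv (fM : fin_gen M) (j : {linear M -> M}) : jac j ->
  exists u : {linear M -> M}, forall x, u (x - j x) = x.
Proof.
move=> hj; pose f : {linear M -> M} := idfun \- j.
have fi : injective f.
  by apply: add_ker0_inj => x /eqP; rewrite subr_eq0 => /eqP /(hj (idfun : {linear M -> M})).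
have [u [uK _]] := lin_inv (surj_bij fM (inj_surj fM fi)).
by exists u => x; apply: uK.
Qed.

(** If x = e (j x) + e (j' x), the inverse [u] of 1 - e j gives x = u (e (j' x)), and radicality of
    [j'] applies. *)
Lemma jac_add (fM : fin_gen M) (j j' : {linear M -> M}) : jac j -> jac j' -> jac (j \+ j').
Proof.
move=> hj hj' e x; have [u uE] := jac_inv fM (@jac_comp_l e _ hj).
move/eqP; rewrite /= linearD -subr_eq0 opprD addrA subr_eq0 => /eqP e1.
by apply: (hj' (u \o e)); rewrite /= -e1 uE.
Qed.

(** The submodule rad(End M) N. *)
Definition jspan (N : smod M) : smod M :=
  gspan (fun x => exists (j : {linear M -> M}) y, [/\ jac j, N y & x = j y]).

Definition stable (N : smod M) := forall (e : {linear M -> M}) x, N x -> N (e x).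

Lemma jspan_stable (N : smod M) : stable (jspan N).
Proof.
move=> e; apply: gspan_img => _ [j [y [hj Ny ->]]]; apply: gspan_sub.
by exists (e \o j), y; split=> //; apply: jac_comp_l.
Qed.

Lemma nakayama (fM : fin_gen M) (N1 N2 : smod M) : stable N1 -> stable N2 ->
  (forall x, N2 x -> sadd (jspan N2) N1 x) -> forall x, N2 x -> N1 x.
Proof.
move=> s1 s2 h; have [c cP] := mdimP fM; have [m mP] := fcoord_space N2 cP.
have [x0 x0N x0P] : exists2 x0 : 'I_(mdim M) -> M, forall i, N2 (x0 i) & forall y, N2 y ->
    exists (e : 'I_(mdim M) -> {linear M -> M}) z, N1 z /\ y = \sum_i e i (x0 i) + z.
  have /choice[x0 xE] : forall i, exists y, N2 y /\ c y = row i m.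
    by move=> i; have [y] := (mP (row i m)).2 (row_sub i m); exists y.
  exists x0 => [i|y Ny]; first by have [] := xE i.
  have cy : (c y <= m)%MS by apply/mP; exists y.
  have /submxP[w wE] := cy.
  exists (fun i => scal M (w 0 i)), 0; split; first exact: smod0.
  apply: cP.1; rewrite addr0 (fcoord_sum cP (fun i => w 0 i)) wE mulmx_sum_row.
  by apply: eq_bigr => i _; have [_ ->] := xE i.
elim: {c cP m mP}(mdim M) x0 x0N x0P => [|k IH] x0 x0N x0P.
  by move=> x Nx; have [e [z [Nz ->]]] := x0P x Nx; rewrite big_ord0 add0r.
apply: (IH (fun i => x0 (lift ord0 i))) => // {IH}.
have jP y : jspan N2 y -> exists (e : 'I_k.+1 -> {linear M -> M}) z,
    [/\ forall i, jac (e i), N1 z & y = \sum_i e i (x0 i) + z].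
  elim=> [|a _ w [j [y' [hj Ny ->]]] _ [e [z [he Nz ->]]]].
    exists (fun=> GRing.null_fun M : {linear M -> M}), 0; split.
    - by move=> _; apply: jac0.
    - exact: smod0.
    by rewrite big1 ?addr0.
  rewrite -linearZ /=; have [e' [z' [Nz' ->]]] := x0P _ (smodZ a Ny).
  exists (fun i => (j \o e' i) \+ e i), (j z' + z); split.
  - by move=> i; apply: jac_add => //; apply: jac_comp_r.
  - by apply: smodD => //; apply: s1.
  by rewrite linearD linear_sum addrACA -big_split.
have [s [t [/jP[e [z [he Nz ->]]] Nt E]]] := h _ (x0N ord0).
have x0E : x0 ord0 - e ord0 (x0 ord0) = \sum_i e (lift ord0 i) (x0 (lift ord0 i)) + (z + t).
  apply/eqP; rewrite subr_eq {1}E big_ord_recl; apply/eqP.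
  by rewrite -!addrA [LHS]addrC -!addrA.
have [u uE] := jac_inv fM (he ord0).
move=> y /x0P[f [w [Nw ->]]].
exists (fun i => (f ord0 \o u \o e (lift ord0 i)) \+ f (lift ord0 i)).
exists (f ord0 (u (z + t)) + w); split.
  by apply: smodD Nw; exact: (s1 _ _ (s1 _ _ (smodD Nz Nt))).
rewrite big_ord_recl -{1}(uE (x0 ord0)) x0E !linearD !linear_sum big_split /=.
by rewrite [X in X + w]addrAC -!addrA.
Qed.

Lemma jspan_full (fM : fin_gen M) (N : smod M) : stable N ->
  (forall x, N x -> jspan N x) -> forall x, N x -> x = 0.
Proof.
move=> sN h; pose Z := kerm (idfun : {linear M -> M}).
apply: (@nakayama fM Z N) => // [e x x0|x /h Jx]; first by rewrite /Z /= [x]x0 linear0.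
by exists x, 0; split; rewrite ?addr0.
Qed.

(** As the kernel of the zero endomorphism this is all of [M]. *)
Definition szero : smod M := kerm (GRing.null_fun M : {linear M -> M}).

(** The radical acts nilpotently on [M]. If each [e] with p e nonzero had a radical [j] with p e j
    nonzero, products of arbitrarily many radical maps would stay nonzero under [p]. *)
Lemma jac_kill (fM : fin_gen M) (C : lmodType A) (p : {linear M -> C}) : (exists x, p x <> 0) ->
  exists e : {linear M -> M}, (exists x, p (e x) <> 0) /\
    forall j : {linear M -> M}, jac j -> forall x, p (e (j x)) = 0.
Proof.
move=> [x0 px0]; apply: contrapT => no.
(* [N k] is the k-th power of the radical applied to [M]; the chain starts at all of [M]. *)
pose N := fix N k := if k is k'.+1 then jspan (N k') else szero.
have sN k : stable (N k) by case: k => [//|k]; apply: jspan_stable.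
have mono k x : N k.+1 x -> N k x.
  by apply: gspan_min => _ [j [y [_ Ny ->]]]; apply: sN.
have [k /(jspan_full fM (sN k)) Nk0] := chain_down fM mono.
have [e [[x pex] he]] : exists e : {linear M -> M}, (exists x, p (e x) <> 0) /\
    forall i x, N i x -> N (i + k)%N (e x).
  elim: k {Nk0} => [|k [e [pe he]]].
    by exists idfun; split=> [|i x]; [exists x0|rewrite addn0].
  have [j hj [x pejx]] : exists2 j : {linear M -> M}, jac j & exists x, p (e (j x)) <> 0.
    apply: contrapT => nj; apply: no; exists e; split=> // j hj x.
    by apply: contrapT => h; apply: nj; exists j => //; exists x.
  exists (e \o j); split=> [|i y Ny]; first by exists x.
  by rewrite addnS -addSn; apply: he; apply: gspan_sub; exists j, y.
by apply: pex; rewrite (Nk0 (e x)) ?linear0 //; apply: (he 0%N).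
Qed.
End Jac.

Lemma split_iso X Y (a : {linear X -> Y}) (b : {linear Y -> X}) :
  (forall x, b (a x) = x) -> mod_iso Y (X * sub (kerm b))%type.
Proof.
move=> ba; apply: mod_iso_sym; exists (lcopair a (incl (kerm b))).
apply: bij_inj_surj => [|y].
  apply: add_ker0_inj => -[x k]; rewrite lcopairE /= => e.
  have x0 : x = 0.
    by have := congr1 b e; rewrite linearD linear0 ba (inclP k) addr0.
  congr pair => //; apply: (@incl_inj _ _ _ (kerm b)); rewrite linear0.
  by move: e; rewrite x0 linear0 add0r.
have [k kE] : exists k, incl (kerm b) k = y - a (b y).
  by apply: incl_onto; rewrite /= linearB ba subrr.
by exists (b y, k); rewrite lcopairE kE /= addrC subrK.
Qed.

(** * Endomorphisms of indecomposable modules *)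

Section Indecomposable.
Context {X : lmodType A} (fX : fin_gen X) (iX : indecomposable X).

Lemma retract_bij Y (a : {linear Y -> X}) (b : {linear X -> Y}) :
  ~ is_zero Y -> (forall y, b (a y) = y) -> bijective b.
Proof.
move=> nY ba; case: (iX.2 _ _ (split_iso ba)) => // K0.
apply: bij_inj_surj => [|y]; last by exists (a y).
apply: add_ker0_inj => x /(@incl_onto _ _ _ (kerm b))[k <-].
by rewrite (K0 k) linear0.
Qed.

Definition hpow (h : {linear X -> X}) n : {linear X -> X} :=
  iter n (fun f : {linear X -> X} => h \o f) idfun.
Lemma hpowD h m n x : hpow h (m + n) x = hpow h m (hpow h n x).
Proof. by elim: m => //= m ->. Qed.

(** Fitting's lemma: once the kernels of the powers of [h] stabilise, at g = h^n, the module is the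
    direct sum of ker g and im g, and one of the two is zero. *)
Lemma fitting (h : {linear X -> X}) :
  injective h \/ exists n, forall x, hpow h n x = 0.
Proof.
have mono n x : kerm (hpow h n) x -> kerm (hpow h n.+1) x by move=> /= ->; rewrite linear0.
have [n nP] := chain_up fX mono.
have st m x : hpow h (n + m) x = 0 -> hpow h n x = 0.
  elim: m => [|m IH]; first by rewrite addn0.
  by rewrite addnS -addSn hpowD => /nP; rewrite /= -hpowD; exact: IH.
pose g := hpow h n; pose K := kerm g; pose I := imm g.
have gg y : g (g y) = 0 -> g y = 0 by rewrite -hpowD; apply: st.
have [gI gIE] := @corestrict _ _ _ _ I (g \o incl I) (fun x => ex_intro _ (incl I x) erefl).
have gI_surj : surj gI.
  apply: inj_surj; first exact: fin_gen_inj (@incl_inj _ _ _ I) fX.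
  apply: add_ker0_inj => y gy; apply: (@incl_inj _ _ _ I); rewrite linear0.
  have : g (incl I y) = 0 by rewrite -[LHS]gIE gy linear0.
  by have [z <-] := inclP y; apply: gg.
have iso : mod_iso X (sub K * sub I)%type.
  apply: mod_iso_sym; exists (lcopair (incl K) (incl I)); apply: bij_inj_surj => [|x].
    apply: add_ker0_inj => -[k i]; rewrite lcopairE /= => e.
    have gi : g (incl I i) = 0.
      by have := congr1 g e; rewrite linearD linear0 [g _](inclP k) add0r.
    have i0 : incl I i = 0 by move: gi; have [z <-] := inclP i; apply: gg.
    congr pair; [apply: (@incl_inj _ _ _ K)|apply: (@incl_inj _ _ _ I)]; rewrite linear0 //.
    by move: e; rewrite i0 addr0.
  have [i0 i0E] : exists i, incl I i = g x by apply: incl_onto; exists x.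
  have [i1 i1E] := gI_surj i0.
  have [k kE] : exists k, incl K k = x - incl I i1.
    apply: incl_onto; rewrite /K /= linearB -i0E -i1E gIE; exact: subrr.
  by exists (k, i1); rewrite lcopairE kE /= subrK.
case: (iX.2 _ _ iso) => [K0|I0]; [left|right].
  apply: add_ker0_inj => x hx.
  have /nP/(@incl_onto _ _ _ K)[k <-] : hpow h n.+1 x = 0.
    by rewrite -addn1 hpowD /= hx linear0.
  by rewrite (K0 k) linear0.
exists n => x; have [i iE] : exists i, incl I i = g x by apply: incl_onto; exists x.
by rewrite -[LHS]iE (I0 i) linear0.
Qed.

(** End X is local: if x = g (e x), then [g \o e] fixes x; it is not injective since [e] is not
    bijective, hence it is nilpotent and x = 0. *)
Lemma nonbij_jac (e : {linear X -> X}) : ~ bijective e -> jac e.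
Proof.
move=> ne g x xE; have [hi|[n hn]] := fitting (g \o e).
  case: ne; apply: (surj_bij fX); apply: (inj_surj fX) => y z yz.
  by apply: hi; rewrite /= yz.
have h m : hpow (g \o e) m x = x by elim: m => //= m ->.
by rewrite -(h n).
Qed.

Lemma jac_nonbij (e : {linear X -> X}) : jac e -> ~ bijective e.
Proof.
move=> he /lin_inv[g [eg ge]]; apply: iX.1 => x; apply: (he g).
by rewrite eg.
Qed.

(** Otherwise all [f i] are radical and X = rad(End X) X, which Nakayama's lemma excludes. *)
Lemma generated_bij n (f : 'I_n -> {linear X -> X}) :
  (forall x, exists m, x = \sum_i f i (m i)) -> exists i, bijective (f i).
Proof.
move=> fP; apply: contrapT => no; apply: iX.1 => x.
apply: (@jspan_full X fX (szero (M := X))) => // {}x _; have [m ->] := fP x.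
apply: smod_sum => i; apply: gspan_sub; exists (f i), (m i); split=> //.
by apply: nonbij_jac => bf; apply: no; exists i.
Qed.
End Indecomposable.

Definition decomposition M (I : finType) (X : I -> lmodType A)
    (io : forall k, {linear X k -> M}) (pi : forall k, {linear M -> X k}) :=
  [/\ forall k, indecomposable (X k), forall k x, pi k (io k x) = x,
      forall k l x, k != l -> pi k (io l x) = 0
    & forall x, x = \sum_k io k (pi k x)].

Lemma decomposition_ex M : fin_gen M ->
  exists (I : finType) (X : I -> lmodType A) io pi, @decomposition M I X io pi.
Proof.
have [n] := ubnP (mdim M); elim: n M => // n IH M /ltnSE le fM.
have [M0|nM0] := pselect (is_zero M).
  exists void, (fun k : void => match k with end), (fun k : void => match k with end).
  exists (fun k : void => match k with end); split=> [[]//|[]//|[]//|x].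
  by rewrite big_pred0 // => -[].
have [iM|] := pselect (indecomposable M).
  exists unit, (fun=> M), (fun=> idfun), (fun=> idfun); split; [by []|by []|by case=> -[]|move=> x].
  by rewrite (big_pred1 tt) // => -[].
move=> niM; have [X [Y [iXY nX nY]]] : exists X Y, [/\ mod_iso M (X * Y)%type, ~ is_zero X & ~ is_zero Y].
  apply: contrapT => no; apply: niM; split=> // X Y iXY.
  have [|nX] := pselect (is_zero X); first by left.
  have [|nY] := pselect (is_zero Y); first by right.
  by case: no; exists X, Y.
have [f /lin_inv[g [fK gK]]] := iXY.
pose aX : {linear X -> M} := g \o lpair (idfun : {linear X -> X}) (GRing.null_fun Y : {linear X -> Y}).
pose aY : {linear Y -> M} := g \o lpair (GRing.null_fun X : {linear Y -> X}) (idfun : {linear Y -> Y}).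
pose bX : {linear M -> X} := lfst X Y \o f.
pose bY : {linear M -> Y} := lsnd X Y \o f.
have abX x : bX (aX x) = x by rewrite /bX /aX /= gK.
have abY x : bY (aY x) = x by rewrite /bY /aY /= gK.
have bXY y : bX (aY y) = 0 by rewrite /bX /aY /= gK.
have bYX y : bY (aX y) = 0 by rewrite /bY /aX /= gK.
have ab x : x = aX (bX x) + aY (bY x).
  have fa u : f (aX u) = (u, 0) by rewrite /aX /= gK.
  have fb u : f (aY u) = (0, u) by rewrite /aY /= gK.
  apply: (can_inj fK); rewrite linearD fa fb /bX /bY /=; case: (f x) => u v.
  by rewrite -[RHS]/(u + 0, 0 + v) addr0 add0r.
have lt Z Z' (a : {linear Z -> M}) (b : {linear M -> Z}) (b' : {linear M -> Z'}) (a' : {linear Z' -> M}) :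
    (forall x, b (a x) = x) -> (forall x, b' (a' x) = x) -> (forall x, b' (a x) = 0) -> ~ is_zero Z' ->
    (mdim Z < n)%N /\ fin_gen Z.
  move=> ba ba' b'a nZ'; have ai : injective a by apply: can_inj ba.
  split; last exact: fin_gen_inj ai fM.
  apply: leq_trans le; apply: (mdim_inj_lt (i := a)) => // sa; apply: nZ' => z.
  by rewrite -(ba' z); have [x <-] := sa (a' z).
have [ltX fgX] := lt _ _ _ _ _ _ abX abY bYX nY.
have [ltY fgY] := lt _ _ _ _ _ _ abY abX bXY nX.
have [I [XI [ioI [piI [h1 h2 ho h3]]]]] := IH X ltX fgX.
have [J [XJ [ioJ [piJ [k1 k2 ko k3]]]]] := IH Y ltY fgY.
pose XX (s : (I + J)%type) := match s with inl i => XI i | inr j => XJ j end.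
pose io (s : (I + J)%type) : {linear XX s -> M} :=
  match s with inl i => aX \o ioI i | inr j => aY \o ioJ j end.
pose pi (s : (I + J)%type) : {linear M -> XX s} :=
  match s with inl i => piI i \o bX | inr j => piJ j \o bY end.
exists (I + J)%type, XX, io, pi; split=> [[]//|[i|j] x|[i|j] [i'|j'] x ne|x].
- exact: etrans (congr1 (piI i) (abX _)) (h2 i x).
- exact: etrans (congr1 (piJ j) (abY _)) (k2 j x).
- exact: etrans (congr1 (piI i) (abX _)) (ho i i' x ne).
- exact: etrans (congr1 (piI i) (bXY _)) (linear0 _).
- exact: etrans (congr1 (piJ j) (bYX _)) (linear0 _).
- exact: etrans (congr1 (piJ j) (abY _)) (ko j j' x ne).
rewrite big_sumType {1}(ab x) {1}(h3 (bX x)) {1}(k3 (bY x)) !linear_sum.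
by congr (_ + _).
Qed.
End Radical.

(** * Projectivity and the class Hom(-, tau M) = 0 *)

Section Projectives.
Context {F : fieldType} {A : falgType F}.
Implicit Types (M N K Q X Y Z P B E : lmodType A).

Lemma pow_dsum M n : exists f : {linear pow M n -> dsum (nseq n M)}, bijective f.
Proof.
elim: n => [|n [f bf]].
  exact: (is_zero_iso (@pow0_zero _ _ M) zero_mod_zero).
have [g bg] := mod_iso_sym (powS_iso M n); have [f' [fK f'K]] := lin_inv bf.
exists (lpair (lfst M (pow M n)) (f \o lsnd M (pow M n)) \o g).
apply: bij_comp => //; exists (lpair (lfst M _) (f' \o lsnd M _)) => -[x y].
  by rewrite !lpairE /= fK.
by rewrite !lpairE /= f'K.
Qed.

Lemma surj_comp M N K (f : {linear N -> K}) (g : {linear M -> N}) :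
  surj f -> surj g -> surj (f \o g).
Proof. by move=> fs gs y; have [x <-] := fs y; have [z <-] := gs x; exists z. Qed.

Lemma Gen1_pow V M X : Gen1 V M X <->
  V X /\ exists n (f : {linear pow M n -> X}), surj f.
Proof.
split=> [[VX [s [sM [f fs]]]]|[VX [n [f fs]]]]; last first.
  split=> //; exists (nseq n M); split=> [i|].
    by rewrite size_nseq => lt; rewrite nth_nseq lt; apply: mod_iso_refl.
  have [g /lin_inv[h [gK hK]]] := pow_dsum M n; exists (f \o h).
  by apply: surj_comp => // y; exists (g y).
split=> //; suff [g gs] : exists g : {linear pow M (size s) -> dsum s}, surj g.
  by exists (size s), (f \o g); apply: surj_comp.
elim: s sM {f fs} => [|N s IH] sM.
  by exists (GRing.null_fun zero_mod) => y; exists 0; rewrite (zero_mod_zero y).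
have [|g gs] := IH; first by move=> i; apply: (sM i.+1).
have [h /bij_surj hs] := sM 0%N isT; have [k /bij_surj ks] := mod_iso_sym (powS_iso M (size s)).
exists (lpair (h \o lfst M _) (g \o lsnd M _) \o k); apply: surj_comp => // -[x y].
by have [x' <-] := hs x; have [y' <-] := gs y; exists (x', y').
Qed.

(* Ext-projectivity: extensions of M by members of T split; M need not be in T. *)
Definition eproj (V T : modclass A) M := V M /\ forall E (q : {linear E -> M}),
  V E -> surj q -> T (sub (kerm q)) -> exists h : {linear M -> E}, forall x, q (h x) = x.

(* The class D_sigma of silting theory. *)
Definition Dcl (V : modclass A) Q1 Q0 (s : {linear Q1 -> Q0}) : modclass A := fun Y =>
  V Y /\ forall u : {linear Q1 -> Y}, exists v : {linear Q0 -> Y}, forall x, v (s x) = u x.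

(* By the Auslander-Smalo criterion Hom(Y, tau M) = 0 amounts to the splitting
   of all extensions of M by quotients of Y; see tau_Dtau below. *)
Definition Dtau (V : modclass A) M : modclass A := fun Y => V Y /\
  forall E (q : {linear E -> M}), V E -> surj q ->
    (exists g : {linear Y -> sub (kerm q)}, surj g) ->
    exists h : {linear M -> E}, forall x, q (h x) = x.

Section Wide.
Context {V : modclass A} (Vw : is_wide V).

(** [g] need not be onto: the lifting takes place over its image, which lies in [V] because [V] is
    wide. *)
Lemma proj_lift P X Y (g : {linear X -> Y}) (f : {linear P -> Y}) :
  projective V P -> V X -> V Y -> (forall p, exists x, g x = f p) ->
  exists h : {linear P -> X}, forall p, g (h p) = f p.
Proof.
move=> [VP hP] VX VY gf.
have [k kE] := @corestrict _ _ _ _ (imm g) f gf.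
have [g' g's g'E] := imm_corestrict g.
have [h hE] := hP _ _ g' k VX (wide_imm Vw g VX VY) g's.
by exists h => p; rewrite -g'E hE kE.
Qed.

Lemma proj_pow P n : projective V P -> projective V (pow P n).
Proof.
move=> [VP hP]; split=> [|X Y g f VX VY gs]; first exact: (wide_pow Vw).
have /choice[h hE] : forall i, exists h : {linear P -> X}, forall x, g (h x) = f (pinj i x).
  by move=> i; have [h hE] := hP _ _ g (f \o pinj i) VX VY gs; exists h.
exists (pout h) => x; rewrite poutE linear_sum.
by rewrite {2}(pow_decomp x) linear_sum; apply: eq_bigr => i _; rewrite hE.
Qed.

Lemma proj_prod P Q : projective V P -> projective V Q -> projective V (P * Q)%type.
Proof.
move=> [VP hP] [VQ hQ]; split=> [|X Y g f VX VY gs]; first exact: (wide_prod Vw).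
have [h hE] := hP _ _ g (f \o lpair (idfun : {linear P -> P}) (GRing.null_fun Q : {linear P -> Q})) VX VY gs.
have [k kE] := hQ _ _ g (f \o lpair (GRing.null_fun P : {linear Q -> P}) (idfun : {linear Q -> Q})) VX VY gs.
exists (lcopair h k) => -[x y]; rewrite lcopairE linearD hE kE /= -linearD.
by congr (f _); rewrite !mklin_funE -[LHS]/(x + 0, 0 + y) addr0 add0r.
Qed.

Lemma proj_retract P Q (a : {linear P -> Q}) (b : {linear Q -> P}) :
  V P -> (forall x, b (a x) = x) -> projective V Q -> projective V P.
Proof.
move=> VP ba [VQ hQ]; split=> // X Y g f VX VY gs.
have [h hE] := hQ _ _ g (f \o b) VX VY gs; exists (h \o a) => x.
by rewrite /= hE /= ba.
Qed.

(** Pull [g] back along [f]. The pullback maps onto [M] with kernel isomorphic to ker g, so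
    Ext-projectivity splits it, and the section followed by the projection to [X] is the lift. *)
Lemma eproj_lift (T : modclass A) M X Z (g : {linear X -> Z}) (f : {linear M -> Z}) :
  (forall K K', mod_iso K K' -> T K -> T K') -> eproj V T M -> V X -> V Z ->
  surj g -> T (sub (kerm g)) -> exists h : {linear M -> X}, forall x, g (h x) = f x.
Proof.
move=> Tiso [VM hM] VX VZ gs Tk.
pose d : {linear (X * M)%type -> Z} := lcopair g (\- f).
pose E := kerm d; pose q : {linear sub E -> M} := lsnd X M \o incl E.
pose p : {linear sub E -> X} := lfst X M \o incl E.
have pq e : g (p e) = f (q e).
  by apply/eqP; rewrite -subr_eq0; apply/eqP; exact: (inclP e).
have mkE x m : g x = f m -> exists e, p e = x /\ q e = m.
  move=> e; have [|y yE] := @incl_onto _ _ _ E (x, m).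
    by rewrite /E /d /= mklin_funE /= e subrr.
  by exists y; rewrite /p /q /= yE.
have qs : surj q by move=> m; have [x xm] := gs (f m); have [e [_ <-]] := mkE _ _ xm; exists e.
have VE : V (sub E) by apply: (wide_kerm Vw) => //; apply: (wide_prod Vw).
have [|h hE] := hM _ q VE qs; last by exists (p \o h) => x; rewrite -[LHS]/(g (p (h x))) pq hE.
apply: Tiso Tk; have [k kE] := @corestrict _ _ _ _ (kerm g) (p \o incl (kerm q))
  (fun e => etrans (pq _) (etrans (congr1 f (inclP e)) (linear0 f))).
apply: mod_iso_sym; exists k; apply: bij_inj_surj => [|x].
  apply: add_ker0_inj => e ke; apply: (@incl_inj _ _ _ (kerm q)); apply: (@incl_inj _ _ _ E).
  rewrite !linear0; have q0 : q (incl (kerm q) e) = 0 := inclP e.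
  have p0 : p (incl (kerm q) e) = 0 by rewrite -[LHS](kE e) ke linear0.
  by move: p0 q0; rewrite /p /q /=; case: (incl E _) => x m /= -> ->.
have [|e [pe qe]] := mkE (incl _ x) 0; first by rewrite linear0; exact: (inclP x).
have [y yE] := @incl_onto _ _ _ (kerm q) e qe.
by exists y; apply: (@incl_inj _ _ _ (kerm g)); rewrite kE /= yE.
Qed.

Lemma eproj_retract (T : modclass A) M X (a : {linear X -> M}) (b : {linear M -> X}) :
  (forall K K', mod_iso K K' -> T K -> T K') -> V X -> (forall x, b (a x) = x) ->
  eproj V T M -> eproj V T X.
Proof.
move=> Tiso VX ba eM; split=> // E q VE qs Tk.
have [h hE] := eproj_lift b Tiso eM VE VX qs Tk.
by exists (h \o a) => x; rewrite /= hE.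
Qed.

Lemma Gen1_sub (T : modclass A) M X : is_torsion V T -> T M -> Gen1 V M X -> T X.
Proof.
move=> Tt TM /Gen1_pow[VX [n [f fs]]].
by apply: (torsion_surj Tt) fs => //; apply: (torsion_pow Vw).
Qed.

Lemma Gen1_self M : V M -> Gen1 V M M.
Proof. by move=> VM; apply: (Gen_self (V := WideSubcat Vw)) => //; apply: mod_iso_refl. Qed.

Lemma Gen1_surj M X Y (f : {linear X -> Y}) : Gen1 V M X -> V Y -> surj f -> Gen1 V M Y.
Proof.
move=> /Gen1_pow[VX [n [g gs]]] VY fs; apply/Gen1_pow; split=> //.
by exists n, (f \o g); apply: surj_comp.
Qed.

Lemma Gen1_iso M X Y : mod_iso X Y -> Gen1 V M X -> Gen1 V M Y.
Proof.
move=> iXY GX; have [f /bij_surj fs] := iXY; apply: Gen1_surj fs => //.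
by apply: (wide_iso Vw iXY); case: GX.
Qed.

(** Only closure under extensions needs an idea: maps from [M] generating X / S lift to [X] by
    Ext-projectivity, and together with maps generating [S] they generate [X]. *)
Lemma eproj_gen M : eproj V (Gen1 V M) M -> is_torsion V (Gen1 V M).
Proof.
move=> eM; have [VM _] := eM; apply: (mk_torsion Vw).
- by move=> X [].
- split; first exact: (wide_zero Vw).
  by exists [::]; split=> //; exists idfun => y; exists y.
- by move=> X Y f; apply: Gen1_surj.
move=> X S VX /Gen1_pow[VS [n [f fs]]] /Gen1_pow[VQ [m [g gs]]].
have ks : forall i, exists h : {linear M -> X}, forall x, pr S (h x) = g (pinj i x).
  move=> i; have [||h hE] := eproj_lift (g := pr S) (g \o pinj i) _ eM VX VQ (@pr_surj _ _ _ S).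
  - exact: Gen1_iso.
  - apply/Gen1_pow; have e x : S x <-> kerm (pr S) x by rewrite /= -[_ = 0]/(pr S x = 0) prP.
    split; first exact: (wide_sub_eq Vw) e VS.
    have [k /bij_surj kk] := mod_iso_eq e; exists n, (k \o f); exact: surj_comp.
  by exists h.
have [h hE] := choice ks; apply/Gen1_pow; split=> //.
pose F0 (i : 'I_(n + m)) : {linear M -> X} :=
  match split i with inl a => incl S \o f \o pinj a | inr b => h b end.
exists (n + m)%N, (pout F0) => x.
have [z zE] := gs (pr S x).
have /prP/incl_onto[s sE] : pr S (x - \sum_i h i (pproj i z)) = 0.
  rewrite linearB linear_sum -zE {1}(pow_decomp z) linear_sum -sumrB big1 // => i _.
  by rewrite hE subrr.
have [y yE] := fs s.
have [w wE] := @pow_mk _ _ _ M (fun i : 'I_(n + m) =>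
  match split i with inl a => pproj a y | inr b => pproj b z end).
exists w; rewrite poutE big_split_ord /= /F0.
under eq_bigr => i _ do rewrite wE (unsplitK (inl i)).
under [X in _ + X]eq_bigr => i _ do rewrite wE (unsplitK (inr i)).
have -> : \sum_i (incl S \o f \o pinj i) (pproj i y) = incl S (f y).
  by rewrite {2}(pow_decomp y) !linear_sum.
by rewrite yE sE subrK.
Qed.

(** * Projective covers, presentations and the class D_s *)

Section Progenerator.
Context {P : lmodType A} (PV : progenerator V P).

Lemma proj_surj_ex X : V X -> exists Q (f : {linear Q -> X}), projective V Q /\ surj f.
Proof.
by move=> /PV.2/Gen1_pow[_ [n [f fs]]]; exists (pow P n), f; split=> //; apply: proj_pow PV.1.
Qed.

(** Take [Q] projective of least dimension mapping onto [X]. If p h has the same image as [p], lift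
    [p] through it to [k] and put e = h k. The stable image of the powers of [e] is a retract of [Q]
    that still maps onto [X], so it is all of [Q], and [h] is onto. *)
Lemma pcover_ex X : V X -> exists Q (p : {linear Q -> X}), proj_cover V p /\ surj p.
Proof.
move=> VX; pose Pr n := `[< exists Q (p : {linear Q -> X}), [/\ projective V Q, surj p & mdim Q = n] >].
have ex : exists n, Pr n.
  by have [Q [f [hQ fs]]] := proj_surj_ex VX; exists (mdim Q); apply/asboolP; exists Q, f.
case: (ex_minnP ex) => d /asboolP[Q [p [hQ ps dQ]]] dmin; exists Q, p; split=> //.
split=> // Y h VY hp; have VQ := hQ.1; have fQ := wide_fg Vw VQ.
have [k kE] : exists k : {linear Q -> Y}, forall x, p (h (k x)) = p x.
  by apply: (proj_lift (g := p \o h)) => // x; have [y yE] := hp x; exists y.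
pose e : {linear Q -> Q} := h \o k.
pose g n : {linear Q -> Q} := iter n (fun f : {linear Q -> Q} => e \o f) idfun.
have gS n x : g n.+1 x = e (g n x) by [].
have pg n x : p (g n x) = p x by elim: n => // n IH; rewrite gS /e /= kE.
have mono n y : imm (g n.+1) y -> imm (g n) y.
  have gr m x : g m.+1 x = g m (e x) by elim: m x => // m IH x; rewrite gS IH.
  by move=> [x <-]; exists (e x); rewrite gr.
have [n nP] := chain_down fQ mono; pose I := imm (g n).
have eI y : exists z, I z /\ e z = incl I y.
  by have [x xE] := nP _ (inclP y); exists (g n x); split=> //; exists x.
have [r rE] := @corestrict _ _ _ _ I (e \o incl I) (fun y =>
  mono _ _ (let: ex_intro x xE := inclP y in ex_intro _ x (congr1 e xE))).
have rs : surj r.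
  move=> y; have [z [/incl_onto[z' <-] ze]] := eI y; exists z'.
  by apply: (@incl_inj _ _ _ I); rewrite rE.
have VI : V (sub I) by apply: (wide_imm Vw).
have fI := wide_fg Vw VI.
have ps' : surj (p \o incl I).
  move=> x; have [y <-] := ps x; have [z zE] := @incl_onto _ _ _ I (g n y) (ex_intro _ y erefl).
  by exists z; rewrite /= zE pg.
have [gn [gns gnE]] : exists gn : {linear Q -> sub I}, surj gn /\ forall x, incl I (gn x) = g n x.
  by have [gn h1 h2] := imm_corestrict (g n); exists gn.
have rb n' : exists u : {linear sub I -> sub I}, forall x, u (iter n' r x) = x.
  have [u [uK _]] := lin_inv (surj_bij fI rs).
  elim: n' => [|m [w wE]]; first by exists idfun.
  by exists (w \o u) => x /=; rewrite uK wE.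
have [u uE] := rb n.
have gr m x : incl I (iter m r x) = g m (incl I x).
  by elim: m => // m IH; rewrite iterS rE gS -IH.
have rI x : (u \o gn) (incl I x) = x.
  by rewrite -[RHS]uE /=; congr (u _); apply: (@incl_inj _ _ _ I); rewrite gnE gr.
have /dmin le : Pr (mdim (sub I)).
  apply/asboolP; exists (sub I), (p \o incl I); split=> //.
  exact: proj_retract VI rI hQ.
have sI : surj (incl I).
  by apply/bij_surj/inj_dim_bij => //; [apply: incl_inj|rewrite dQ].
move=> y; have [z <-] := sI y; have [x xE] := nP _ (inclP z).
by exists (k (g n x)); rewrite -xE.
Qed.

Lemma min_pres_ex M : V M -> exists P1 P0 (p1 : {linear P1 -> P0}) (p0 : {linear P0 -> M}),
  min_proj_pres V p1 p0.
Proof.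
move=> VM; have [P0 [p0 [c0 s0]]] := pcover_ex VM.
have [P1 [q [c1 s1]]] := pcover_ex (wide_kerm Vw p0 c0.1.1 VM).
exists P1, P0, (incl (kerm p0) \o q), p0; split=> // [|x].
  split=> [|X h VX hh]; first exact: c1.1.
  apply: c1.2 => // y; have [x xE] := hh y; exists x.
  exact: (@incl_inj _ _ _ (kerm p0)).
split=> [/(@incl_onto _ _ _ (kerm p0))[k <-]|[y <-]]; last exact: (inclP (q y)).
by have [y <-] := s1 k; exists y.
Qed.

(** Quotients use projectivity of [Q1]. For an extension, extend the given map modulo [S], lift the
    result to [X] by projectivity of [Q0], and extend the remaining difference, which has values in
    [S]. *)
Lemma Dcl_torsion Q1 Q0 (s : {linear Q1 -> Q0}) :
  projective V Q1 -> projective V Q0 -> is_torsion V (Dcl V s).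
Proof.
move=> p1 p0; apply: (mk_torsion Vw).
- by move=> X [].
- split=> [|u]; first exact: (wide_zero Vw).
  by exists (GRing.null_fun _) => x; rewrite (zero_mod_zero (u x)).
- move=> X Y f [VX hX] VY fs; split=> // u.
  have [u' u'E] := p1.2 _ _ f u VX VY fs; have [v vE] := hX u'.
  by exists (f \o v) => x; rewrite /= vE u'E.
move=> X S VX [VS hS] [VQ hQ]; split=> // u.
have [v vE] := hQ (pr S \o u).
have [w wE] := p0.2 _ _ (pr S) v VX VQ (@pr_surj _ _ _ S).
have d x : S ((u \- (w \o s)) x).
  by apply/prP; rewrite /= linearB wE vE subrr.
have [u' u'E] := corestrict d; have [v' v'E] := hS u'.
by exists (w \+ (incl S \o v')) => x; rewrite /= v'E u'E /= addrC subrK.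
Qed.

(* Only for minimal presentations is this inclusion an equality. *)
Lemma Dcl_Dtau Q1 Q0 (s : {linear Q1 -> Q0}) M (c : {linear Q0 -> M}) Y :
  projective V Q1 -> projective V Q0 -> V M -> surj c ->
  (forall x, c x = 0 <-> exists y, s y = x) -> Dcl V s Y -> Dtau V M Y.
Proof.
move=> p1 p0 VM cs ck DY; split=> [|E q VE qs [g gs]]; first by case: DY.
have Vk : V (sub (kerm q)) by apply: (wide_kerm Vw).
have [_ Dk] := torsion_surj (Dcl_torsion s p1 p0) DY Vk gs.
have [f fE] := p0.2 _ _ q c VE VM qs.
have d x : kerm q ((f \o s) x) by rewrite /= fE; apply/ck; exists x.
have [u uE] := corestrict d; have [v vE] := Dk u.
have [x /ck[y <-]|h hE] := factor_surj (f := f \- (incl (kerm q) \o v)) cs.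
  by rewrite /= vE uE /= subrr.
exists h => x; have [y <-] := cs x; rewrite hE /= linearB fE.
by have -> : q (incl (kerm q) (v y)) = 0 := inclP (v y); rewrite subr0.
Qed.

(* The pushout of the presentation along u : P1 -> Y is an extension of M by a
   quotient of Y.  A splitting gives w : P0 -> Y such that u - w p1 has the same
   image as its restriction to ker p1, so ker(u - w p1) + ker p1 = P1; as p1 is
   essential, u = w p1. *)
Lemma Dtau_Dcl P1 P0 (p1 : {linear P1 -> P0}) M (p0 : {linear P0 -> M}) Y :
  V M -> min_proj_pres V p1 p0 -> Dtau V M Y -> Dcl V p1 Y.
Proof.
move=> VM [[pP0 _] s0 [pP1 es] ex] [VY hY]; split=> // u.
have [VP0 VP1] := (pP0.1, pP1.1).
pose G := imm (lpair u (\- p1)); pose E := quo G.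
have VYP : V (Y * P0)%type by apply: (wide_prod Vw).
have VE : V E by apply: (wide_quo_imm Vw).
have [|q qE] := @factor_surj _ _ _ _ _ (pr G) (p0 \o lsnd Y P0) (@pr_surj _ _ _ G).
  move=> x /prP[z <-]; rewrite /= ?mklin_funE /= linearN.
  by apply/eqP; rewrite oppr_eq0; apply/eqP/ex; exists z.
pose i : {linear Y -> E} := pr G \o lpair (idfun : {linear Y -> Y}) (GRing.null_fun P0 : {linear Y -> P0}).
pose f : {linear P0 -> E} := pr G \o lpair (GRing.null_fun Y : {linear P0 -> Y}) (idfun : {linear P0 -> P0}).
have qf x : q (f x) = p0 x by rewrite /f /= qE.
have fi z : f (p1 z) = i (u z).
  apply/(pr_eq G); exists (- z).
  by rewrite !lpairE /= !linearN opprK -[RHS]/(0 - u z, p1 z - 0) sub0r subr0.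
have ik y : kerm q (i y) by rewrite /= /i /= qE /= linear0.
have [g gE] := corestrict ik.
have gs : surj g.
  move=> k; have [[y x] yxE] := pr_surj (incl _ k).
  have eE : incl (kerm q) k = i y + f x.
    rewrite -yxE /i /f /= -linearD; congr (pr G _).
    by rewrite !mklin_funE -[RHS]/(y + 0, 0 + x) addr0 add0r.
  have /ex[z zx] : p0 x = 0.
    by have := inclP k; rewrite /= eE linearD qf [q (i y)]ik add0r.
  exists (y + u z); apply: (@incl_inj _ _ _ (kerm q)).
  by rewrite gE eE -zx fi linearD.
have qs : surj q by move=> m; have [x <-] := s0 m; exists (f x).
have [h hE] := hY E q VE qs (ex_intro _ g gs).
have [|w wE] := proj_lift (g := i) (f := f \- (h \o p0)) pP0 VY VE.
  move=> x; have [k kE] : exists k, incl (kerm q) k = (f \- (h \o p0)) x.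
    by apply: incl_onto; rewrite /= linearB qf hE subrr.
  by have [y yE] := gs k; exists y; rewrite -gE yE.
pose u' : {linear P1 -> Y} := u \- (w \o p1).
have ul z : exists2 l, p1 l = 0 & u' z = u' l.
  have : i (u' z) = 0.
    have wE' : i (w (p1 z)) = f (p1 z) - h (p0 (p1 z)) := wE _.
    rewrite -[u' z]/(u z - w (p1 z)) linearB wE' fi.
    have -> : p0 (p1 z) = 0 by apply/ex; exists z.
    by rewrite linear0 subr0 subrr.
  move=> /prP[l]; rewrite !lpairE /= => /pair_equal_spec[ul /eqP].
  rewrite oppr_eq0 => /eqP pl; exists l => //.
  by rewrite /u' /= pl linear0 subr0 ul.
have us : surj (incl (kerm u')).
  apply: es => [|z]; first exact: (wide_kerm Vw).
  have [l pl ul'] := ul z; have [k kE] : exists k, incl (kerm u') k = z - l.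
    by apply: incl_onto; rewrite /= -[_ = 0]/(u' (z - l) = 0) linearB ul' subrr.
  by exists k; rewrite kE linearB pl subr0.
exists w => z; have [k kE] := us z; apply/esym/eqP; rewrite -subr_eq0; apply/eqP.
by rewrite -[LHS]/(u' z) -kE; apply: (inclP k).
Qed.

Lemma Dtau_pres P1 P0 (p1 : {linear P1 -> P0}) M (p0 : {linear P0 -> M}) Y :
  V M -> min_proj_pres V p1 p0 -> (Dtau V M Y <-> Dcl V p1 Y).
Proof.
move=> VM mp; split; first exact: Dtau_Dcl mp.
by case: mp => [[pP0 _] s0 [pP1 _] ex]; apply: (Dcl_Dtau pP1 pP0).
Qed.

Lemma Dtau_torsion M : V M -> is_torsion V (Dtau V M).
Proof.
move=> VM; have [P1 [P0 [p1 [p0 mp]]]] := min_pres_ex VM.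
have -> : Dtau V M = Dcl V p1 by apply/predeqP => Y; exact: Dtau_pres mp.
by case: mp => [[pP0 _] _ [pP1 _] _]; apply: Dcl_torsion.
Qed.

End Progenerator.

Lemma Dtau_iso M M' Y : mod_iso M M' -> Dtau V M Y -> Dtau V M' Y.
Proof.
move=> /mod_iso_sym[f bf] [VY hY]; split=> // E q VE qs [g gs].
have e x : kerm q x <-> kerm (f \o q) x.
  by split=> /= [->|/(inj_ker0 (bij_inj bf))//]; rewrite linear0.
have [k /bij_surj ks] := mod_iso_eq e.
have fqs : surj (f \o q) by apply: surj_comp => //; apply: bij_surj.
have [|h hE] := hY E (f \o q) VE fqs.
  by exists (k \o g); apply: surj_comp.
by exists (h \o f) => x; apply: (bij_inj bf); exact: (hE (f x)).
Qed.

Lemma eproj_Dtau (T : modclass A) M X : is_torsion V T -> eproj V T M -> T X -> Dtau V M X.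
Proof.
move=> Tt [VM hM] TX; split=> [|E q VE qs [g gs]]; first exact: (torsion_in Tt).
by apply: hM => //; apply: (torsion_surj Tt) gs => //; apply: (wide_kerm Vw).
Qed.

Lemma Dtau_eproj (T : modclass A) M : V M -> (forall X, T X -> Dtau V M X) -> eproj V T M.
Proof.
move=> VM hT; split=> // E q VE qs /hT[_ h]; apply: h => //.
by exists idfun => y; exists y.
Qed.
End Wide.
End Projectives.

(** * Silting modules and mutation *)

Section Mutation.
Context {F : fieldType} {A : falgType F}.
Implicit Types (M N K Q X Y Z P B E : lmodType A).
Context {V : modclass A} (Vw : is_wide V).

Lemma Gen1_fam M X : Gen1 V M X <-> V X /\ exists n (f : 'I_n -> {linear M -> X}),
  forall x, exists m : 'I_n -> M, x = \sum_i f i (m i).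
Proof.
rewrite Gen1_pow; split=> -[VX [n [f fs]]]; split=> //; exists n.
  exists (fun i => f \o pinj i) => x; have [z <-] := fs x.
  by exists (fun i => pproj i z); rewrite {1}(pow_decomp z) linear_sum.
exists (pout f) => x; have [m ->] := fs x; have [z zE] := pow_mk m.
by exists z; rewrite poutE; apply: eq_bigr => i _; rewrite zE.
Qed.

Lemma Gen1_src M N X (q : {linear N -> M}) : surj q -> Gen1 V M X -> Gen1 V N X.
Proof.
move=> /choice[r rK] /Gen1_fam[VX [n [f fP]]]; apply/Gen1_fam; split=> //.
exists n, (fun i => f i \o q) => x; have [m ->] := fP x; exists (r \o m).
by apply: eq_bigr => i _; rewrite /= rK.
Qed.

Lemma wide_retract X M (a : {linear X -> M}) (b : {linear M -> X}) :
  (forall x, b (a x) = x) -> V M -> V X.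
Proof.
move=> ba VM; have ai : injective a by apply: can_inj ba.
apply: (wide_iso Vw (mod_iso_sym (mod_iso_sub_imm ai))).
apply: (wide_sub_eq Vw (S := imm (a \o b))); last exact: (wide_imm Vw).
by move=> x; split=> -[y <-]; [exists (b y)|exists (a y); rewrite /= ba].
Qed.

(** The span is a sum of images of maps from [T]; a submodule of it that lies in [T] and has maximal
    dimension absorbs each of these images. *)
Lemma gspan_torsion T Y (S : Y -> Prop) : is_torsion V T -> V Y ->
  (forall y, S y -> exists X (h : {linear X -> Y}), [/\ T X, forall x, S (h x) & exists x, y = h x]) ->
  T (sub (gspan S)).
Proof.
move=> Tt VY Sh; have fY := wide_fg Vw VY.
pose Pr n := `[< exists S' : smod Y,
  [/\ forall x, S' x -> gspan S x, T (sub S') & mdim (sub S') = n] >].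
have ex0 : exists n, Pr n.
  pose S0 := imm (GRing.null_fun Y : {linear zero_mod -> Y}).
  exists (mdim (sub S0)); apply/asboolP; exists S0; split=> // [_ [x <-]|]; first exact: smod0.
  by apply: (torsion_imm Vw Tt) => //; apply/(torsion_zero Vw Tt)/zero_mod_zero.
have ub n : Pr n -> (n <= mdim Y)%N.
  by move=> /asboolP[S' [_ _ <-]]; apply: mdim_inj (@incl_inj _ _ _ S') fY.
case: (ex_maxnP ex0 ub) => d /asboolP[S' [S'S TS' dS']] dmax.
apply: (torsion_sub_eq Vw Tt (S := S')) => // x; split; first exact: S'S.
apply: gspan_min => {}x Sx; have [X [h [TX hS [z xE]]]] := Sh _ Sx.
pose S2 := sadd S' (imm h).
have le y : S' y -> S2 y.
  by move=> S'y; exists y, 0; split; rewrite ?addr0 //; apply: smod0.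
have : (mdim (sub S2) <= d)%N.
  apply: dmax; apply/asboolP; exists S2; split=> // [_ [s [t [S's [u <-] ->]]]|].
    by apply: smodD; [apply: S'S|apply: gspan_sub].
  by apply: (torsion_add Vw Tt) => //; apply: (torsion_imm Vw Tt).
apply: contraPP => nS'x; apply/negP; rewrite -ltnNge -dS'; apply: mdim_smod_lt => // h2.
apply: nS'x; apply: h2; exists 0, x; split; rewrite ?add0r //; first exact: smod0.
by rewrite xE; exists z.
Qed.

Definition hom_gens X Z n (f : 'I_n -> {linear X -> Z}) := forall g : {linear X -> Z},
  exists h : 'I_n -> {linear X -> X}, forall x, g x = \sum_j f j (h j x).

Lemma hom_gens_reduce X Z n (f : 'I_n.+1 -> {linear X -> Z}) j
    (h : 'I_n.+1 -> {linear X -> X}) : hom_gens f -> (forall x, h j x = x) ->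
  (forall x, \sum_a f a (h a x) = 0) -> hom_gens (fun a => f (lift j a)).
Proof.
move=> fgen hj fh g; have [h' h'E] := fgen g.
exists (fun a => h' (lift j a) \- (h (lift j a) \o h' j)) => x.
have := fh (h' j x); rewrite (bigD1_ord j) //= hj => /eqP.
rewrite addr_eq0 => /eqP fj; rewrite h'E (bigD1_ord j) //= fj addrC -sumrB.
by apply: eq_bigr => a' _; rewrite linearB.
Qed.

Definition has_generator (T : modclass A) := exists2 Y, T Y & forall X, T X -> Gen1 V Y X.

(** [s] is a projective presentation of [M] with T = D_s = Gen M, the module form of a two-term
    silting object. The presentation may fail to be minimal. *)
Definition silting (T : modclass A) M :=
  exists Q1 Q0 (s : {linear Q1 -> Q0}) (c : {linear Q0 -> M}),
  [/\ projective V Q1 /\ projective V Q0, surj c,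
      forall x, c x = 0 <-> exists y, s y = x, forall Y, T Y <-> Dcl V s Y
    & T M /\ forall X, T X -> Gen1 V M X].

(** A Wakamatsu-type argument. Extend u : Q1 -> ker g to v : Q0 -> N. Then g v kills im s and
    factors as k c; lift [k] to [l] and replace [v] by v - l c, whose values lie in ker g and which
    agrees with [v] on im s. *)
Lemma silting_ker T M N Z (g : {linear N -> Z}) : silting T M -> V Z -> T N ->
  surj g -> (forall k : {linear M -> Z}, exists l : {linear M -> N}, forall x, g (l x) = k x) ->
  T (sub (kerm g)).
Proof.
move=> [Q1 [Q0 [s [c [[p1 p0] cs ck TD _]]]]] VZ /TD[VN DN] gs gl; apply/TD.
split=> [|u]; first exact: (wide_kerm Vw).
have [v vE] := DN (incl (kerm g) \o u).
have [x /ck[y <-]|k kE] := factor_surj (f := g \o v) cs.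
  by rewrite /= vE; apply: (inclP (u y)).
have [l lE] := gl k.
have d x : kerm g ((v \- (l \o c)) x) by rewrite /= linearB lE kE subrr.
have [w wE] := corestrict d; exists w => x; apply: (@incl_inj _ _ _ (kerm g)).
rewrite wE /= vE; have -> : c (s x) = 0 by apply/ck; exists x.
by rewrite linear0 subr0.
Qed.

Lemma silting_eproj T M : silting T M -> V M -> eproj V T M.
Proof.
move=> [Q1 [Q0 [s [c [[p1 p0] cs ck TD _]]]]] VM; apply: (Dtau_eproj VM) => X /TD.
exact: (Dcl_Dtau Vw p1 p0 VM cs ck).
Qed.

Definition left_approx (T : modclass A) P N (f : {linear P -> N}) :=
  T N /\ forall X, T X -> forall g : {linear P -> X},
    exists h : {linear N -> X}, forall x, h (f x) = g x.

Section Silting.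
Context {P : lmodType A} (PV : progenerator V P).
Context {T : modclass A} (Tt : is_torsion V T).

(** A family spanning Hom(P, Y), for a generator [Y], gives P -> Y^m. A map from [P] to a quotient
    of Y^n lifts to Y^n, where each component is a combination of the family. *)
Lemma left_approx_ex : has_generator T ->
  exists (T0 : lmodType A) (f : {linear P -> T0}), left_approx T f.
Proof.
move=> [Y TY gY]; have pP := PV.1; have VY := torsion_in Tt TY.
have [m [f fP]] := hom_span (wide_fg Vw pP.1) (wide_fg Vw VY).
exists (pow Y m), (pin f); split=> [|X /gY/Gen1_pow[VX [n [k ks]]] g].
  exact: (torsion_pow Vw Tt).
have [g' g'E] := pP.2 _ _ k g (wide_pow Vw n VY) VX ks.
have /choice[w wE] : forall i, exists w : 'I_m -> F, pproj i \o g' = hcomb w f :> {linear P -> Y}.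
  by move=> i; apply: fP.
pose H i : {linear pow Y m -> Y} := linsum (fun j => scal Y (w i j) \o pproj j).
exists (k \o pin H) => x; transitivity (k (pin H (pin f x))) => //.
rewrite -g'E; congr (k _); apply: pow_ext => i; rewrite pinE linsumE.
have := congr1 (fun h : {linear P -> Y} => h x) (wE i); rewrite hcombE /= => ->.
by apply: eq_bigr => j _; rewrite [pproj j _]pinE.
Qed.

(** Take an approximation of least dimension. If E -> T0 has its kernel in [T], a lift of [f] to [E]
    extends along [f] to h : T0 -> E. Then r = q h fixes the image of [f], so minimality makes [r]
    onto, hence bijective, and q splits. *)
Lemma min_left_approx_ex : has_generator T -> exists (T0 : lmodType A) (f : {linear P -> T0}),
  left_approx T f /\ eproj V T T0.
Proof.
move=> gT; pose Pr n := `[< exists (T0 : lmodType A) (f : {linear P -> T0}), left_approx T f /\ mdim T0 = n >].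
have ex : exists n, Pr n.
  by have [T0 [f h]] := left_approx_ex gT; exists (mdim T0); apply/asboolP; exists T0, f.
case: (ex_minnP ex) => d /asboolP[T0 [f [[TT0 fT] dT]]] dmin; exists T0, f; split=> //.
have VT0 := torsion_in Tt TT0; have fT0 := wide_fg Vw VT0.
split=> // E q VE qs Tk; have TE : T E := torsion_is_ext Tt (ext_ker qs) Tk TT0.
have [k kE] := PV.1.2 _ _ q f VE VT0 qs.
have [h hE] := fT E TE k; pose r : {linear T0 -> T0} := q \o h.
have rf x : r (f x) = f x by rewrite /r /= hE kE.
have [f1 f1E] := @corestrict _ _ _ _ (imm r) f (fun x => ex_intro _ (f x) (rf x)).
have /dmin le : Pr (mdim (sub (imm r))).
  apply/asboolP; exists (sub (imm r)), f1; split=> //.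
  split=> [|X TX g]; first exact: (torsion_imm Vw Tt).
  have [l lE] := fT X TX g; exists (l \o incl (imm r)) => x.
  by rewrite -lE /= f1E.
have si : surj (incl (imm r)).
  by apply/bij_surj/inj_dim_bij => //; [apply: incl_inj|rewrite dT].
have rs : surj r by move=> y; have [z <-] := si y; apply: (inclP z).
have [r' [r'K rK]] := lin_inv (surj_bij fT0 rs).
by exists (h \o r') => x; apply: (rK x).
Qed.

(* For a left T-approximation P -> T0 with T0 Ext-projective, T0 plus the
   cokernel is silting. *)
Lemma silting_ex : has_generator T -> exists M, silting T M.
Proof.
move=> gT; have [T0 [f [[TT0 fT] eT0]]] := min_left_approx_ex gT.
have VT0 := torsion_in Tt TT0; have [P1 [P0 [p1 [p0 mp]]]] := min_pres_ex Vw PV VT0.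
have [[pP0 _] s0 [pP1 _] ex] := mp.
have VP : V P := PV.1.1.
have [f' f'E] := PV.1.2 _ _ p0 f pP0.1 VT0 s0.
pose T1 := quo (imm f); pose M : lmodType A := (T0 * T1)%type.
(* [s2] presents the cokernel [T1] of [f]: to the relations of [T0] it adds the lifts to [P0] of the
   elements of im f. Then [s] is the direct sum of [p1] and [s2]. *)
pose s2 : {linear (P1 * P)%type -> P0} := lcopair p1 f'.
pose s : {linear (P1 * (P1 * P))%type -> (P0 * P0)%type} :=
  lpair (p1 \o lfst P1 (P1 * P)%type) (s2 \o lsnd P1 (P1 * P)%type).
pose c : {linear (P0 * P0)%type -> M} :=
  lpair (p0 \o lfst P0 P0) (pr (imm f) \o p0 \o lsnd P0 P0).
have cE x y : c (x, y) = (p0 x, pr (imm f) (p0 y)) by [].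
have s2E b p : s2 (b, p) = p1 b + f' p by [].
have sE a b p : s (a, (b, p)) = (p1 a, s2 (b, p)) by [].
(* If all maps from [P] to [X] extend along [f], the maps from [P] generating [X] can be replaced by
   maps from [T0]. *)
have genT0 X : V X -> (forall g : {linear P -> X}, exists h : {linear T0 -> X},
    forall x, h (f x) = g x) -> Gen1 V T0 X.
  move=> VX /choice[h hE]; have /Gen1_fam[_ [n [g gP]]] := PV.2 X VX.
  apply/Gen1_fam; split=> //; exists n, (fun i => h (g i)) => x.
  by have [m ->] := gP x; exists (f \o m); apply: eq_bigr => i _; rewrite /= hE.
have TT1 : T T1.
  apply: (torsion_surj Tt) TT0 _ (@pr_surj _ _ _ (imm f)); exact: (wide_quo_imm Vw).
have TM : T M by apply: (torsion_prod Tt).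
exists M, (P1 * (P1 * P))%type, (P0 * P0)%type, s, c; split.
- by split; [apply: (proj_prod Vw) => //; apply: (proj_prod Vw) => //; exact: PV.1|apply: (proj_prod Vw)].
- move=> [y z]; have [z' <-] := pr_surj z; have [x <-] := s0 y; have [x' <-] := s0 z'.
  by exists (x, x').
- move=> [x y]; split=> [|[[a [b p]] <-]]; last first.
    rewrite sE cE s2E linearD f'E.
    have -> : p0 (p1 a) = 0 by apply/ex; exists a.
    have -> : p0 (p1 b) = 0 by apply/ex; exists b.
    by rewrite add0r; congr pair; apply/(prP (imm f)); exists p.
  rewrite cE => /pair_equal_spec[/ex[a <-]].
  move=> /(prP (imm f))[p]; rewrite -f'E => /eqP; rewrite eq_sym -subr_eq0 -linearB.
  move=> /eqP/ex[b bE]; exists (a, (b, p)).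
  by rewrite sE s2E bE subrK.
(* Membership in D_s, tested on maps supported on the summand [P], yields extensions along [f] of
   all maps from [P] to [Y]; so [T0] generates [Y]. *)
- move=> Y; split=> [TY|[VY DY]]; last first.
    apply: (Gen1_sub Vw Tt TT0); apply: genT0 => // g.
    have [v vE] := DY (g \o lsnd P1 P \o lsnd P1 (P1 * P)%type).
    pose w : {linear P0 -> Y} := v \o lpair (GRing.null_fun P0 : {linear P0 -> P0}) (idfun : {linear P0 -> P0}).
    have vsE (b : P1) (p : P) : w (s2 (b, p)) = g p.
      have := vE (0, (b, p)); rewrite sE linear0 => vE'.
      exact: vE'.
    have [x /ex[b <-]|h hE] := factor_surj (f := w) s0.
      have := vsE b 0; rewrite s2E linear0 addr0 => ->; exact: linear0.
    exists h => p; rewrite -f'E hE.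
    by have := vsE 0 p; rewrite s2E linear0 add0r.
  split=> [|u]; first exact: (torsion_in Tt).
  have DY : Dcl V p1 Y by apply/(Dtau_pres Vw Y VT0 mp); apply: (eproj_Dtau Vw Tt eT0).
  have [_ hY] := DY.
  have [v1 v1E] := hY (u \o lpair (idfun : {linear P1 -> P1}) (GRing.null_fun (P1 * P)%type : {linear P1 -> (P1 * P)%type})).
  have [v2 v2E] := hY (u \o lpair (GRing.null_fun P1 : {linear P1 -> P1})
     (lpair (idfun : {linear P1 -> P1}) (GRing.null_fun P : {linear P1 -> P}))).
  pose u3 : {linear P -> Y} := u \o lpair (GRing.null_fun P1 : {linear P -> P1})
     (lpair (GRing.null_fun P1 : {linear P -> P1}) (idfun : {linear P -> P})).
  (* [v2] settles the relations of [T0]. What is missing on [P] extends along [f] to [T0], and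
     composing with [p0] leaves those relations untouched. *)
  have [h hE] := fT Y TY (u3 \- (v2 \o f')).
  exists (lcopair v1 (v2 \+ (h \o p0))) => -[a [b p]].
  rewrite sE s2E lcopairE -[X in _ + X]/(v2 (p1 b + f' p) + h (p0 (p1 b + f' p))).
  have e1 : v1 (p1 a) = u (a, (0, 0)) := v1E a.
  have e2 : v2 (p1 b) = u (0, (b, 0)) := v2E b.
  have e3 : h (f p) = u (0, (0, p)) - v2 (f' p) := hE p.
  rewrite !linearD f'E e1 e2 e3; have -> : p0 (p1 b) = 0 by apply/ex; exists b.
  rewrite linear0 add0r -[_ + v2 _ + _]addrA [v2 (f' p) + _]addrC subrK -!linearD.
  by congr (u _); rewrite -[LHS]/(a + (0 + 0), (0 + (b + 0), 0 + (0 + p))) !addr0 !add0r.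
split=> // X TX; apply: (Gen1_src (q := lfst T0 T1)) => [y|]; first by exists (y, 0).
by apply: genT0 (torsion_in Tt TX) _ => g; apply: fT.
Qed.

(** * Mutation at an indecomposable summand *)

Section Mutate.
Context {M : lmodType A} (sT : silting T M).
Context {I : finType} {X : I -> lmodType A} {io : forall k, {linear X k -> M}}.
Context {pj : forall k, {linear M -> X k}} (dM : decomposition io pj).

Let TM : T M. Proof. by case: sT => Q1 [Q0 [s [c [_ _ _ _ []]]]]. Qed.
Let genM Y : T Y -> Gen1 V M Y.
Proof. by case: sT => Q1 [Q0 [s [c [_ _ _ _ []]]]] _; apply. Qed.
Let VM : V M := torsion_in Tt TM.
Let TX k : T (X k).
Proof.
have [_ pio _ _] := dM; apply: (torsion_surj Tt (f := pj k)) TM _ _; first exact: wide_retract (pio k) VM.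
by move=> x; exists (io k x); apply: pio.
Qed.
Let fX k : fin_gen (X k) := wide_fg Vw (torsion_in Tt (TX k)).

(** The radical of the category add M evaluated at [X k]: the sum of the images of all
    non-isomorphisms from the chosen summands. *)
Definition rad k : smod (X k) := gspan (fun y =>
  exists l (h : {linear X l -> X k}), ~ bijective h /\ exists z, y = h z).

Let V_rad k : V (quo (rad k)).
Proof.
apply: (wide_quo Vw) (torsion_in Tt (TX k)); apply: (torsion_in Tt); apply: (gspan_torsion Tt (torsion_in Tt (TX k))).
move=> _ [l [h [nh [z ->]]]]; exists (X l), h; split=> // [x|]; last by exists z.
by exists l, h; split=> //; exists x.
Qed.

(** A fixed vector x of the composite with [e] gives a fixed vector pj l x of g h in End(X l). That
    endomorphism is not bijective, since otherwise [h] would split and be an isomorphism of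
    indecomposables; so it is radical and pj l x = 0. *)
Lemma rad_jac k l (h : {linear X l -> X k}) : ~ bijective h ->
  jac (io k \o h \o pj l).
Proof.
move=> nh e x xE; have [iX pio _ _] := dM.
pose g : {linear X k -> X l} := pj l \o e \o io k.
have gh : ~ bijective (g \o h).
  move=> /lin_inv[u [uK _]]; have [|v hv vh] := retract_bij (iX k) (a := h) (b := u \o g) (iX l).1.
    exact: uK.
  case: nh; have h' y : h y = v y by rewrite -(hv (h y)) /= [u (g (h y))]uK.
  by exists (u \o g) => y; [exact: uK|rewrite h'; exact: hv].
have p0 : pj l x = 0.
  have J : jac (g \o h) := nonbij_jac (fX l) (iX l) gh.
  by apply: (J idfun); rewrite /g /= -{1}xE.
by rewrite xE /= p0 !linear0.
Qed.

(** The torsion-free quotient of [M] with respect to [S] is nonzero; take a nonzero map from [M] to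
    it that kills rad(End M) M. It is nonzero on some [X i] and factors there through X i / rad,
    which therefore is not in [S]. *)
Lemma split_summand (S : modclass A) : is_torsion V S -> ~ S M ->
  exists i, ~ S (quo (rad i)).
Proof.
move=> St nSM; have [S0 [SS0 VQ hQ]] := torsion_pair Vw St VM.
have [x0 px0] : exists x, pr S0 x <> 0.
  apply: contrapT => no; apply: nSM; apply: (torsion_surj St (f := incl S0)) => // x.
  apply: incl_onto; apply/prP; apply: contrapT => h; apply: no; by exists x.
have fM := wide_fg Vw VM.
have [e [[x pex] ejac]] := jac_kill fM (ex_intro _ x0 px0).
have [iX pio _ dx] := dM.
have [i [y fy]] : exists i y, pr S0 (e (io i y)) <> 0.
  apply: contrapT => no; apply: pex; rewrite (dx x) !linear_sum big1 // => k _.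
  by apply: contrapT => h; apply: no; exists k, (pj k x).
exists i => SB; apply: fy.
have [z /prP rz|g gE] := factor_surj (q := pr (rad i)) (f := pr S0 \o e \o io i) (@pr_surj _ _ _ _).
  move: rz; apply: (gspan_min (T := kerm (pr S0 \o e \o io i))) => _ [l [h [nh [u ->]]]].
  by have := ejac _ (rad_jac nh) (io l u); rewrite /= pio.
by have := hQ _ SB g (pr _ y); rewrite gE.
Qed.

Section AtSummand.
Context {i : I} {S : modclass A} (St : is_torsion V S).
Context (ST : forall Y, S Y -> T Y) (nSB : ~ S (quo (rad i))).

(* mut_mod is M with all summands isomorphic to X i removed. *)
Definition far k := `[< ~ mod_iso (X k) (X i) >].
Fact mut_idem_linear : linear (fun x : M => \sum_(k | far k) io k (pj k x)).
Proof.
move=> a x y; rewrite scaler_sumr -big_split; apply: eq_bigr => k _ /=.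
by rewrite !linearP.
Qed.
Definition mut_idem : {linear M -> M} := mklin mut_idem_linear.
Let e := mut_idem.
Let eE x : e x = \sum_(k | far k) io k (pj k x). Proof. by []. Qed.
Let ee x : e (e x) = e x.
Proof.
have [_ pio orth _] := dM; rewrite (eE (e x)) [in RHS]eE; apply: eq_bigr => k fk.
rewrite eE linear_sum (bigD1 k) //= pio big1 ?addr0 // => l /andP[_ ne].
by rewrite orth // eq_sym.
Qed.
Let eio k x : far k -> e (io k x) = io k x.
Proof.
have [_ pio orth _] := dM; move=> fk; rewrite eE (bigD1 k) //= pio big1 ?addr0 // => l /andP[_ ne].
by rewrite orth // linear0.
Qed.
Definition mut_mod := sub (imm e).
Let U := mut_mod.
Let TU : T U. Proof. exact: (torsion_imm Vw Tt). Qed.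
Let VU : V U := torsion_in Tt TU.
Let eU : eproj V T U.
Proof.
have [b _ bE] := imm_corestrict e.
apply: (eproj_retract Vw (a := incl (imm e)) (b := b)) (silting_eproj sT VM) => //.
- exact: (torsion_iso Vw Tt).
by move=> x; apply: (@incl_inj _ _ _ (imm e)); rewrite bE; have [y <-] := inclP x; rewrite ee.
Qed.

Lemma mut_in : T mut_mod. Proof. exact: TU. Qed.

Lemma mut_torsion : is_torsion V (Gen1 V U).
Proof.
apply: (eproj_gen Vw); case: eU => _ h; split=> // E q VE qs /(Gen1_sub Vw Tt TU).
exact: h.
Qed.

Lemma mut_sub Y : Gen1 V U Y -> T Y.
Proof. exact: (Gen1_sub Vw Tt TU). Qed.

(** Summands not isomorphic to [X i] map into its radical. If they generated it, X i / rad would be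
    zero and so belong to [S]. *)
Lemma mut_proper : ~ Gen1 V U (X i).
Proof.
move=> /Gen1_fam[_ [n [f fP]]]; apply: nSB; apply: (torsion_zero Vw St) => u.
have [x <-] := pr_surj u; apply/prP; have [m ->] := fP x.
have [b _ bE] := imm_corestrict e.
apply: smod_sum => j; have -> : m j = b (incl _ (m j)).
  by apply: (@incl_inj _ _ _ (imm e)); rewrite bE; have [y <-] := inclP (m j); rewrite ee.
have -> : b (incl _ (m j)) = \sum_(k | far k) b (io k (pj k (incl _ (m j)))).
  apply: (@incl_inj _ _ _ (imm e)); rewrite bE eE linear_sum; apply: eq_bigr => k fk.
  by rewrite bE eio.
rewrite linear_sum; elim/big_ind: _ => [|? ? ? ?|k /asboolP fk]; first exact: smod0.
  exact: smodD.
apply: gspan_sub; exists k, (f j \o b \o io k); split; last by eexists; reflexivity.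
by move=> bf; apply: fk; exists (f j \o b \o io k).
Qed.

(* If Y has a nonzero quotient Z with Hom(mut_mod, Z) = 0, a minimal family
   generating Hom(X i, Z) gives a surjection of a power of X i onto Z whose
   kernel lies in T and in the radical; so X i / rad is a quotient of Z, hence
   in S. *)
Lemma mut_above Y : S Y -> Gen1 V U Y.
Proof.
move=> SY; have VY := torsion_in St SY; have Ut := mut_torsion.
have [S1 [US1 VZ hZ]] := torsion_pair Vw Ut VY.
apply: (torsion_ext Ut US1); apply: (torsion_zero Vw Ut); set Z := quo S1 => z0; apply: contrapT => nz0.
have SZ : S Z by apply: (torsion_surj St) SY VZ (@pr_surj _ _ _ S1).
have [iX pio orth dx] := dM.
have [b _ bE] := imm_corestrict e.
have far0 k (g : {linear X k -> Z}) : far k -> forall x, g x = 0.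
  move=> fk x; have := hZ _ (Gen1_self Vw VU) (g \o pj k \o incl (imm e)) (b (io k x)).
  by rewrite /= bE eio // pio.
have exn : exists n, `[< exists f : 'I_n -> {linear X i -> Z}, hom_gens f >].
  have [n [f fP]] := hom_span (fX i) (wide_fg Vw VZ); exists n; apply/asboolP; exists f => g.
  have [w ->] := fP g; exists (fun j => scal _ (w j)) => x; rewrite hcombE.
  by apply: eq_bigr => j _; rewrite linearZ.
case: (ex_minnP exn) => -[|n] /asboolP[f fgen] nmin.
  (* With no generators Hom(X i, Z) is zero, hence so is Hom(M, Z), although [Z] is a nonzero module
     in Gen M. *)
  have /Gen1_fam[_ [m [k kP]]] := genM (ST SZ); have [y yE] := kP z0.
  apply: nz0; rewrite yE big1 // => j _; rewrite (dx (y j)) linear_sum big1 // => l _.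
  have [/far0 fl|/asboolP/contrapT[t /lin_inv[t' [tK _]]]] := boolP (far l).
    exact: (fl (k j \o io l)).
  rewrite -(tK (pj l (y j))); have [h hE] := fgen (k j \o io l \o t').
  by rewrite -[LHS]/((k j \o io l \o t') (t (pj l (y j)))) hE big_ord0.
pose N := pow (X i) n.+1; pose g : {linear N -> Z} := pout f.
have lift1 l (k : {linear X l -> Z}) : exists h : {linear X l -> N}, forall x, g (h x) = k x.
  have [fl|] := boolP (far l).
    exists (GRing.null_fun N) => x; by rewrite linear0 far0.
  move=> /asboolP/contrapT[t /lin_inv[t' [tK t'K]]].
  have [h hE] := fgen (k \o t'); exists (pin h \o t) => x.
  have -> : k x = (k \o t') (t x) by rewrite /= tK.
  rewrite hE poutE.
  by apply: eq_bigr => j _; rewrite [pproj _ _]pinE.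
have liftM (k : {linear M -> Z}) : exists h : {linear M -> N}, forall x, g (h x) = k x.
  pose h l := projT1 (cid (lift1 l (k \o io l))).
  have hE l y : g (h l y) = k (io l y) := projT2 (cid (lift1 l (k \o io l))) y.
  exists (linsum (fun l => h l \o pj l)) => x; rewrite linsumE linear_sum {2}(dx x) linear_sum.
  by apply: eq_bigr => l _; apply: hE.
have TN : T N by apply: (torsion_pow Vw Tt).
have gs : surj g.
  move=> z; have /Gen1_fam[_ [m [k kP]]] := genM (ST SZ); have [y ->] := kP z.
  have /choice[h hE] : forall j, exists h : {linear M -> N}, forall x, g (h x) = k j x.
    by move=> j; apply: liftM.
  by exists (\sum_j h j (y j)); rewrite linear_sum; apply: eq_bigr => j _; apply: hE.
have TK : T (sub (kerm g)) := silting_ker sT VZ TN gs liftM.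
(* A map from [X l] to the kernel with bijective j-th component gives a relation among the [f a]
   with an invertible coefficient, against minimality of [n.+1]. *)
have Krad (j : 'I_n.+1) (x : sub (kerm g)) : rad i (pproj j (incl _ x)).
  have /Gen1_fam[_ [m [k kP]]] := genM TK; have [y ->] := kP x.
  rewrite linear_sum linear_sum; apply: smod_sum => a; rewrite (dx (y a)) !linear_sum.
  elim/big_ind: _ => [|? ? ? ?|l _]; [exact: smod0|exact: smodD|].
  pose t : {linear X l -> X i} := pproj j \o incl (kerm g) \o k a \o io l.
  apply: gspan_sub; exists l, t; split; last by exists (pj l (y a)).
  move=> /lin_inv[t' [tK t'K]].
  pose h : {linear X i -> N} := incl (kerm g) \o k a \o io l \o t'.
  have hj x' : pproj j (h x') = x' := t'K x'.
  have gh x' : g (h x') = 0 := inclP (k a (io l (t' x'))).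
  have /nmin : `[< exists f : 'I_n -> {linear X i -> Z}, hom_gens f >]; last by rewrite ltnn.
  apply/asboolP; exists (fun a' : 'I_n => f (lift (j : 'I_n.+1) a')).
  apply: (hom_gens_reduce (h := fun a => pproj a \o h)) fgen _ _ => x'; [exact: hj|exact: gh].
have [y /(@incl_onto _ _ _ (kerm g))[y' <-]|q qE] := factor_surj (f := pr (rad i) \o pproj ord0) gs.
  exact/prP/Krad.
apply: nSB; apply: (torsion_surj St (f := q)) SZ _ _ => [|B].
  exact: V_rad.
have [x <-] := pr_surj B; have [w wE] := @pow_mk _ _ n.+1 _ (fun=> x).
by exists (g w); rewrite qE /= wE.
Qed.
End AtSummand.
End Mutate.
End Silting.

Section GoodTorsion.
Hypothesis A_finite : tau_tilting_finite A.

Lemma torsion_has_generator P T : progenerator V P -> is_torsion V T -> has_generator T.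
Proof.
move=> PV Tt; have Vt : is_torsion V V := @tors_top_subproof _ _ (WideSubcat Vw).
have [|T' [T't [gT' TT'] min]] := tors_min Vw (C := fun T' => has_generator T' /\ forall X, T X -> T' X) A_finite.
  by exists V; split=> //; split=> [|X /(torsion_in Tt)//]; exists P; [exact: PV.1.1|exact: PV.2].
suff T'T X : T' X -> T X.
  suff <- : T' = T by [].
  by apply/predeqP => X; split; [apply: T'T|apply: TT'].
have [M sM] := silting_ex PV T't gT'.
have TM : T' M by case: sM => Q1 [Q0 [s [c [_ _ _ _ []]]]].
have VM := torsion_in T't TM.
have [TM'|nTM] := pselect (T M).
  case: sM => Q1 [Q0 [s [c [_ _ _ _ [_ gM]]]]] /gM; exact: (Gen1_sub Vw Tt TM').
have [I [Xs [io [pj dM]]]] := decomposition_ex (wide_fg Vw VM).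
have [i nTi] := split_summand T't sM dM Tt nTM.
(* The mutated class has a generator and contains [T], so minimality of [T'] forces it to contain
   [X i]. *)
exfalso; apply: (mut_proper dM Tt nTi).
refine (min (Gen1 V (@mut_mod M I Xs io pj i)) _ _ _ _ _).
- exact: (mut_torsion T't sM dM).
- split; last exact: (mut_above T't sM dM Tt TT' nTi).
  exists (@mut_mod M I Xs io pj i) => //; apply: (Gen1_self Vw).
  exact: (torsion_in T't (mut_in T't sM)).
- exact: (mut_sub T't sM).
have [_ pio _ _] := dM.
apply: (torsion_surj T't (f := pj i)) TM _ _; first exact: wide_retract (pio i) VM.
by move=> x; exists (io i x); apply: pio.
Qed.
End GoodTorsion.
End Mutation.

(** * Progenerators of wide subcategories *)

Section WideProgenerator.
Context {F : fieldType} {A : falgType F}.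
Implicit Types (M N K Q X Y Z P B E : lmodType A).

Lemma regular_progenerator : progenerator (@fin_gen F A) (A^o : lmodType A).
Proof.
have mL X (x : X) : linear (fun a : A^o => (a : A) *: x).
  by move=> a b c; rewrite scalerDl scalerA.
split; first split.
- by exists 1%N, (fun=> 1 : A) => x; exists (fun=> x); rewrite big_ord1 /= [RHS]mulr1.
- move=> X Y g f _ _ gs; have [x xE] := gs (f (1 : A)).
  exists (mklin (mL X x)) => a; rewrite linearZ /= xE -linearZ.
  by congr (f _); apply: mulr1.
move=> X fX; apply/(Gen1_fam); split=> //; have [n [g gP]] := fX.
by exists n, (fun i => mklin (mL X (g i))) => x; have [c ->] := gP x; exists c.
Qed.

Section Wide.
Hypothesis A_finite : tau_tilting_finite A.
Context {V : modclass A} (Vw : is_wide V).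

(* A torsion class of mod A containing V.  The quotient of an Ext-projective
   generator by the common kernel of all its maps to V is a progenerator of V. *)
Definition image_closed : modclass A := fun Y =>
  fin_gen Y /\ forall X (f : {linear Y -> X}), V X -> V (sub (imm f)).

Lemma image_closed_torsion : is_torsion fin_gen image_closed.
Proof.
have fw := @fin_gen_wide F A; apply: (mk_torsion fw).
- by move=> X [].
- split=> [|X f VX]; first exact: (wide_zero fw).
  exact: (wide_imm Vw f (wide_zero Vw) VX).
- move=> X Y f [_ hX] fY fs; split=> // Z g VZ.
  apply: (wide_sub_eq Vw (S := imm (g \o f))); last exact: hX.
  move=> z; split=> -[x <-]; first by exists (f x).
  by have [y <-] := fs x; exists y.
move=> X S fX [fS hS] [_ hQ]; split=> // Y f VY.
(* With g : X / S -> Y / I1 induced by [f], the image of [f] is the kernel of the composite of Y ->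
   Y / I1 with the cokernel of [g]. *)
pose I1 := imm (f \o incl S); have VI1 : V (sub I1) by apply: hS.
have VQ1 : V (quo I1) by apply: (wide_quo Vw).
have [x /prP/incl_onto[y <-]|g gE] := factor_surj (f := pr I1 \o f) (@pr_surj _ _ _ S).
  by apply/(prP I1); exists y.
have /(wide_quo Vw)/(_ VQ1) VQ2 : V (sub (imm g)) by apply: hQ.
apply: (wide_sub_eq Vw (S := kerm (pr (imm g) \o pr I1))); last first.
  by apply: (wide_kerm Vw) => //.
move=> y; split=> [/(prP (imm g))[u]|[x <-]].
  have [x <-] := pr_surj u; rewrite gE => /(pr_eq I1)[s sE].
  exists (x - incl S s); rewrite linearB.
  by have -> : f (incl S s) = f x - y := sE; rewrite opprB addrC subrK.
by apply/(prP (imm g)); exists (pr S x); rewrite gE.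
Qed.

Lemma wide_progenerator : exists P, progenerator V P.
Proof.
have fw := @fin_gen_wide F A; have Tt := image_closed_torsion.
have VT X : V X -> image_closed X.
  by move=> VX; split=> [|Y f VY]; [exact: (wide_fg Vw)|exact: (wide_imm Vw)].
have PA := regular_progenerator.
have [M sM] := silting_ex fw PA Tt (torsion_has_generator fw A_finite PA Tt).
have [TM gM] : image_closed M /\ forall X, image_closed X -> Gen1 fin_gen M X.
  by case: sM => Q1 [Q0 [s [c [_ _ _ _ ]]]].
have eM := silting_eproj fw sM TM.1.
pose Pr n := `[< exists X (f : {linear M -> X}), V X /\ mdim (sub (kerm f)) = n >].
have ex : exists n, Pr n.
  exists (mdim (sub (kerm (GRing.null_fun zero_mod : {linear M -> zero_mod})))).
  apply/asboolP; exists zero_mod, (GRing.null_fun zero_mod); split=> //.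
  exact: (wide_zero Vw).
case: (ex_minnP ex) => d /asboolP[X0 [f [VX0 dE]]] dmin.
(* Otherwise the kernel of the pair (f, g), again a map to [V], would be strictly smaller than ker
   f. *)
have fmin X (g : {linear M -> X}) : V X -> forall x, f x = 0 -> g x = 0.
  move=> VX x fx; apply: contrapT => gx.
  have le y : kerm (lpair f g) y -> kerm f y by rewrite /= lpairE => /pair_equal_spec[].
  suff : (mdim (sub (kerm (lpair f g))) < d)%N.
    rewrite ltnNge dmin //; apply/asboolP; exists (X0 * X)%type, (lpair f g); split=> //.
    exact: (wide_prod Vw).
  rewrite -dE; apply: mdim_smod_lt le _ => [|h]; first exact: TM.1.
  by have := h x fx; rewrite /= lpairE => /pair_equal_spec[_].
have [m ms mE] := imm_corestrict f; pose Q := sub (imm f).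
have VQ : V Q by apply: TM.2.
have fac X (g : {linear M -> X}) : V X -> exists h : {linear Q -> X}, forall x, h (m x) = g x.
  by move=> VX; apply: factor_surj ms _ => x mx; apply: fmin => //; rewrite -mE mx linear0.
exists Q; split; first split=> //.
  (* ker g lies in [V], hence in [image_closed], where [M] is Ext-projective. So [k \o m] lifts to
     [X], and the lift factors through [Q]. *)
  move=> X Y g k VX VY gs.
  have [|h hE] := eproj_lift fw (k \o m) (torsion_iso fw Tt) eM (wide_fg Vw VX) (wide_fg Vw VY) gs.
    exact/VT/(wide_kerm Vw).
  have [h' h'E] := fac X h VX; exists h' => q; have [x <-] := ms q.
  by rewrite h'E hE.
move=> X VX; have /Gen1_fam[_ [n [g gP]]] := gM X (VT X VX).
have /choice[h hE] : forall i, exists h : {linear Q -> X}, forall x, h (m x) = g i x.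
  by move=> i; apply: fac.
apply/Gen1_fam; split=> //; exists n, h => x; have [y ->] := gP x.
by exists (m \o y); apply: eq_bigr => i _; rewrite /= hE.
Qed.

Lemma torsion_eproj T : is_torsion V T ->
  exists M, [/\ T M, eproj V T M & forall X, T X <-> Gen1 V M X].
Proof.
move=> Tt; have [P PV] := wide_progenerator.
have [M sM] := silting_ex Vw PV Tt (torsion_has_generator Vw A_finite PV Tt).
have [TM gM] : T M /\ forall X, T X -> Gen1 V M X.
  by case: sM => Q1 [Q0 [s [c [_ _ _ _ ]]]].
exists M; split=> // [|X]; first exact: (silting_eproj Vw sM (torsion_in Tt TM)).
by split=> [/gM//|/(Gen1_sub Vw Tt TM)].
Qed.
End Wide.
End WideProgenerator.

(** * The Auslander-Reiten translate *)

Section ARTranslate.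
Context {F : fieldType} {A : falgType F}.
Implicit Types (M N K Q X Y Z P B E : lmodType A).

Section HomDual.
Context {P Q : lmodType A} {psi : {linear P -> Q} -> F} (hpsi : hom_dual psi).

Lemma hom_dual0 (f : {linear P -> Q}) : (forall x, f x = 0) -> psi f = 0.
Proof.
move=> f0; have e x : f x = 1%:A *: f x + f x by rewrite f0 scaler0 addr0.
have := hpsi e; rewrite mul1r => /eqP.
by rewrite -{1}[psi f]add0r (inj_eq (addIr _)) => /eqP.
Qed.

Lemma hom_dual_comb n (w : 'I_n -> F) (f : 'I_n -> {linear P -> Q}) :
  psi (hcomb w f) = \sum_i w i * psi (f i).
Proof.
elim: n w f => [|n IH] w f.
  by rewrite big_ord0; apply: hom_dual0 => x; rewrite hcombE big_ord0.
rewrite big_ord_recl -IH; apply: hpsi => x.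
by rewrite !hcombE big_ord_recl.
Qed.

Lemma hom_dual_sum n (f : 'I_n -> {linear P -> Q}) (g : {linear P -> Q}) :
  (forall x, g x = \sum_i f i x) -> psi g = \sum_i psi (f i).
Proof.
move=> gE; rewrite (_ : g = hcomb (fun=> 1) f) ?hom_dual_comb.
  by apply: eq_bigr => i _; rewrite mul1r.
apply: lin_ext => x; rewrite gE hcombE; apply: eq_bigr => i _.
by rewrite !scale1r.
Qed.
End HomDual.

Section Wide.
Context {V : modclass A} (Vw : is_wide V).

Lemma ker_cover P n X (g : {linear pow P n -> X}) : progenerator V P -> V X ->
  exists m (k : {linear pow P m -> pow P n}),
    (forall y, g (k y) = 0) /\ forall x, g x = 0 -> exists y, k y = x.
Proof.
move=> PV VX; have /PV.2/Gen1_pow[_ [m [c cs]]] := wide_kerm Vw g (wide_pow Vw n PV.1.1) VX.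
exists m, (incl (kerm g) \o c); split=> [y|x /(@incl_onto _ _ _ (kerm g))[k <-]].
  exact: (inclP (c y)).
by have [y <-] := cs k; exists y.
Qed.

Lemma AR_Dtau M N X : V M -> is_AR_translate V M N -> V X ->
  (hom_zero X N <-> Dtau V M X).
Proof.
move=> VM [VN [P [P1 [P0 [p1 [p0 [PV mp [phi [phiL phiE phi_inj phi_im]]]]]]]]] VX.
have [[pP0 _] s0 [pP1 _] ex] := mp; rewrite (Dtau_pres Vw X VM mp).
have VP := PV.1.1.
have /Gen1_pow[_ [n [G Gs]]] := PV.2 X VX.
have [m [c [Gc cG]]] := ker_cover G PV VX.
pose g i : {linear P -> X} := G \o pinj i.
pose k i j : {linear P -> P} := pproj i \o c \o pinj j.
have GE x : G x = \sum_i g i (pproj i x) by rewrite {1}(pow_decomp x) linear_sum.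
have gk j x : \sum_i g i (k i j x) = 0 by rewrite -(GE (c (pinj j x))) Gc.
have dual f : hom_dual (phi f) by have /phi_im[] : exists f', forall h, phi f' h = phi f h by exists f.
have dualr h : hom_dual (fun f => phi f h) by move=> a f f' f'' e; apply: phiL e _.
split=> [h0|[_ D] f].
  split=> // u; apply: contrapT => nu.
  (* [Psi] is a functional on Hom(P1, X) that vanishes on the maps factoring through [p1] but not on
     [u]. Its pullbacks along the [g i] correspond to maps P -> N respecting the relations of [X];
     the map X -> N they define is zero by assumption, which forces Psi u = 0. *)
  have [D [H HP]] := hcoord_ex (wide_fg Vw pP1.1) (wide_fg Vw VX).
  pose S (u : {linear P1 -> X}) := exists v : {linear P0 -> X}, forall x, v (p1 x) = u x.
  have [||B BP] := hcoord_space HP (S := S).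
  - by exists (GRing.null_fun X), (GRing.null_fun X).
  - move=> a u1 u2 u3 [v1 v1E] [v2 v2E] u3E; exists (hlin a v1 v2) => x.
    by rewrite u3E -v1E -v2E.
  have [j uj] : exists j, (H u *m cokermx B) 0 j <> 0.
    apply: contrapT => no; apply: nu.
    have /BP[u' Su' /HP.1 <-//] : (H u <= B)%MS.
    rewrite submxE; apply/eqP/rowP => j; rewrite [RHS]mxE; apply: contrapT => uj.
    by apply: no; exists j.
  pose Psi (u : {linear P1 -> X}) := (H u *m cokermx B) 0 j.
  have PsiD : hom_dual Psi.
    by move=> a u1 u2 u3 /HP.2 u3E; rewrite /Psi u3E mulmxDl -scalemxAl !mxE.
  have Psi0 u' : S u' -> Psi u' = 0.
    move=> Su'; have : (H u' <= B)%MS by apply/BP; exists u'.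
    by rewrite /Psi submxE => /eqP ->; rewrite mxE.
  have /choice[fg fgE] : forall i, exists f, forall h, phi f h = Psi (g i \o h).
    move=> i; apply/phi_im; split=> [a h1 h2 h3 h3E|h]; last first.
      by apply: Psi0; exists (g i \o h).
    by apply: PsiD => x; rewrite -[LHS]/(g i (h3 x)) h3E linearP.
  have [x /cG[y <-]|f fE] := factor_surj (f := pout fg) Gs.
    rewrite poutE; have -> : \sum_i fg i (pproj i (c y)) = \sum_j' linsum (fun i => fg i \o k i j') (pproj j' y).
      under [RHS]eq_bigr => j' _ do rewrite linsumE.
      rewrite exchange_big; apply: eq_bigr => i _.
      by rewrite {1}(pow_decomp y) !linear_sum.
    rewrite big1 // => j' _; apply: phi_inj => h.
    rewrite (hom_dual_sum (dualr h) (f := fun i => fg i \o k i j')) //.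
    under eq_bigr => i _ do rewrite phiE fgE.
    rewrite -(hom_dual_sum PsiD (g := GRing.null_fun X)) => [|x'].
      exact: (hom_dual0 PsiD).
    by rewrite /= (gk j' (h x')).
  have fg0 i x : fg i x = 0.
    have := h0 f (g i x); rewrite fE poutE (bigD1 i) //= big1 => [|l li].
      by rewrite addr0 pproj_pinj.
    by rewrite pproj_pinj_ne ?linear0.
  apply: uj; have [h hE] := pP1.2 _ _ G u (wide_pow Vw n VP) VX Gs.
  rewrite -[LHS]/(Psi u) (hom_dual_sum PsiD (f := fun i => g i \o (pproj i \o h))).
    rewrite big1 // => i _; rewrite -fgE; exact: (hom_dual0 (dualr _)).
  by move=> x; rewrite -hE GE.
suff fg0 i x0 : f (g i x0) = 0.
  by move=> x; have [y <-] := Gs x; rewrite GE linear_sum big1.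
apply: (phi_inj (f \o g i)) => h.
have [v vE] := D (g i \o h).
have [w wE] := pP0.2 _ _ G v (wide_pow Vw n VP) VX Gs.
(* The [d l] are chosen so that the sum of the g l (d l) is g i h - v p1 = 0; hence [d] factors
   through the relations [c], and the sum of the phi (f g l) (d l) vanishes. Since [phi] kills maps
   factoring through [p1], this sum is phi (f g i) h. *)
pose d l : {linear P1 -> P} :=
  (if l == i then h else GRing.null_fun P) \- (pproj l \o w \o p1).
have [L LE] : exists L : {linear P1 -> pow P m}, forall x, c (L x) = pin d x.
  apply: (proj_lift Vw pP1) => [||x]; [exact: (wide_pow Vw)|exact: (wide_pow Vw)|].
  apply: cG; rewrite GE.
  have dv l : pproj l (pin d x) = (if l == i then h x else 0) - pproj l (w (p1 x)).
    by rewrite pinE /d; case: ifP.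
  under eq_bigr => l _ do rewrite dv linearB.
  rewrite sumrB -(GE (w (p1 x))) wE vE (bigD1 i) // eqxx big1 => [|l /negbTE ->].
    by rewrite Monoid.mulm1; apply: subrr.
  exact: linear0 (g l).
have dE l x : d l x = \sum_j k l j (pproj j (L x)).
  by rewrite -[LHS]pinE -LE {1}(pow_decomp (L x)) !linear_sum.
have e1 : \sum_l phi (f \o g l) (d l) = 0.
  transitivity (\sum_l \sum_j phi (f \o g l) (k l j \o (pproj j \o L))).
    by apply: eq_bigr => l _; apply: (hom_dual_sum (dual _)) => x; apply: dE.
  rewrite exchange_big big1 // => j _.
  under eq_bigr => l _ do rewrite -phiE.
  rewrite -(hom_dual_sum (dualr _) (g := GRing.null_fun N)) => [|x].
    exact: (hom_dual0 (dualr _)).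
  by rewrite /= -linear_sum gk linear0.
have e2 l : phi (f \o g l) (d l) = (if l == i then phi (f \o g l) h else 0).
  have z : phi (f \o g l) ((pproj l \o w) \o p1) = 0.
    by have /phi_im[_ ->] : exists f', forall h, phi f' h = phi (f \o g l) h by exists (f \o g l).
  have dl x : d l x = (-1)%:A *: (pproj l \o w \o p1) x +
      (if l == i then h else GRing.null_fun P : {linear P1 -> P}) x.
    by rewrite /d !scaleN1r [RHS]addrC.
  rewrite (dual _ _ _ _ _ dl) z mulr0 add0r.
  by case: ifP => // _; apply: (hom_dual0 (dual _)).
by move: e1; rewrite (eq_bigr _ (fun l _ => e2 l)) -big_mkcond big_pred1_eq.
Qed.

(** The functionals [psi i] span D Tr M, so [Th] maps Hom(P, P^a) onto it. Maps [k j] spanning the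
    kernel serve as relations, and [N] is the cokernel of P^b -> P^a. *)
Lemma AR_ex P M : progenerator V P -> V M -> exists N, is_AR_translate V M N.
Proof.
move=> PV VM; have VP := PV.1.1; have fP := wide_fg Vw VP.
have [P1 [P0 [p1 [p0 mp]]]] := min_pres_ex Vw PV VM.
have [[pP0 _] s0 [pP1 _] ex] := mp.
pose R (psi : {linear P1 -> P} -> F) := hom_dual psi /\ forall h0 : {linear P0 -> P}, psi (h0 \o p1) = 0.
have [a [psi [psiR psiP]]] : exists a (psi : 'I_a -> {linear P1 -> P} -> F),
    (forall i, R (psi i)) /\ forall ps, R ps -> exists w, forall h, ps h = \sum_i w i * psi i h.
  have [D [H HP]] := hcoord_ex (wide_fg Vw pP1.1) fP.
  have [||m mP] := hcoord_space HP (S := fun _ => True) => //.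
    by exists (GRing.null_fun P).
  pose ev (v : 'rV[F]_D) (h : {linear P1 -> P}) := (H h *m v^T) 0 0.
  have evD v : hom_dual (ev v).
    by move=> b h1 h2 h3 /HP.2 h3E; rewrite /ev h3E mulmxDl -scalemxAl !mxE.
  have [||S SP] := @rowspace F D (fun v => forall h0 : {linear P0 -> P}, ev v (h0 \o p1) = 0).
  - by move=> h0; rewrite /ev trmx0 mulmx0 mxE.
  - move=> b u v hu hv h0; rewrite /ev linearP /= mulmxDr -scalemxAr mxE [X in X + _]mxE.
    by rewrite -![(_ *m _) 0 0]/(ev _ _) hu hv mulr0 addr0.
  exists D, (fun i => ev (row i S)); split=> [i|ps [psD ps0]].
    by split; [exact: evD|apply/SP/row_sub].
  have /choice[hh hhE] : forall i, exists h, H h = row i m.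
    by move=> i; have [h _ hE] := (mP (row i m)).2 (row_sub i m); exists h.
  pose v : 'rV[F]_D := (pinvmx m *m \col_i ps (hh i))^T.
  have vE h : ps h = ev v h.
    have Hm : (H h <= m)%MS by apply/mP; exists h.
    pose w := H h *m pinvmx m.
    have wE : H h = w *m m by rewrite mulmxKpV.
    have -> : h = hcomb (fun i => w 0 i) hh.
      apply: HP.1; rewrite (hcoord_comb HP) wE mulmx_sum_row.
      by apply: eq_bigr => i _; rewrite hhE.
    rewrite (hom_dual_comb psD) /ev (hcoord_comb HP) /v trmxK.
    under [X in (X *m _) 0 0]eq_bigr => i _ do rewrite hhE.
    rewrite -mulmx_sum_row -wE mulmxA -/w mxE.
    by apply: eq_bigr => i _; rewrite !mxE.
  have /SP/submxP[w wE] : forall h0 : {linear P0 -> P}, ev v (h0 \o p1) = 0.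
    by move=> h0; rewrite -vE.
  exists (fun i => w 0 i) => h; rewrite vE /ev wE trmx_mul mulmxA mxE.
  apply: eq_bigr => i _; rewrite mulrC [w^T _ _]mxE; congr (_ * _).
  by rewrite !mxE; apply: eq_bigr => l _; rewrite !mxE.
pose Th (f : {linear P -> pow P a}) (h : {linear P1 -> P}) := \sum_i psi i (pproj i \o f \o h).
pose rel (k : {linear P -> pow P a}) := forall h, Th k h = 0.
have ThL b (f f' f'' : {linear P -> pow P a}) h : (forall x, f'' x = b%:A *: f x + f' x) -> Th f'' h = b * Th f h + Th f' h.
  move=> e; rewrite /Th mulr_sumr -big_split; apply: eq_bigr => i _ /=.
  by apply: (psiR i).1 => x; rewrite /= e linearP.
have [D [H HP]] := hcoord_ex fP (wide_fg Vw (wide_pow Vw a VP)).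
have [||b [k [krel kP]]] := hcoord_span HP (S := rel).
- exists (GRing.null_fun _) => h; rewrite /Th big1 // => i _.
  by apply: (hom_dual0 (psiR i).1) => x; rewrite /= linear0.
- by move=> w f1 f2 f3 r1 r2 e h; rewrite (ThL w f1 f2) // r1 r2 mulr0 addr0.
pose Q := imm (pout k); pose N := quo Q.
have VN : V N by apply: (wide_quo_imm Vw); apply: (wide_pow Vw).
have lift (f : {linear P -> N}) : exists f' : {linear P -> pow P a}, forall x, pr Q (f' x) = f x.
  exact: (PV.1.2 _ _ (pr Q) f (wide_pow Vw a VP) VN (@pr_surj _ _ _ Q)).
(* Two lifts of the same map to [N] differ by a map factoring through the relations, on which [Th]
   vanishes. *)
have ThQ (f f' : {linear P -> pow P a}) h : (forall x, pr Q (f x) = pr Q (f' x)) -> Th f h = Th f' h.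
  move=> e; have [x|l lE] := proj_lift Vw (g := pout k) (f := f \- f') PV.1 (wide_pow Vw b VP) (wide_pow Vw a VP).
    exact/(pr_eq Q)/e.
  rewrite (ThL 1 (pout k \o l) f' f) => [|x]; last first.
    by rewrite scale1r scale1r /= lE /= subrK.
  rewrite mul1r -[RHS]add0r; congr (_ + _).
  rewrite /Th; transitivity (\sum_i \sum_j psi i (pproj i \o k j \o (pproj j \o l \o h))).
    apply: eq_bigr => i _; apply: (hom_dual_sum (psiR i).1) => x.
    by rewrite /= poutE linear_sum.
  by rewrite exchange_big big1 // => j _; apply: krel.
exists N; split=> //; exists P, P1, P0, p1, p0; split=> //.
pose lf f := projT1 (cid (lift f)).
have lfE f x : pr Q (lf f x) = f x := projT2 (cid (lift f)) x.
exists (fun f h => Th (lf f) h); split.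
- move=> w f f' f'' e h; rewrite -(ThL w (lf f) (lf f') (hlin w (lf f) (lf f'))) //.
  by apply: ThQ => x; rewrite /= !linearD linearZ !lfE.
- move=> f e h; rewrite (ThQ _ (lf f \o e)) => [|x]; last by rewrite /= !lfE.
  by apply: eq_bigr => i _; congr (psi i _); apply: lin_ext.
- move=> f /kP[w wE] x; rewrite -lfE wE; apply/(prP Q).
  rewrite hcombE; apply: smod_sum => i; apply: smodZ; exists (pinj i x).
  rewrite poutE (bigD1 i) //= big1 => [|l li]; first by rewrite addr0 pproj_pinj.
  by rewrite pproj_pinj_ne ?linear0.
move=> ps; split=> [[f fE]|/psiP[w wE]].
  have e h : ps h = Th (lf f) h by rewrite fE.
  split=> [w h1 h2 h3 h3E|h0].
    rewrite !e /Th mulr_sumr -big_split; apply: eq_bigr => i _ /=.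
    by apply: (psiR i).1 => x; rewrite /= h3E !linearP.
  rewrite e /Th big1 // => i _; rewrite -[RHS]((psiR i).2 (pproj i \o lf f \o h0)).
  by congr (psi i _); apply: lin_ext.
exists (pr Q \o pin (fun i => scal P (w i))) => h.
rewrite (ThQ _ (pin (fun i => scal P (w i)))) => [|x]; last by rewrite lfE.
rewrite wE /Th; apply: eq_bigr => i _.
have := (psiR i).1 (w i) h (GRing.null_fun P) (pproj i \o pin (fun i => scal P (w i)) \o h).
rewrite (hom_dual0 (psiR i).1 (f := GRing.null_fun P)) // addr0; apply => x.
by rewrite /= pinE addr0.
Qed.

Hypothesis A_finite : tau_tilting_finite A.

Lemma tau_Dtau M X : V M -> V X ->
  (exists2 N, is_AR_translate V M N & hom_zero X N) <-> Dtau V M X.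
Proof.
move=> VM VX; split=> [[N NM /(AR_Dtau VM NM VX)//]|DX].
have [P PV] := wide_progenerator A_finite Vw.
by have [N NM] := AR_ex PV VM; exists N => //; apply/(AR_Dtau VM NM VX).
Qed.

Lemma tau_rigidP M : tau_rigid V M <-> basic_module M /\ Dtau V M M.
Proof.
split=> [[VM bM h]|[bM DM]]; first by split=> //; apply/tau_Dtau.
by have [VM _] := DM; split=> //; apply/tau_Dtau.
Qed.

Lemma JperpP M X : V M -> Jperp V M X <-> hom_zero M X /\ Dtau V M X.
Proof.
move=> VM; split=> [[VX MX h]|[MX DX]]; first by split=> //; apply/tau_Dtau.
by have [VX _] := DX; split=> //; apply/tau_Dtau.
Qed.
End Wide.
End ARTranslate.

(** * Bricks *)

Section Bricks.
Context {F : fieldType} {A : falgType F}.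
Implicit Types (M N K Q X Y Z P B E : lmodType A).

Section FiltGen.
Context {V : modclass A} (Vw : is_wide V).

Lemma FiltGen_V B X : FiltGen V B X -> V X.
Proof.
elim=> [M M0|K M Q e _ VK [VQ _]]; first exact: (wide_of_zero Vw).
exact: (wide_ext Vw e).
Qed.

Lemma FiltGen_min (T : modclass A) B X : is_torsion V T -> T B -> FiltGen V B X -> T X.
Proof.
move=> Tt TB; elim=> [M M0|K M Q e _ TK GQ]; first exact: (torsion_zero Vw Tt).
by apply: (torsion_is_ext Tt e TK); apply: (Gen1_sub Vw Tt TB).
Qed.

(** [M'] is the preimage of [K'] in [M]. This lets filtrations be spliced. *)
Lemma is_ext_preim K M Q K' Q' : is_ext K M Q -> is_ext K' Q Q' ->
  exists2 M', is_ext K M' K' & is_ext M' M Q'.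
Proof.
move=> [i [q [ii qs ex]]] [i' [q' [ii' qs' ex']]].
pose S := kerm (q' \o q); exists (sub S); last exact/(@ext_ker _ _ M Q' (q' \o q))/surj_comp.
have [x|j jE] := @corestrict _ _ _ _ S i.
  have q0 : q (i x) = 0 by apply/ex; exists x.
  by rewrite /S /= q0 linear0.
have [x|r rE] := lift_inj (f := q \o incl S) ii'; first exact/ex'/(inclP x).
exists j, r; split=> [x y e|k|x].
- by apply: ii; rewrite -!jE e.
- have [x xE] := qs (i' k); have [|y yE] := @incl_onto _ _ _ S x.
    by rewrite /S /= xE; apply/ex'; exists k.
  by exists y; apply: ii'; rewrite rE /= yE.
split=> [rx|[k <-]].
  have /ex[k kE] : q (incl S x) = 0 by rewrite -[LHS]rE rx linear0.
  by exists k; apply: (@incl_inj _ _ _ S); rewrite jE.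
by apply: ii'; rewrite rE linear0 /= jE; apply/ex; exists k.
Qed.

Lemma FiltGen_iso B X Y : mod_iso X Y -> FiltGen V B X -> FiltGen V B Y.
Proof.
move=> + FX; case: FX => [M M0|K M Q e FK GQ] iXY.
  apply: Filt_zero => y; have [f /bij_surj fs] := iXY; have [x <-] := fs y.
  by rewrite (M0 x) linear0.
move: iXY => [f bf]; have [g [fK gK]] := lin_inv bf; have [i [q [ii qs ex]]] := e.
apply: Filt_step FK GQ; exists (f \o i), (q \o g); split=> [||x].
- exact: inj_comp (bij_inj bf) ii.
- by move=> z; have [x <-] := qs z; exists (f x); rewrite /= fK.
by rewrite /= ex; split=> -[k kE]; exists k; [rewrite /= kE gK|rewrite -kE /= fK].
Qed.

Lemma FiltGen_ext B K M Q : is_ext K M Q -> FiltGen V B K -> FiltGen V B Q -> FiltGen V B M.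
Proof.
move=> + FK FQ; elim: FQ M => [Q0 z|K' Q0 Q' e' _ IH GQ'] M e.
  apply: FiltGen_iso FK; move: e => [i [q [ii qs ex]]]; exists i.
  by apply: bij_inj_surj => // x; apply/ex.
have [M' e1 e2] := is_ext_preim e e'.
exact: Filt_step e2 (IH _ e1) GQ'.
Qed.

Lemma FiltGen_surj B X Y (f : {linear X -> Y}) :
  FiltGen V B X -> V Y -> surj f -> FiltGen V B Y.
Proof.
move=> FX; elim: FX Y f => [M M0|K M Q e FK IH GQ] Y f VY fs.
  by apply: Filt_zero => y; have [x <-] := fs y; rewrite (M0 x) linear0.
have [i [q [ii qs ex]]] := e; have VK := FiltGen_V FK.
have [r rs rE] := imm_corestrict (f \o i).
have VI : V (sub (imm (f \o i))) := wide_imm Vw (f \o i) VK VY.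
apply: Filt_step (smod_is_ext (imm (f \o i))) (IH _ r VI rs) _.
have [x /ex[k <-]|g gE] := factor_surj (f := pr (imm (f \o i)) \o f) qs.
  by apply/(prP (imm (f \o i))); exists k.
apply: (Gen1_surj (f := g)) GQ (wide_quo Vw VI VY) _ => z.
by have [y <-] := pr_surj z; have [x <-] := fs y; exists (q x); rewrite gE.
Qed.

Lemma FiltGen_torsion B : is_torsion V (FiltGen V B).
Proof.
apply: (mk_torsion Vw) => [X|||X S _]; first exact: FiltGen_V.
- exact/Filt_zero/zero_mod_zero.
- by move=> X Y f FX VY fs; apply: FiltGen_surj fs.
exact/FiltGen_ext/smod_is_ext.
Qed.

Lemma FiltGen_self B : V B -> FiltGen V B B.
Proof.
move=> VB; have i0 : injective (GRing.null_fun B : {linear zero_mod -> B}).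
  by apply: add_ker0_inj => x _; apply: zero_mod_zero.
apply: (@Filt_step _ _ _ zero_mod B B).
- exists (GRing.null_fun B), idfun; split=> // [y|x]; first by exists y.
  by split=> [x0|[k <-]//]; exists 0; rewrite linear0; apply: esym.
- exact/Filt_zero/zero_mod_zero.
exact: (Gen1_self Vw).
Qed.

Lemma lperp_torsion (T : modclass A) Y : is_torsion V T ->
  is_torsion V (fun X => T X /\ hom_zero X Y).
Proof.
move=> Tt; apply: (mk_torsion Vw).
- by move=> X [/(torsion_in Tt)].
- split; first exact/(torsion_zero Vw Tt)/zero_mod_zero.
  by move=> f x; rewrite (zero_mod_zero x) linear0.
- move=> X Z f [TX h] VZ fs; split; first exact: (torsion_surj Tt TX VZ fs).
  by move=> g z; have [x <-] := fs z; apply: (h (g \o f)).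
move=> X S VX [TS hS] [TQ hQ]; split; first exact: (torsion_ext Tt TS TQ).
move=> f x; have [y /prP/incl_onto[s <-]|g gE] := factor_surj (f := f) (@pr_surj _ _ _ S).
  exact: (hS (f \o incl S)).
by rewrite -gE hQ.
Qed.

Lemma FiltGen_hom B X Y : V B -> hom_zero B Y -> FiltGen V B X -> hom_zero X Y.
Proof.
move=> VB BY FX; have [] // := FiltGen_min (lperp_torsion Y (FiltGen_torsion B)) _ FX.
by split=> //; apply: FiltGen_self.
Qed.

Section Brick.
Context {B : lmodType A} (bB : brick B) (VB : V B).

(** A nonzero object of Filt Gen B receives a nonzero map from [B]. Followed by the inclusion of
    [S], it is a nonzero endomorphism of the brick, hence bijective. *)
Lemma brick_sub_FiltGen (S : smod B) : FiltGen V B (sub S) -> (exists x, S x /\ x <> 0) ->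
  forall x, S x.
Proof.
move=> FS [x [Sx nx]]; have [y yE] := incl_onto Sx.
have [h0|] := pselect (hom_zero B (sub S)).
  have := FiltGen_hom VB h0 FS (idfun : {linear sub S -> sub S}) y.
  by move=> /= y0; case: nx; rewrite -yE y0 linear0.
move=> nh; have [g [b gb]] : exists (g : {linear B -> sub S}) b, g b <> 0.
  by apply: contrapT => no; apply: nh => g b; apply: contrapT => gb; apply: no; exists g, b.
case: (bB.2 (incl S \o g)) => [z|/bij_surj s].
  by case: gb; apply: (@incl_inj _ _ _ S); rewrite linear0; apply: z.
by move=> z; have [u <-] := s z; apply: inclP.
Qed.

(** The image of a nonzero map to [B] is a nonzero submodule in Filt Gen B, so it is [B], which
    would then lie in [T]. *)
Lemma brick_lower (T : modclass A) : is_torsion V T ->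
  (forall X, T X -> FiltGen V B X) -> ~ T B -> forall X, T X -> hom_zero X B.
Proof.
move=> Tt TB nTB X TX f x; apply: contrapT => fx; apply: nTB.
have TI : T (sub (imm f)) by apply: (torsion_imm Vw Tt).
apply: (torsion_iso Vw Tt _ TI); exists (incl (imm f)); apply: bij_inj_surj; first exact: incl_inj.
move=> y; apply: incl_onto; apply: (brick_sub_FiltGen (TB _ TI)).
by exists (f x); split=> //; exists x.
Qed.
End Brick.

Lemma brick_FiltGen_inj B B' : brick B -> brick B' -> V B -> V B' ->
  (forall X, FiltGen V B X <-> FiltGen V B' X) -> mod_iso B B'.
Proof.
move=> bB bB' VB VB' e.
have main C C' : brick C -> brick C' -> V C -> V C' ->
    (forall X, FiltGen V C X <-> FiltGen V C' X) -> exists f : {linear C' -> C}, surj f.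
  move=> bC bC' VC VC' eC.
  have nh : ~ hom_zero C' C.
    move=> h; apply: bC.1 => x.
    exact: (FiltGen_hom VC' h ((eC C).1 (FiltGen_self VC)) (idfun : {linear C -> C}) x).
  have [f [x fx]] : exists (f : {linear C' -> C}) x, f x <> 0.
    by apply: contrapT => no; apply: nh => f x; apply: contrapT => h; apply: no; exists f, x.
  exists f; apply: (brick_sub_FiltGen bC VC (S := imm f)).
    by apply: (torsion_imm Vw (FiltGen_torsion C)) => //; apply/eC; apply: FiltGen_self.
  by exists (f x); split=> //; exists x.
have [f fs] := main _ _ bB bB' VB VB' e.
have [g gs] := main _ _ bB' bB VB' VB (fun X => iff_sym (e X)).
exists g; apply: (surj_dim_bij (wide_fg Vw VB) gs); exact: (mdim_surj fs (wide_fg Vw VB')).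
Qed.
End FiltGen.

(** Since [szero] is all of [M], this is M / rad(End M) M. *)
Definition beta M : lmodType A := quo (@jspan F A M (szero (M := M))).

Section BetaIndecomposable.
Context {M : lmodType A} (fM : fin_gen M) (iM : indecomposable M).

(** For an indecomposable module of finite dimension the radical endomorphisms are the
    non-surjective ones; zero terms are dropped from the sums. *)
Lemma beta_is_beta : is_beta M (beta M).
Proof.
exists (pr _); split=> [|m]; first exact: pr_surj.
rewrite prP; split=> [|[n [g [x [gP ->]]]]]; last first.
  apply: smod_sum => i; apply: gspan_sub; exists (g i), (x i); split=> //.
  by apply: (nonbij_jac fM iM) => /bij_surj; case: (gP i).
elim=> [|a _ x [j [y [hj _ ->]]] _ [n [g [u [gP ->]]]]].
  exists 0%N, (fun=> idfun), (fun=> 0); split=> [[]//|].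
  by rewrite big_ord0.
have [j0|nj0] := pselect (forall y, j y = 0).
  by exists n, g, u; split=> //; rewrite j0 scaler0 add0r.
exists n.+1, (fun i => if unlift ord0 i is Some k then g k else j).
exists (fun i => if unlift ord0 i is Some k then u k else a *: y); split=> [i|].
  case: (unliftP ord0 i) => [k|] _; first exact: gP.
  split; first by apply: contrapT => no; apply: nj0 => z; apply: contrapT => h; apply: no; exists z.
  by move=> /(surj_bij fM); apply: (jac_nonbij iM).
rewrite big_ord_recl unlift_none linearZ; congr (_ + _).
by apply: eq_bigr => k _; rewrite liftK.
Qed.

Lemma beta_nonzero : ~ is_zero (beta M).
Proof.
move=> z; apply: iM.1 => x; apply: (@jspan_full _ _ M fM (szero (M := M))) => // y _.
by apply/prP; apply: (z (pr _ y)).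
Qed.
End BetaIndecomposable.

Lemma beta_iso M M' : mod_iso M M' -> mod_iso (beta M) (beta M').
Proof.
move=> [f /lin_inv[g [fK gK]]].
have jacT N N' (a : {linear N -> N'}) (b : {linear N' -> N}) (j : {linear N -> N}) :
    cancel a b -> cancel b a -> jac j -> jac (a \o j \o b).
  move=> aK bK hj e x xE; have : b x = 0.
    by apply: (hj (b \o e \o a)); rewrite /= -{1}xE.
  by move=> /(congr1 a); rewrite bK linear0.
have h N N' (a : {linear N -> N'}) (b : {linear N' -> N}) x : cancel a b -> cancel b a ->
    jspan (szero (M := N)) x -> jspan (szero (M := N')) (a x).
  move=> aK bK; apply: (gspan_img (f := a)) => _ [j [y [hj _ ->]]]; apply: gspan_sub.
  by exists (a \o j \o b), (a y); split=> //; [apply: jacT|rewrite /= aK].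
apply: (mod_iso_quo (q := pr (jspan (szero (M := M'))) \o f)) => [y|x].
  by have [z <-] := pr_surj y; exists (g z); rewrite /= gK.
rewrite /= -[_ = 0]/(pr (jspan (szero (M := M'))) (f x) = 0) prP; split=> [|/(h _ _ _ _ _ fK gK)//].
by move=> /(h _ _ _ _ _ gK fK); rewrite fK.
Qed.

Section Rigid.
Hypothesis A_finite : tau_tilting_finite A.
Context {V : modclass A} (Vw : is_wide V).

Lemma Dtau_tors M : V M -> is_torsion V (Dtau V M).
Proof. by have [P PV] := wide_progenerator A_finite Vw; apply: (Dtau_torsion Vw PV). Qed.

Lemma rigid_eproj M : Dtau V M M -> eproj V (Gen1 V M) M.
Proof.
move=> D; have VM := D.1; apply: (Dtau_eproj VM) => X.
exact: (Gen1_sub Vw (Dtau_tors VM) D).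
Qed.

Lemma rigid_torsion M : Dtau V M M -> is_torsion V (Gen1 V M).
Proof. by move/rigid_eproj/(eproj_gen Vw). Qed.

Section Beta.
Context {M : lmodType A} (iM : indecomposable M) (rM : Dtau V M M).
Let VM : V M := rM.1.
Let fM : fin_gen M := wide_fg Vw VM.
Let Gt := rigid_torsion rM.
Let R := jspan (szero (M := M)).

Let GR : Gen1 V M (sub R).
Proof.
apply: (gspan_torsion Vw Gt VM) => _ [j [y [hj _ ->]]]; exists M, j; split.
- exact: (Gen1_self Vw).
- by move=> x; exists j, x.
by exists y.
Qed.

Lemma beta_V : V (beta M).
Proof. exact: (wide_quo Vw (torsion_in Gt GR) VM). Qed.

Lemma beta_Gen : Gen1 V M (beta M).
Proof. exact: (torsion_surj Gt (Gen1_self Vw VM) beta_V (@pr_surj _ _ _ R)). Qed.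

(** If [M] had a nonzero torsion-free quotient for Filt Gen beta(M), a nonzero map to it killing
    rad(End M) M would factor through beta(M), which has no nonzero map to that quotient. *)
Lemma beta_FiltGen X : FiltGen V (beta M) X <-> Gen1 V M X.
Proof.
split; first exact: (FiltGen_min Vw Gt beta_Gen).
have Ft := FiltGen_torsion Vw (beta M); apply: (Gen1_sub Vw Ft).
have [S [FS VQ hQ]] := torsion_pair Vw Ft VM.
have [p0|] := pselect (forall x, pr S x = 0).
  by apply: (torsion_surj Ft FS VM (f := incl S)) => x; apply/incl_onto/prP.
move=> np; have [x0 px0] : exists x, pr S x <> 0.
  by apply: contrapT => no; apply: np => x; apply: contrapT => h; apply: no; exists x.
have [e [[x pex] ej]] := jac_kill fM (ex_intro _ x0 px0).
have [y /prP Ry|g gE] := factor_surj (f := pr S \o e) (@pr_surj _ _ _ R).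
  move: Ry; apply: (gspan_min (T := kerm (pr S \o e))) => _ [j [z [hj _ ->]]].
  exact: ej.
by case: pex; rewrite -[LHS]gE (hQ _ (FiltGen_self Vw beta_V)).
Qed.

(** The kernel rad(End M) M of the projection lies in Gen M, where [M] is Ext-projective. *)
Lemma beta_lift (g : {linear M -> beta M}) : exists h : {linear M -> M}, forall x, pr R (h x) = g x.
Proof.
have k : Gen1 V M (sub (kerm (pr R))).
  by apply: (Gen1_iso Vw _ GR); apply: mod_iso_eq => x; apply: iff_sym; apply: prP.
have [h hE] := eproj_lift Vw (X := M) (Z := quo R) (g := pr R) g (@Gen1_iso _ _ _ Vw M)
  (rigid_eproj rM) VM beta_V (@pr_surj _ _ _ R) k.
by exists h.
Qed.

(** Lift an endomorphism of beta(M) to [h] on [M]. Either [h] is bijective and the endomorphism is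
    onto, or [h] is radical and the endomorphism is zero. *)
Lemma beta_brick : brick (beta M).
Proof.
split=> [|f]; first exact: beta_nonzero.
have [f0|nf0] := pselect (forall x, f x = 0); [by left|right].
have [h hE] := beta_lift (f \o pr R).
apply: (surj_bij (wide_fg Vw beta_V)) => y; have [x <-] := pr_surj y.
have [/bij_surj hs|nh] := pselect (bijective h).
  by have [z <-] := hs x; exists (pr R z); rewrite hE.
case: nf0 => u; have [v <-] := pr_surj u; rewrite -[LHS]hE; apply/prP; apply: gspan_sub.
by exists h, v; split=> //; apply: (nonbij_jac fM iM).
Qed.
End Beta.

(** The composites M -> M' -> M generate [M]; by Nakayama one of them is bijective, which makes [M]
    a summand of the indecomposable [M']. *)
Lemma Gen1_indecomposable_inj M M' : V M -> V M' -> indecomposable M -> indecomposable M' ->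
  (forall X, Gen1 V M X <-> Gen1 V M' X) -> mod_iso M M'.
Proof.
move=> VM VM' iM iM' e.
have /Gen1_fam[_ [n [f fP]]] : Gen1 V M' M by apply/e; apply: (Gen1_self Vw).
have /Gen1_fam[_ [m [g gP]]] : Gen1 V M M' by apply/e; apply: (Gen1_self Vw).
have fM := wide_fg Vw VM.
have [i [j /lin_inv[u [uK _]]]] : exists i j, bijective (f i \o g j).
  apply: contrapT => no; apply: iM.1 => x.
  apply: (@jspan_full _ _ M fM (szero (M := M))) => // y _; have [z ->] := fP y.
  apply: smod_sum => i; have [w ->] := gP (z i); rewrite linear_sum; apply: smod_sum => j.
  apply: gspan_sub; exists (f i \o g j), (w j); split=> //.
  by apply: (nonbij_jac fM iM) => b; apply: no; exists i, j.
apply: mod_iso_sym; exists (u \o f i); apply: (retract_bij iM' (a := g j)) iM.1 _.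
exact: uK.
Qed.
End Rigid.
End Bricks.

(** * Join-irreducible torsion classes *)

Section JoinIrreducible.
Context {F : fieldType} {A : falgType F}.
Implicit Types (M N K Q X Y Z P B E : lmodType A).

(** The guard [V B] makes this total in [B]. For [B] in [V] it is the least torsion class containing
    [B], namely Filt Gen B. *)
Definition tgen (V : wide_subcat A) B : tors V :=
  Tors (@tors_inter_subproof _ _ V (fun T => V B -> T B) (tors_top V) id).

Section Lattice.
Context {V : wide_subcat A}.
Implicit Types (T U L : tors V).
Let Vw := wide_classP V.
Local Notation le := (@tors_le F A V).
Local Notation bot := (tors_bot V).
Local Notation top := (tors_top V).

Lemma tgenP B X : V B -> (tgen V B X <-> FiltGen V B X).
Proof.
move=> VB; split=> [h|FX T TB].
  exact: (h (Tors (FiltGen_torsion Vw B)) (fun _ => FiltGen_self Vw VB)).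
exact: (FiltGen_min Vw (tors_classP T) (TB VB) FX).
Qed.

Lemma tgen_le B T : V B -> (le (tgen V B) T <-> T B).
Proof.
move=> VB; split=> [|TB X]; last by apply.
by apply; apply/tgenP => //; apply: FiltGen_self.
Qed.

Lemma tgen_in B : V B -> tgen V B B.
Proof. by move=> VB; apply/(tgen_le _ VB). Qed.

Lemma within_all T : within le bot top T.
Proof. by split; [apply: tors_le0x|apply: tors_lex1]. Qed.

Lemma le_joinl T U : le T (tors_join T U).
Proof. by have [] := (tors_leUx T U (tors_join T U)).1 (@tors_le_refl _ _ _ _). Qed.
Lemma le_joinr T U : le U (tors_join T U).
Proof. by have [] := (tors_leUx T U (tors_join T U)).1 (@tors_le_refl _ _ _ _). Qed.

(** * Torsion classes with a greatest class [L] strictly below them *)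

Section Lower.
Context {T L : tors V} (LT : le L T) (nTL : ~ le T L).
Context (low : forall U, le U T -> ~ le T U -> le U L).

Lemma lower_cji : tors_cji T.
Proof.
move=> S Sle Slub; apply: contrapT => nST; apply: nTL; apply: Slub => y Sy.
apply: low => [|Ty]; first exact: Sle.
by apply: nST; rewrite (tors_le_anti Ty (Sle _ Sy)).
Qed.

Lemma lower_ji : join_irreducible le (@tors_join F A V) bot top T.
Proof.
split=> [|T0|y z _ _ yz]; first exact: within_all.
  by apply: nTL; rewrite T0; apply: tors_le0x.
have [yT|nyT] := pselect (le T y).
  left; apply: tors_le_anti => //; rewrite yz; exact: le_joinl.
have [zT|nzT] := pselect (le T z).
  right; apply: tors_le_anti => //; rewrite yz; exact: le_joinr.
case: nTL; rewrite {1}yz; apply/tors_leUx; split; apply: low => //; rewrite yz.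
  exact: le_joinl.
exact: le_joinr.
Qed.

Lemma lower_cover : tors_cover L T.
Proof.
split=> // [LE|W [LW WT]]; first by apply: nTL; rewrite LE.
have [TW|nTW] := pselect (le T W); first by right; apply: tors_le_anti.
by left; apply: tors_le_anti => //; apply: low.
Qed.

Lemma lower_unique U : tors_cover U T -> U = L.
Proof.
move=> [UT nUT hU]; have UL : le U L.
  by apply: low => // TU; apply: nUT; apply: tors_le_anti.
by case: (hU L (conj UL LT)) => // LE; case: nTL; rewrite LE.
Qed.

Lemma lower_jlabel : is_jlabel le (@tors_join F A V) bot top L T T.
Proof.
split=> [||y _ yL]; first exact: within_all.
  by apply: tors_le_anti; [apply/tors_leUx; split|apply: le_joinl].
apply: contrapT => nTy; apply: nTL; rewrite -{1}yL; apply/tors_leUx; split=> //.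
by apply: low => //; rewrite -yL; apply: le_joinl.
Qed.
End Lower.

Definition tlower B : tors V := Tors (lperp_torsion Vw B (tors_classP (tgen V B))).

Section Brick.
Context {B : lmodType A} (bB : brick B) (VB : V B).
Lemma tlower_le : le (tlower B) (tgen V B). Proof. by move=> X []. Qed.
Lemma tlower_proper : ~ le (tgen V B) (tlower B).
Proof.
move=> /(_ B (tgen_in VB))[_ h]; apply: bB.1 => x; exact: (h (idfun : {linear B -> B}) x).
Qed.
Lemma tlower_max U : le U (tgen V B) -> ~ le (tgen V B) U -> le U (tlower B).
Proof.
move=> UT nTU X UX; split; first exact: UT.
apply: (brick_lower Vw bB VB (tors_classP U)) UX => [Y /UT|UB]; first by move/(tgenP _ VB).
by apply: nTU; apply/tgen_le.
Qed.
End Brick.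

Lemma tgen_inj B B' : brick B -> brick B' -> V B -> V B' ->
  tgen V B = tgen V B' -> mod_iso B B'.
Proof.
move=> bB bB' VB VB' e; apply: (brick_FiltGen_inj Vw) => // X.
by rewrite -!tgenP // e.
Qed.

Lemma tgen_iso B B' : mod_iso B B' -> tgen V B = tgen V B'.
Proof.
move=> iB; have e T : (V B -> T B) <-> (V B' -> T B').
  split=> h VB'.
    by apply: (torsion_iso Vw (tors_classP T) iB); apply: h; apply: (wide_iso Vw (mod_iso_sym iB)).
  by apply: (torsion_iso Vw (tors_classP T) (mod_iso_sym iB)); apply: h; apply: (wide_iso Vw iB).
by apply: tors_ext => X; split=> h T /e; apply: h.
Qed.

Hypothesis A_finite : tau_tilting_finite A.

Lemma tgen_beta M X : indecomposable M -> Dtau V M M ->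
  (tgen V (beta M) X <-> Gen1 V M X).
Proof.
move=> iM rM; rewrite (tgenP _ (beta_V A_finite Vw rM)).
exact: (beta_FiltGen A_finite Vw rM).
Qed.

(** Write T = Gen N with [N] Ext-projective. [T] is the join of the Gen of the indecomposable
    summands of [N], so it equals one of them; summands inherit Ext-projectivity and are therefore
    tau-rigid. *)
Lemma ji_tau_rigid T : join_irreducible le (@tors_join F A V) bot top T ->
  exists M, [/\ indecomposable M, Dtau V M M & T = tgen V (beta M)].
Proof.
move=> [_ Tn0 Tji]; have Tt := tors_classP T.
have [N [TN eN gN]] := torsion_eproj A_finite Vw Tt; have VN := torsion_in Tt TN.
have [I [Xs [io [pj [iX pio _ dx]]]]] := decomposition_ex (wide_fg Vw VN).
have TX k : T (Xs k).
  apply: (torsion_surj Tt TN (f := pj k)); first exact: (wide_retract Vw (pio k) VN).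
  by move=> x; exists (io k x); apply: pio.
have VX k := torsion_in Tt (TX k).
have eX k : eproj V T (Xs k).
  exact: (eproj_retract Vw (torsion_iso Vw Tt) (VX k) (pio k) eN).
have DX k : Dtau V (Xs k) (Xs k) := eproj_Dtau Vw Tt (eX k) (TX k).
pose G k : tors V := Tors (rigid_torsion A_finite Vw (DX k)).
have Gle k : le (G k) T by move=> X; apply: (Gen1_sub Vw Tt).
pose Js := foldr (fun k U => tors_join (G k) U) bot.
have Jle s : le (Js s) T.
  by elim: s => [|k s IH]; [apply: tors_le0x|apply/tors_leUx; split].
have Jin s k : k \in s -> Js s (Xs k).
  elim: s => // l s IH; rewrite inE => /predU1P[->|/IH h].
    by apply: le_joinl; apply: (Gen1_self Vw).
  exact: le_joinr.
have TJ : T = Js (enum I).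
  apply: tors_le_anti => // X /gN; apply: (Gen1_sub Vw (tors_classP _)).
  have [S [JS VQ hQ]] := torsion_pair Vw (tors_classP (Js (enum I))) VN.
  apply: (torsion_surj (tors_classP _) JS VN (f := incl S)) => x; apply/incl_onto/prP.
  rewrite (dx x) linear_sum big1 // => k _.
  exact: (hQ (Xs k) (Jin _ k (mem_enum _ k)) (pr S \o io k)).
have [k Tk] : exists k, T = G k.
  elim: (enum I) TJ => [|k s IH] TJ; first by case: Tn0.
  by case: (Tji _ _ (within_all (G k)) (within_all (Js s)) TJ) => e; [exists k|apply: IH].
exists (Xs k); split=> //; apply: tors_ext => X; rewrite Tk.
by rewrite (tgen_beta _ (iX k) (DX k)).
Qed.
End Lattice.
End JoinIrreducible.

(** * Reduction at a tau-rigid module *)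

Section Reduction.
Context {F : fieldType} {A : falgType F}.
Implicit Types (M N K Q X Y Z P B E : lmodType A).
Hypothesis A_finite : tau_tilting_finite A.
Context {V : wide_subcat A}.
Let Vw := wide_classP V.
Context {M : lmodType A} (iM : indecomposable M) (rM : Dtau V M M).
Let VM : V M := rM.1.
Let fM : fin_gen M := wide_fg Vw VM.
Let Dt : is_torsion V (Dtau V M) := Dtau_tors A_finite Vw VM.
Let Gt : is_torsion V (Gen1 V M) := rigid_torsion A_finite Vw rM.
Local Notation le := (@tors_le F A V).

Definition rgen : tors V := Tors Gt.
Definition tau_perp : tors V := Tors Dt.

Lemma rgen_in : rgen M. Proof. exact: (Gen1_self Vw). Qed.
Lemma rgen_le (T : tors V) : le rgen T <-> T M.
Proof.
split=> [|TM X]; last exact: (Gen1_sub Vw (tors_classP T) TM).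
by apply; apply: rgen_in.
Qed.
Lemma rgen_tau_perp : le rgen tau_perp. Proof. exact/rgen_le. Qed.

Lemma rgen_hom X Y : rgen X -> hom_zero M Y -> hom_zero X Y.
Proof.
move=> /Gen1_fam[_ [n [f fP]]] MY g x; have [m ->] := fP x.
by rewrite linear_sum big1 // => i _; apply: (MY (g \o f i)).
Qed.

Lemma rgen_zero X : rgen X -> hom_zero M X -> is_zero X.
Proof. by move=> RX MX x; apply: (rgen_hom RX MX (idfun : {linear X -> X})). Qed.

Let JP X : Jperp V M X <-> hom_zero M X /\ Dtau V M X := JperpP Vw A_finite X VM.

Lemma hom_zero_inj X Y Z (i : {linear X -> Y}) : injective i -> hom_zero Z Y -> hom_zero Z X.
Proof. by move=> ii h f x; apply: ii; rewrite linear0; apply: (h (i \o f)). Qed.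

Lemma Jperp_wide : is_wide (Jperp V M).
Proof.
have eD : eproj V (Dtau V M) M by apply: (Dtau_eproj VM).
split=> [X /JP[_ [VX _]]|X Y iXY /JP[MX DX]||X Y f K /JP[MX DX] /JP[MY DY] iK|
  X Y f Q /JP[MX DX] /JP[MY DY] cQ|K X Q e /JP[MK DK] /JP[MQ DQ]].
- exact: (wide_fg Vw).
- apply/JP; split; last exact: (torsion_iso Vw Dt iXY DX).
  have [g /bij_inj gi] := mod_iso_sym iXY; exact: hom_zero_inj gi MX.
- apply/JP; split; last exact/(torsion_zero Vw Dt)/zero_mod_zero.
  by move=> f x; apply: zero_mod_zero.
- have VK : V K := wide_ker Vw DX.1 DY.1 iK.
  have [i [ii ik]] := iK; apply/JP; split; first exact: hom_zero_inj ii MX.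
  (* A map u : P1 -> K extends to v : P0 -> X. Since f v kills im p1 it factors through [M], so it
     is zero because Hom(M, Y) = 0; hence [v] takes values in [K]. *)
  have [P PV] := wide_progenerator A_finite Vw.
  have [P1 [P0 [p1 [p0 mp]]]] := min_pres_ex Vw PV VM.
  apply/(Dtau_pres Vw K VM mp); split=> // u.
  have [_ DX'] := (Dtau_pres Vw X VM mp).1 DX.
  have [v vE] := DX' (i \o u); have [_ s0 _ ex] := mp.
  have [y /ex[z <-]|g gE] := factor_surj (f := f \o v) s0.
    by rewrite /= vE; apply/ik; exists (u z).
  have [y|w wE] := lift_inj (f := v) ii.
    by apply/ik; rewrite -[LHS]gE MY.
  by exists w => x; apply: ii; rewrite wE vE.
- have VQ : V Q := wide_coker Vw DX.1 DY.1 cQ.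
  have [q [qs qk]] := cQ; apply/JP; split; last exact: (torsion_surj Dt DY VQ qs).
  (* ker q is the image of [f], so it lies in [Dtau V M], for which [M] is Ext-projective; thus [g]
     lifts to [Y], where Hom(M, Y) = 0. *)
  move=> g; have Dk : Dtau V M (sub (kerm q)).
    by apply: (torsion_sub_eq Vw Dt (S := imm f)) => [y|]; [exact: iff_sym (qk y)|exact: (torsion_imm Vw Dt f DX DY.1)].
  have [h hE] := eproj_lift Vw g (torsion_iso Vw Dt) eD DY.1 VQ qs Dk.
  by move=> x; rewrite -hE MY linear0.
have [i [q [ii qs ex]]] := e; apply/JP; split; last exact: (torsion_is_ext Dt e).
move=> g; have [x|h hE] := lift_inj (f := g) ii; first exact/ex/(MQ (q \o g)).
by move=> x; rewrite -hE MK linear0.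
Qed.

Definition Jsub : wide_subcat A := WideSubcat Jperp_wide.
Let Jw := wide_classP Jsub.

Lemma JsubP X : Jsub X <-> hom_zero M X /\ Dtau V M X. Proof. exact: JP. Qed.
Lemma Jsub_wide X : Jsub X -> V X. Proof. by move=> /JsubP[_ []]. Qed.

Lemma Psi_subproof (U : tors Jsub) : is_torsion V (fun Y => Dtau V M Y /\
  forall Z (f : {linear Y -> Z}), Jsub Z -> surj f -> U Z).
Proof.
have Ut := tors_classP U; apply: (mk_torsion Vw).
- by move=> X [[]].
- split; first exact/(torsion_zero Vw Dt)/zero_mod_zero.
  move=> Z f JZ fs; apply: (torsion_zero Jw Ut) => z; have [x <-] := fs z.
  by rewrite (zero_mod_zero x) linear0.
- move=> X Y f [DX hX] VY fs; split; first exact: (torsion_surj Dt DX VY fs).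
  by move=> Z g JZ gs; apply: (hX Z (g \o f)) => //; apply: surj_comp.
move=> X S VX [DS hS] [DQ hQ]; split; first exact: (torsion_ext Dt DS DQ).
move=> Z f JZ fs; have /JsubP[MZ DZ] := JZ; pose I := imm (f \o incl S).
have [r rs _] := imm_corestrict (f \o incl S).
(* The image of [S] in [Z] embeds in [Z] and is a quotient of [S], which puts it and Z / I in
   J(M). *)
have JI : Jsub (sub I).
  apply/JsubP; split; first exact: hom_zero_inj (@incl_inj _ _ _ I) MZ.
  exact: (torsion_imm Vw Dt _ DS DZ.1).
have UI := hS _ r JI rs.
apply: (torsion_ext Ut UI); have [x /prP/incl_onto[s <-]|g gE] := factor_surj (f := pr I \o f) (@pr_surj _ _ _ S).
  by apply/(prP I); exists s.
apply: (hQ _ g (wide_quo Jw JI JZ)) => y; have [z <-] := pr_surj y.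
by have [x <-] := fs z; exists (pr S x); rewrite gE.
Qed.

Definition Psi U : tors V := Tors (Psi_subproof U).

Lemma Res_subproof (T : tors V) : is_torsion Jsub (fun X => Jsub X /\ T X).
Proof.
have Tt := tors_classP T; apply: (mk_torsion Jw).
- by move=> X [].
- by split; [exact: (wide_zero Jw)|exact/(torsion_zero Vw Tt)/zero_mod_zero].
- by move=> X Y f [JX TX] JY fs; split=> //; apply: (torsion_surj Tt TX (Jsub_wide JY) fs).
by move=> X S JX [JS TS] [JQ TQ]; split=> //; apply: (torsion_ext Tt TS TQ).
Qed.
Definition Res T : tors Jsub := Tors (Res_subproof T).

Lemma Psi_top U : le (Psi U) tau_perp. Proof. by move=> X []. Qed.

Lemma Psi_bot U : le rgen (Psi U).
Proof.
apply/rgen_le; split=> // Z f /JsubP[MZ _] fs; apply: (torsion_zero Jw (tors_classP U)) => z.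
by have [x <-] := fs z; apply: MZ.
Qed.

Lemma PsiJ U X : Jsub X -> (Psi U X <-> U X).
Proof.
move=> JX; split=> [[_ h]|UX]; first by apply: (h X idfun) => // y; exists y.
split=> [|Z f JZ fs]; first by have /JsubP[] := JX.
exact: (torsion_surj (tors_classP U) UX JZ fs).
Qed.

Lemma torsion_quotient Y : Dtau V M Y -> exists S : smod Y, rgen (sub S) /\ Jsub (quo S).
Proof.
move=> DY; have [S [RS VQ hQ]] := torsion_pair Vw Gt DY.1.
exists S; split=> //; apply/JsubP; split; first exact/hQ/rgen_in.
exact: (torsion_surj Dt DY VQ (@pr_surj _ _ _ S)).
Qed.

(** Each module in [tau_perp] is an extension of an object of J(M) by one of Gen M, so inclusions
    between [rgen] and [tau_perp] can be tested on J(M). *)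
Lemma le_Jsub (T T' : tors V) : le rgen T' -> le T tau_perp ->
  (forall X, Jsub X -> T X -> T' X) -> le T T'.
Proof.
move=> gT' TD h Y TY; have [S [RS JS]] := torsion_quotient (TD _ TY).
apply: (torsion_ext (tors_classP T') (gT' _ RS)); apply: h => //.
exact: (torsion_surj (tors_classP T) TY (Jsub_wide JS) (@pr_surj _ _ _ S)).
Qed.

Lemma PsiK T : le rgen T -> le T tau_perp -> Psi (Res T) = T.
Proof.
move=> gT TD; apply: tors_le_anti; apply: le_Jsub => //.
- exact: Psi_top.
- by move=> X JX /(PsiJ _ JX)[].
- exact: Psi_bot.
by move=> X JX TX; apply/PsiJ.
Qed.

Lemma Psi_le U U' : le (Psi U) (Psi U') <-> tors_le U U'.
Proof.
split=> [h X UX|h X [DX hX]]; last by split=> // Z f JZ fs; apply/h/(hX Z f).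
have JX := torsion_in (tors_classP U) UX.
by apply/(PsiJ _ JX)/h/PsiJ.
Qed.

Lemma Psi_inj U U' : Psi U = Psi U' -> U = U'.
Proof.
by move=> e; apply: tors_le_anti; apply/Psi_le; rewrite e.
Qed.

Lemma Psi_bot_eq : Psi (tors_bot Jsub) = rgen.
Proof.
apply: tors_le_anti; last exact: Psi_bot.
apply: le_Jsub => // [|X JX /(PsiJ _ JX)/= X0]; first exact: Psi_top.
exact: (torsion_zero Vw Gt).
Qed.

Lemma Psi_top_eq : Psi (tors_top Jsub) = tau_perp.
Proof.
apply: tors_le_anti; first exact: Psi_top.
by apply: le_Jsub; [exact: Psi_bot|by []|move=> X JX _; apply/PsiJ].
Qed.

Lemma Psi_join U U' : Psi (tors_join U U') = tors_join (Psi U) (Psi U').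
Proof.
have gJ : le rgen (tors_join (Psi U) (Psi U')).
  by move=> X /(@Psi_bot U); apply: le_joinl.
have Jt : le (tors_join (Psi U) (Psi U')) tau_perp by apply/tors_leUx; split; apply: Psi_top.
apply: tors_le_anti; last first.
  by apply/tors_leUx; split; apply/Psi_le; [apply: le_joinl|apply: le_joinr].
rewrite -(PsiK gJ Jt); apply/Psi_le/tors_leUx.
by split; apply/Psi_le; rewrite (PsiK gJ Jt); [apply: le_joinl|apply: le_joinr].
Qed.

Lemma Psi_onto T : le rgen T -> le T tau_perp -> exists U, Psi U = T.
Proof. by move=> gT TD; exists (Res T); apply: PsiK. Qed.

Lemma Psi_cover U U' : tors_cover U U' -> tors_cover (Psi U) (Psi U').
Proof.
move=> [UU' nUU' h]; split; first exact/Psi_le.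
  by move=> /Psi_inj.
move=> W [UW WU']; have [||R WE] := @Psi_onto W.
- by move=> X /(@Psi_bot U)/UW.
- by move=> X /WU' /Psi_top.
rewrite -WE in UW WU' *; case: (h R); first by split; apply/Psi_le.
  by move=> ->; left.
by move=> ->; right.
Qed.

(** This makes the identification of torsion classes by their bricks compatible with the passage
    from [V] to J(M). *)
Lemma tgen_join B : Jsub B -> tors_join (tgen V B) rgen = Psi (tgen Jsub B).
Proof.
move=> JB; have VB := Jsub_wide JB; apply: tors_le_anti.
  apply/tors_leUx; split; last exact: Psi_bot.
  by apply/tgen_le => //; apply/PsiJ => //; apply: tgen_in.
have BD : le (tgen V B) tau_perp by apply/tgen_le => //; have /JsubP[] := JB.
have jD : le (tors_join (tgen V B) rgen) tau_perp.
  by apply/tors_leUx; split=> //; apply: rgen_tau_perp.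
rewrite -(PsiK (@le_joinr _ _ _ _ _) jD); apply/Psi_le/tgen_le => //.
by split=> //; apply: le_joinl; apply: tgen_in.
Qed.

(* Let B in S of minimal dimension with Hom(M, B) = 0.  A nonsplit extension of
   M by a quotient of B would be an object E of S outside Gen M, hence have a
   nonzero map to B; restricted to the kernel this map is zero or bijective, and
   either case contradicts Hom(M, B) = 0 or nonsplitness.  So B lies in tau_perp,
   and S meets tau_perp in more than Gen M. *)
Lemma cover_le_tau_perp S : tors_cover rgen S -> le S tau_perp.
Proof.
move=> [gS ngS hS]; have St := tors_classP S.
pose Pr n := `[< exists B, [/\ S B, hom_zero M B, ~ is_zero B & mdim B = n] >].
have ex : exists n, Pr n.
  have [Y [SY nY]] : exists Y, S Y /\ ~ rgen Y.
    apply: contrapT => no; apply: ngS; apply: tors_le_anti => // Y SY.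
    by apply: contrapT => h; apply: no; exists Y.
  have [S1 [RS VQ hQ]] := torsion_pair Vw Gt (torsion_in St SY).
  exists (mdim (quo S1)); apply/asboolP; exists (quo S1); split=> //.
  - exact: (torsion_surj St SY VQ (@pr_surj _ _ _ S1)).
  - exact/hQ/rgen_in.
  move=> Q0; apply: nY; exact: (torsion_ext Gt RS (torsion_zero Vw Gt Q0)).
case: (ex_minnP ex) => d /asboolP[B [SB MB nB dB]] dmin.
have VB := torsion_in St SB; have fB := wide_fg Vw VB.
have dle Y : S Y -> hom_zero M Y -> ~ is_zero Y -> (mdim B <= mdim Y)%N.
  by move=> SY MY nY; rewrite dB; apply: dmin; apply/asboolP; exists Y.
have perp Z : S Z -> hom_zero Z B -> rgen Z.
  move=> SZ ZB; pose L : tors V := Tors (lperp_torsion Vw B St).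
  have gL : le rgen L by move=> X RX; split; [apply: gS|apply: rgen_hom].
  have LS : le L S by move=> X [].
  case: (hS L (conj gL LS)) => LE; first by rewrite -LE.
  case: nB => x; have : L B by rewrite LE.
  by move=> [_ h]; apply: (h (idfun : {linear B -> B}) x).
have onto Z (f : {linear Z -> B}) : S Z -> (exists z, f z <> 0) -> surj f.
  move=> SZ [z fz] b; have SI : S (sub (imm f)) by apply: (torsion_imm Vw St).
  have /bij_surj s : bijective (incl (imm f)).
    apply: (inj_dim_bij fB (@incl_inj _ _ _ _)); apply: dle => //.
      exact: hom_zero_inj (@incl_inj _ _ _ (imm f)) MB.
    move=> I0; apply: fz; have [y yE] := @incl_onto _ _ _ (imm f) (f z) (ex_intro _ z erefl).
    by rewrite -yE (I0 y) linear0.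
  by have [y <-] := s b; apply: (inclP y).
(* The quotient of [Z] by its Gen M-part has smaller dimension than [B]; if it were nonzero it would
   contradict the choice of [B]. *)
have quot Z (f : {linear B -> Z}) : V Z -> surj f -> ~ injective f -> rgen Z.
  move=> VZ fs ni; have [S1 [RS VQ hQ]] := torsion_pair Vw Gt VZ.
  have [Q0|nQ] := pselect (is_zero (quo S1)); first exact: (torsion_ext Gt RS (torsion_zero Vw Gt Q0)).
  have [x fx nx] : exists2 x, f x = 0 & x <> 0.
    apply: contrapT => no; apply: ni; apply: add_ker0_inj => x fx.
    by apply: contrapT => nx; apply: no; exists x.
  have SZ : S Z := torsion_surj St SB VZ fs.
  have : (mdim B <= mdim (quo S1))%N.
    apply: dle => //; first exact: (torsion_surj St SZ VQ (@pr_surj _ _ _ S1)).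
    exact/hQ/rgen_in.
  rewrite leqNgt => /negP[]; apply: leq_ltn_trans (mdim_surj (@pr_surj _ _ _ S1) (wide_fg Vw VZ)) _.
  by apply: (mdim_surj_lt fs fB); exists x.
have DB : Dtau V M B.
  split=> // E q VE qs [g gs]; have Vk : V (sub (kerm q)) := wide_kerm Vw q VE VM.
  have [gi|ni] := pselect (injective g); last first.
    exact: (rigid_eproj A_finite Vw rM).2 (quot _ g Vk gs ni).
  have SE : S E.
    apply: (torsion_is_ext St (ext_ker qs)); last by apply: gS; apply: rgen_in.
    exact: (torsion_surj St SB Vk gs).
  have [RE|nRE] := pselect (rgen E).
    have /Gen1_fam[_ [n [f fP]]] := RE.
    have [|i /lin_inv[u [_ uK]]] := generated_bij fM iM (f := fun i => q \o f i).
      move=> x; have [e <-] := qs x; have [m ->] := fP e; exists m.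
      by rewrite linear_sum.
    by exists (f i \o u) => x; apply: uK.
  have [f [e fe]] : exists (f : {linear E -> B}) e, f e <> 0.
    apply: contrapT => no; apply: nRE; apply: perp => // f e.
    by apply: contrapT => h; apply: no; exists f, e.
  pose k : {linear B -> B} := f \o incl (kerm q) \o g.
  have [k0|nk0] := pselect (forall b, k b = 0).
    have [x /(@incl_onto _ _ _ (kerm q))[y <-]|h hE] := factor_surj (f := f) qs.
      by have [b <-] := gs y; apply: k0.
    by case: fe; rewrite -hE MB.
  have [b kb] : exists b, k b <> 0.
    by apply: contrapT => no; apply: nk0 => b; apply: contrapT => h; apply: no; exists b.
  have [u [uK _]] := lin_inv (surj_bij fB (onto B k SB (ex_intro _ b kb))).
  have [x /(@incl_onto _ _ _ (kerm q))[y <-]|h hE] :=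
      factor_surj (f := idfun \- (incl (kerm q) \o g \o u \o f)) qs.
    have [c <-] := gs y; rewrite /= -[f _]/(k c) uK.
    exact: subrr.
  exists h => x; have [z <-] := qs x; rewrite hE /= linearB.
  by have -> : q (incl (kerm q) (g (u (f z)))) = 0 := inclP (g (u (f z))); rewrite subr0.
have gI : le rgen (tors_meet S tau_perp) by apply/tors_lexI; split=> //; apply: rgen_tau_perp.
have IS : le (tors_meet S tau_perp) S by have [] := (tors_lexI (tors_meet S tau_perp) S tau_perp).1 (@tors_le_refl _ _ _ _).
case: (hS _ (conj gI IS)) => IE; last first.
  by rewrite -IE; have [] := (tors_lexI (tors_meet S tau_perp) S tau_perp).1 (@tors_le_refl _ _ _ _).
case: nB; apply: rgen_zero => //; rewrite -IE => T [->|->] //.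
Qed.

(** The objects of J(M) all of whose nonzero quotients in J(M) map nontrivially to [X] form a
    torsion class containing [X], hence containing [U]. So [Y] has a nonzero map to [X], which is
    onto because [X] is simple in J(M). *)
Lemma Jsimple_atom X : Jsub X -> ~ is_zero X ->
  (forall S : smod X, Jsub (sub S) -> (exists x, S x /\ x <> 0) -> forall x, S x) ->
  forall U : tors Jsub, tors_le U (tgen Jsub X) -> (exists2 Y, U Y & ~ is_zero Y) -> U X.
Proof.
move=> JX nX simple U UX [Y UY nY].
have CT : is_torsion Jsub (fun Y => Jsub Y /\ forall Z (f : {linear Y -> Z}),
    Jsub Z -> surj f -> ~ is_zero Z -> ~ hom_zero Z X).
  apply: (mk_torsion Jw).
  - by move=> Z [].
  - split; first exact: (wide_zero Jw).
    move=> Z f _ fs [] z; have [x <-] := fs z; by rewrite (zero_mod_zero x) linear0.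
  - move=> Z Z' f [JZ hZ] JZ' fs; split=> // Z2 g JZ2 gs.
    by apply: (hZ Z2 (g \o f)) => //; apply: surj_comp.
  move=> Z S JZ [JS hS] [JQ hQ]; split=> // Z' f JZ' fs nZ' h.
  pose I := imm (f \o incl S); have JI : Jsub (sub I) := wide_imm Jw (f \o incl S) JS JZ'.
  have JQI : Jsub (quo I) := wide_quo Jw JI JZ'.
  have [Q0|nQ] := pselect (is_zero (quo I)); last first.
    have [x /prP/incl_onto[s <-]|g gE] := factor_surj (f := pr I \o f) (@pr_surj _ _ _ S).
      by apply/(prP I); exists s.
    apply: (hQ (quo I) g JQI) nQ _ => [y|k x].
      by have [z <-] := pr_surj y; have [x <-] := fs z; exists (pr S x); rewrite gE.
    by have [z <-] := pr_surj x; apply: (h (k \o pr I)).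
  apply: (hS Z' (f \o incl S) JZ') nZ' h => z; exact/(prP I)/Q0.
have CX : Jsub X /\ forall Z (f : {linear X -> Z}),
    Jsub Z -> surj f -> ~ is_zero Z -> ~ hom_zero Z X.
  split=> // Z f JZ fs nZ h; apply: nZ => z; have [x <-] := fs z.
  have kf := simple (kerm f) (wide_kerm Jw f JX JZ).
  have [[x0 [fx0 nx0]]|no] := pselect (exists x, kerm f x /\ x <> 0).
    exact: (kf (ex_intro _ x0 (conj fx0 nx0)) x).
  have fi : injective f.
    by apply: add_ker0_inj => y fy; apply: contrapT => ny; apply: no; exists y.
  have [g [fK _]] := lin_inv (bij_inj_surj fi fs).
  by rewrite -(fK x) h linear0.
have /(tgen_le (Tors CT) JX) gC := CX; have [JY hY] := gC Y (UX Y UY).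
have nh : ~ hom_zero Y X by apply: (hY Y idfun) => // y; exists y.
have [f [y fy]] : exists (f : {linear Y -> X}) y, f y <> 0.
  by apply: contrapT => no; apply: nh => f y; apply: contrapT => h; apply: no; exists f, y.
apply: (torsion_surj (tors_classP U) UY JX (f := f)); apply: (simple (imm f)).
  exact: (wide_imm Jw f JY JX).
by exists (f y); split=> //; exists y.
Qed.

(* An upper bound z of the covers that omits some object of J(M) omits one, X,
   of minimal dimension; X is simple in J(M), so it gives a cover of Gen M. *)
Lemma tau_perp_pop : is_pop le (tors_top V) rgen tau_perp.
Proof.
split=> [|S cS _|z gz hz]; [exact: rgen_tau_perp|exact: cover_le_tau_perp|].
apply: contrapT => nDz; have zt := tors_classP z.
pose Pr n := `[< exists X, [/\ Jsub X, ~ z X & mdim X = n] >].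
have ex : exists n, Pr n.
  apply: contrapT => no; apply: nDz; apply: le_Jsub => // X JX _.
  by apply: contrapT => nX; apply: no; exists (mdim X); apply/asboolP; exists X.
case: (ex_minnP ex) => d /asboolP[X [JX nzX dX]] dmin; have fX := wide_fg Jw JX.
have zl Y : Jsub Y -> (mdim Y < mdim X)%N -> z Y.
  move=> JY lt; apply: contrapT => nY; move: lt; rewrite ltnNge dX dmin //.
  by apply/asboolP; exists Y.
have nX : ~ is_zero X by move=> X0; apply: nzX; apply: (torsion_zero Vw zt).
have simple (S : smod X) : Jsub (sub S) -> (exists x, S x /\ x <> 0) -> forall x, S x.
  move=> JS [x0 [Sx0 nx0]]; apply: contrapT => nS; apply: nzX.
  apply: (torsion_ext zt (S := S)); apply: zl => //.
  - apply: (mdim_inj_lt (@incl_inj _ _ _ S) fX) => si; apply: nS => x.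
    by have [y <-] := si x; apply: inclP.
  - exact: (wide_quo Jw).
  apply: (mdim_surj_lt (@pr_surj _ _ _ S) fX); exists x0 => //; exact/prP.
pose UX := tgen Jsub X; apply: nzX.
suff /hz h : tors_cover rgen (Psi UX).
  by apply: h => [|]; [exact: tors_lex1|apply/PsiJ => //; apply: tgen_in].
split=> [|gP|w [gw wP]]; first exact: Psi_bot.
  apply: nX; apply: rgen_zero; last by have /JsubP[] := JX.
  by rewrite gP; apply/PsiJ => //; apply: tgen_in.
have wD : le w tau_perp by move=> Y /wP /Psi_top.
have RU : tors_le (Res w) UX by apply/Psi_le; rewrite PsiK.
have [[Y RY nY]|no] := pselect (exists2 Y, Res w Y & ~ is_zero Y).
  right; apply: tors_le_anti => //; rewrite -(PsiK gw wD).
  apply/Psi_le/tgen_le => //; apply: (Jsimple_atom JX nX simple RU).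
  by exists Y.
left; apply: tors_le_anti => //; apply: le_Jsub => // Y JY wY.
by apply: (torsion_zero Vw Gt) => y; apply: contrapT => ny; apply: no; exists Y => // Y0; apply: ny.
Qed.

Lemma is_pop_unique (p : tors V) : is_pop le (tors_top V) rgen p -> p = tau_perp.
Proof.
move=> [gp cp mp]; have [gD cD mD] := tau_perp_pop.
by apply: tors_le_anti; [apply: mp|apply: mD].
Qed.

Local Notation jlab := (is_jlabel le (@tors_join F A V) (tors_bot V) (tors_top V)).

(** Suppose y \/ u = v and [B] is not in [y]. A nonzero map from [y] to [B] has its image in J(M)
    and [v], so it would be onto; a map from [u] to [B] factors through a quotient in J(M) and
    vanishes. Then [y] and [u] lie in the torsion class of all X with Hom(X, B) = 0, and so does
    [v], which contains [B]. *)
Lemma brick_jlabel B u v : Jsub B -> ~ is_zero B -> le rgen u -> le v tau_perp ->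
  tors_cover u v -> v B ->
  (forall Y, Jsub Y -> u Y -> hom_zero Y B) ->
  (forall S : smod B, Jsub (sub S) -> v (sub S) -> (exists x, S x /\ x <> 0) -> forall x, S x) ->
  jlab u v (tgen V B).
Proof.
move=> JB nB gu vD [uv nuv huv] vB uB sB; have VB := Jsub_wide JB; have /JsubP[MB DB] := JB.
have nuB : ~ u B.
  by move=> uB'; apply: nB => x; apply: (uB B JB uB' (idfun : {linear B -> B})).
split; first exact: within_all.
  have jv : within le u v (tors_join (tgen V B) u).
    by split; [apply: le_joinr|apply/tors_leUx; split=> //; apply/tgen_le].
  case: (huv _ jv) => // ju; case: nuB; rewrite -ju; apply: le_joinl; exact: tgen_in.
move=> y _ yu; apply/tgen_le => //; apply: contrapT => nyB.
pose L : tors V := Tors (lperp_torsion Vw B (tors_classP (tors_top V))).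
have yL : le y L.
  move=> X yX; have VX := torsion_in (tors_classP y) yX; split=> // f x; apply: contrapT => fx.
  have yI : y (sub (imm f)) := torsion_imm Vw (tors_classP y) f yX VB.
  have vI : v (sub (imm f)) by rewrite -yu; apply: le_joinl.
  have JI : Jsub (sub (imm f)).
    by apply/JsubP; split; [exact: hom_zero_inj (@incl_inj _ _ _ (imm f)) MB|apply: vD].
  apply: nyB; apply: (torsion_surj (tors_classP y) yI VB (f := incl (imm f))) => b.
  apply: incl_onto; apply: (sB _ JI vI); exists (f x); split=> //; by exists x.
have uL : le u L.
  move=> X uX; have VX := torsion_in (tors_classP u) uX; split=> // f x.
  have [S [RS JS]] := torsion_quotient (vD X (uv X uX)).
  have [s /prP/incl_onto[t <-]|g gE] := factor_surj (f := f) (@pr_surj _ _ _ S).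
    exact: (rgen_hom RS MB (f \o incl S)).
  rewrite -gE; apply: uB => //.
  exact: (torsion_surj (tors_classP u) uX (Jsub_wide JS) (@pr_surj _ _ _ S)).
have /tors_leUx : le y L /\ le u L by [].
rewrite yu => /(_ B vB)[_ h]; apply: nB => x; exact: (h (idfun : {linear B -> B}) x).
Qed.

(** The cover is the image under [Psi] of the one below Filt Gen B in tors(J(M)). *)
Lemma jlabels_brick B : brick B -> Jsub B ->
  jlabels le (@tors_join F A V) (tors_bot V) (tors_top V) rgen tau_perp (tgen V B).
Proof.
move=> bB JB; have L1 := @tlower_le _ _ Jsub B; have L2 := tlower_proper bB JB.
have L3 := tlower_max bB JB.
exists (Psi (tlower B)), (Psi (tgen Jsub B)); split.
- exact: Psi_bot.
- exact: Psi_top.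
- apply: Psi_cover; exact: (lower_cover L1 L2 L3).
apply: brick_jlabel => //; [exact: bB.1|exact: Psi_bot|exact: Psi_top| | | |].
- apply: Psi_cover; exact: (lower_cover L1 L2 L3).
- by apply/PsiJ => //; apply: tgen_in.
- by move=> Y JY /(PsiJ _ JY)[].
move=> S JS /(PsiJ _ JS)/(tgenP _ JB); exact: (brick_sub_FiltGen Jw bB JB).
Qed.

(** [B] has least dimension among the nonzero objects of J(M) in [v] without nonzero maps from
    objects of J(M) in [u]. Its subobjects in J(M) that lie in [v] satisfy the same condition, so
    they are zero or all of [B]; this applies to images of endomorphisms. *)
Lemma jlabels_brick_ex j :
  jlabels le (@tors_join F A V) (tors_bot V) (tors_top V) rgen tau_perp j ->
  exists B, [/\ brick B, Jsub B & j = tgen V B].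
Proof.
move=> [u [v [gu vD cuv [wj ju jmin]]]]; have [uv nuv huv] := cuv.
pose Pr n := `[< exists B, [/\ Jsub B, v B, ~ is_zero B,
  (forall Y, Jsub Y -> u Y -> hom_zero Y B) & mdim B = n] >].
have ex : exists n, Pr n.
  have [X [JX vX nuX]] : exists X, [/\ Jsub X, v X & ~ u X].
    apply: contrapT => no; apply: nuv; apply: tors_le_anti => //; apply: le_Jsub => // X JX vX.
    by apply: contrapT => nX; apply: no; exists X.
  have [S [[JS uS] JQ hQ]] := torsion_pair Jw (tors_classP (Res u)) JX.
  exists (mdim (quo S)); apply/asboolP; exists (quo S); split=> //.
  - exact: (torsion_surj (tors_classP v) vX (Jsub_wide JQ) (@pr_surj _ _ _ S)).
  - move=> Q0; apply: nuX; apply: (torsion_ext (tors_classP u) uS).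
    exact: (torsion_zero Vw (tors_classP u) Q0).
  by move=> Y JY uY; apply: hQ.
case: (ex_minnP ex) => d /asboolP[B [JB vB nB uB dB]] dmin; have fB := wide_fg Jw JB.
have sB (S : smod B) : Jsub (sub S) -> v (sub S) -> (exists x, S x /\ x <> 0) -> forall x, S x.
  move=> JS vS [x0 [Sx0 nx0]] x.
  have /bij_surj s : bijective (incl S).
    apply: (inj_dim_bij fB (@incl_inj _ _ _ S)); rewrite dB; apply: dmin; apply/asboolP.
    exists (sub S); split=> // [S0|Y JY uY].
      by have [y yE] := incl_onto Sx0; apply: nx0; rewrite -yE (S0 y) linear0.
    exact: hom_zero_inj (@incl_inj _ _ _ S) (uB Y JY uY).
  by have [y <-] := s x; apply: inclP.
exists B; split=> //.
  split=> // f; have [f0|nf0] := pselect (forall x, f x = 0); [by left|right].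
  apply: (surj_bij fB); apply: (sB (imm f) (wide_imm Jw f JB JB)).
    exact: (torsion_imm Vw (tors_classP v) f vB (Jsub_wide JB)).
  have [x fx] : exists x, f x <> 0.
    by apply: contrapT => no; apply: nf0 => x; apply: contrapT => h; apply: no; exists x.
  by exists (f x); split=> //; exists x.
have [_ bu bmin] := brick_jlabel JB nB gu vD cuv vB uB sB.
by apply: tors_le_anti; [apply: jmin => //; apply: within_all|apply: bmin].
Qed.
End Reduction.

(** * Exceptional sequences *)

Lemma kappa_consP {L : Type} (le : L -> L -> Prop) (join : L -> L -> L) a b j s :
  kappa_exceptional le join a b (j :: s) <->
  exists p, [/\ forall i, (i <= size s)%N -> join_irreducible le join a b (nth a (j :: s) i),
    is_pop le b j p,
    forall i, (i < size s)%N -> jlabels le join a b j p (nth a s i)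
    & kappa_exceptional le join j p [seq join i j | i <- s]].
Proof.
split=> [h|[p [h1 h2 h3 h4]]]; last exact: kappa_cons h1 h2 h3 h4.
by inversion h as [|? ? ? ? p h1 h2 h3 h4]; exists p.
Qed.

(** * Transport along an embedding of a lattice as an interval with top [hi] *)

Section KappaTransport.
Context {L L' : Type} (le : L -> L -> Prop) (join : L -> L -> L).
Context (le' : L' -> L' -> Prop) (join' : L' -> L' -> L') (e : L' -> L) (hi : L).

Hypothesis le_trans : forall x y z, le x y -> le y z -> le x z.
Hypothesis e_le : forall u v, le (e u) (e v) <-> le' u v.
Hypothesis e_inj : injective e.
Hypothesis e_join : forall u v, e (join' u v) = join (e u) (e v).
Hypothesis e_hi : forall u, le (e u) hi.
Hypothesis e_onto : forall u x, le (e u) x -> le x hi -> exists v, e v = x.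
(* Needed because is_pop compares with all upper bounds in L. *)
Hypothesis hi_meet : forall z, exists m,
  [/\ le m z, le m hi & forall w, le w z -> le w hi -> le w m].

Lemma within_image a b x : within le (e a) (e b) x -> exists2 u, e u = x & within le' a b u.
Proof.
move=> [ax xb]; have [u uE] := e_onto ax (le_trans xb (e_hi b)); exists u => //.
by rewrite -uE in ax xb; split; apply/e_le.
Qed.

Lemma within_transport a b u : within le (e a) (e b) (e u) <-> within le' a b u.
Proof. by split=> -[h h']; split; apply/e_le. Qed.

Lemma cover_transport u v : Defs.cover le (e u) (e v) <-> Defs.cover le' u v.
Proof.
split=> -[uv nuv h]; (split; [exact/e_le|by move=> uvE; apply: nuv; rewrite ?uvE //; apply: e_inj|]).
  by move=> w /within_transport/h[]/e_inj ->; [left|right].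
by move=> _ /within_image[w <- /h[]->]; [left|right].
Qed.

Lemma ji_transport a b u :
  join_irreducible le join (e a) (e b) (e u) <-> join_irreducible le' join' a b u.
Proof.
split=> -[wu nu h]; (split; [exact/within_transport|by move=> uE; apply: nu; rewrite ?uE //; apply: e_inj|]).
  move=> y z /within_transport wy /within_transport wz uE.
  by case: (h _ _ wy wz); rewrite ?uE ?e_join // -e_join -uE => /e_inj; [left|right].
move=> _ _ /within_image[y <- wy] /within_image[z <- wz]; rewrite -e_join => /e_inj uE.
by case: (h _ _ wy wz uE) => <-; [left|right].
Qed.

Lemma is_pop_transport b u p : is_pop le (e b) (e u) (e p) <-> is_pop le' b u p.
Proof.
split=> -[up cp mp]; (split; first exact/e_le).
- by move=> y /cover_transport cy /e_le yb; apply/e_le/cp.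
- move=> z /e_le uz hz; apply/e_le/mp => // y cy yb; have [uy _ _] := cy.
  have [v vE] := e_onto uy (le_trans yb (e_hi b)); rewrite -vE in cy yb *.
  by apply/e_le/hz; [apply/cover_transport|apply/e_le].
- move=> y cy yb; have [uy _ _] := cy.
  have [v vE] := e_onto uy (le_trans yb (e_hi b)); rewrite -vE in cy yb *.
  by apply/e_le/cp; [apply/cover_transport|apply/e_le].
move=> z uz hz; have [m [mz mh mm]] := hi_meet z.
have um := mm _ uz (e_hi u); have [v vE] := e_onto um mh.
apply: le_trans mz; rewrite -vE in um mm *; apply/e_le/mp => [|y cy yb]; first exact/e_le.
by apply/e_le/mm => //; apply: hz; [apply/cover_transport|apply/e_le].
Qed.

Lemma is_jlabel_transport a b u v j :
  is_jlabel le join (e a) (e b) (e u) (e v) (e j) <-> is_jlabel le' join' a b u v j.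
Proof.
split=> -[wj jv mj]; (split; first exact/within_transport).
- by apply: e_inj; rewrite e_join.
- by move=> y wy yv; apply/e_le/mj; [exact/within_transport|rewrite -e_join yv].
- by rewrite -e_join jv.
by move=> _ /within_image[y <- wy]; rewrite -e_join => /e_inj yv; apply/e_le/mj.
Qed.

Lemma jlabels_transport a b x y j :
  jlabels le join (e a) (e b) (e x) (e y) (e j) <-> jlabels le' join' a b x y j.
Proof.
split=> [[u' [v' [xu vy cuv]]]|[u [v [xu vy cuv luv]]]]; last first.
  by exists (e u), (e v); split; [exact/e_le|exact/e_le|exact/cover_transport|exact/is_jlabel_transport].
have [uv _ _] := cuv; have vh := le_trans vy (e_hi y).
have [u uE] := e_onto xu (le_trans uv vh); have [v vE] := e_onto (le_trans xu uv) vh.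
rewrite -uE -vE in xu vy cuv * => luv; exists u, v.
by split; [exact/e_le|exact/e_le|exact/cover_transport|exact/is_jlabel_transport].
Qed.

Lemma kappa_transport a b t :
  kappa_exceptional le join (e a) (e b) (map e t) <-> kappa_exceptional le' join' a b t.
Proof.
(* Induction on the length and not on the list, since the tail is replaced by its joins with the
   head. *)
move: {2}(size t) (erefl (size t)) => n; elim: n a b t => [|n IHn] a b [|j s] //=.
  by move=> _; split=> _; apply: kappa_nil.
move=> [sn]; have jE : [seq join i (e j) | i <- map e s] = map e [seq join' i j | i <- s].
  by rewrite -!map_comp; apply: eq_map => i /=; rewrite e_join.
have nE i : (i <= size s)%N -> nth (e a) (e j :: map e s) i = e (nth a (j :: s) i).
  by move=> si; rewrite -[_ :: _]/(map e (j :: s)) (nth_map a).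
rewrite !kappa_consP size_map jE; split=> -[p [h1 h2 h3 h4]].
  have [[_ jb] _ _] := h1 0%N isT; have [jp _ mp] := h2.
  have pb : le p (e b) by apply: mp => // y [].
  have [q qE] := e_onto jp (le_trans pb (e_hi b)); rewrite -qE in h2 h3 h4.
  exists q; split; [|exact/is_pop_transport| |].
  - by move=> i si; apply/ji_transport; rewrite -nE //; apply: h1.
  - by move=> i si; apply/jlabels_transport; have := h3 i si; rewrite (nth_map a).
  by apply/IHn; rewrite ?size_map.
exists (e p); split; [|exact/is_pop_transport| |].
- by move=> i si; rewrite nE //; apply/ji_transport/h1.
- by move=> i si; rewrite (nth_map a) //; apply/jlabels_transport/h3.
by apply/IHn; rewrite ?size_map.
Qed.
End KappaTransport.

Section Sequences.
Context {F : fieldType} {A : falgType F} (A_finite : tau_tilting_finite A).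
Implicit Types (V : wide_subcat A) (M N X B : lmodType A) (s : seq (lmodType A)).

Lemma rigid_Dtau V M : indecomposable M -> (tau_rigid V M <-> Dtau V M M).
Proof.
move=> iM; rewrite (tau_rigidP (wide_classP V) A_finite); split=> [[]//|rM]; split=> //.
exists [:: M]; split=> [|[|i]//|[|i] [|j]//] //=.
have zE (z : @zero_mod F A) : z = 0 by apply: zero_mod_zero.
exists (lpair idfun (GRing.null_fun zero_mod : {linear M -> zero_mod})), (@fst M zero_mod) => //.
by move=> -[x z]; rewrite lpairE /= (zE z).
Qed.

Lemma tgen_ji V B : brick B -> V B ->
  join_irreducible (@tors_le F A V) (@tors_join F A V) (tors_bot V) (tors_top V) (tgen V B).
Proof. by move=> bB VB; apply: (lower_ji (tlower_proper bB VB) (tlower_max bB VB)). Qed.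

Section Head.
Context {V : wide_subcat A} {M : lmodType A} (iM : indecomposable M) (rM : Dtau V M M).
Local Notation J := (Jsub A_finite rM).
Local Notation le := (@tors_le F A V).

Lemma rgen_beta : rgen A_finite rM = tgen V (beta M).
Proof. by apply: tors_ext => X; rewrite (tgen_beta A_finite). Qed.

Lemma kappa_reduction (t : seq (tors J)) :
  kappa_exceptional le (@tors_join F A V) (rgen A_finite rM) (tau_perp A_finite rM)
    [seq Psi U | U <- t] <-> tors_kappa_exceptional (V := J) t.
Proof.
rewrite -(Psi_bot_eq A_finite rM) -(Psi_top_eq A_finite rM).
apply: (@kappa_transport _ _ _ _ _ _ _ (tau_perp A_finite rM)).
- by move=> T U S TU US X /TU /US.
- exact: Psi_le.
- exact: Psi_inj.
- exact: Psi_join.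
- exact: Psi_top.
- move=> U T UT; apply: Psi_onto; exact: tors_le_trans (@Psi_bot _ _ _ _ _ _ _) UT.
move=> z; exists (tors_meet z (tau_perp A_finite rM)).
have [h h'] := (tors_lexI _ z (tau_perp A_finite rM)).1 (@tors_le_refl _ _ _ _).
by split=> // w wz wr; apply/tors_lexI.
Qed.
End Head.

(** The iterated class W_i is realised as a [wide_subcat], as is necessary to speak of its lattice
    of torsion classes. *)
Lemma tau_exceptional_step V s i : tau_exceptional V s -> (i < size s)%N ->
  exists V' : wide_subcat A, [/\ forall X, V' X <-> foldl Jperp V (take i s) X,
    forall X, V' X -> V X, indecomposable (nth zero_mod s i)
    & Dtau V' (nth zero_mod s i) (nth zero_mod s i)].
Proof.
elim: s i V => // M s IH [|i] V [iM /(rigid_Dtau V iM) rM ts] /=; first by exists V.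
move=> /(IH i (Jsub A_finite rM) ts)[V' [eV' V'J iN rN]]; exists V'; split=> // X /V'J.
exact: Jsub_wide.
Qed.

Lemma tau_exceptional_brick V s i : tau_exceptional V s -> (i < size s)%N ->
  brick (beta (nth zero_mod s i)) /\ V (beta (nth zero_mod s i)).
Proof.
move=> ts si; have [V' [_ V'V iN rN]] := tau_exceptional_step ts si.
split; first exact: (beta_brick A_finite (wide_classP V') iN rN).
exact/V'V/(beta_V A_finite (wide_classP V') rN).
Qed.

(** This is rho: every entry is formed in [V] from the brick beta(M_i), whichever W_i the module
    [M_i] is tau-rigid in. *)
Definition brick_tors V s : seq (tors V) := [seq tgen V (beta M) | M <- s].

Lemma nth_brick_tors V s x0 i : (i < size s)%N ->
  nth x0 (brick_tors V s) i = tgen V (beta (nth zero_mod s i)).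
Proof. by move=> si; rewrite (nth_map zero_mod). Qed.

Lemma join_map_tgen V M (rM : Dtau V M M) bs :
  (forall i, (i < size bs)%N -> Jsub A_finite rM (nth zero_mod bs i)) ->
  [seq tors_join i (rgen A_finite rM) | i <- [seq tgen V B | B <- bs]] =
  [seq Psi U | U <- [seq tgen (Jsub A_finite rM) B | B <- bs]].
Proof.
elim: bs => //= B bs IH h; rewrite (tgen_join (h 0%N isT)) IH // => i; exact: (h i.+1).
Qed.

Lemma brick_tors_kappa V s : tau_exceptional V s -> tors_kappa_exceptional (brick_tors V s).
Proof.
elim: s V => [|M s IH] V; first by move=> _; apply: kappa_nil.
move=> ts; have [iM /(rigid_Dtau V iM) rM tJ] := ts.
have hJ i (si : (i < size s)%N) := tau_exceptional_brick (V := Jsub A_finite rM) tJ si.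
apply/kappa_consP; exists (tau_perp A_finite rM); rewrite size_map; split.
- move=> i si; rewrite (@nth_brick_tors V (M :: s)) //.
  by have [] := tau_exceptional_brick ts (i := i) si; apply: tgen_ji.
- rewrite -(rgen_beta iM rM); exact: tau_perp_pop.
- move=> i si; rewrite nth_brick_tors // -(rgen_beta iM rM).
  by have [] := hJ i si; apply: jlabels_brick.
have jE : [seq tors_join i (rgen A_finite rM) | i <- brick_tors V s] =
    [seq Psi U | U <- brick_tors (Jsub A_finite rM) s].
  rewrite /brick_tors (map_comp (tgen V) beta) join_map_tgen -?map_comp // => i.
  by rewrite size_map => si; rewrite (nth_map zero_mod) //; case: (hJ i si).
rewrite -(rgen_beta iM rM) -/(brick_tors V s) jE.
exact/kappa_reduction/(IH (Jsub A_finite rM)).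
Qed.

Lemma map_lift (T : Type) (x0 : T) (f : lmodType A -> T) (P : lmodType A -> Prop) (t : seq T) :
  (forall i, (i < size t)%N -> exists2 B, P B & nth x0 t i = f B) ->
  exists2 bs, (forall i, (i < size bs)%N -> P (nth zero_mod bs i)) & [seq f B | B <- bs] = t.
Proof.
elim: t => [|y t IH] h; first by exists [::].
case: (h 0%N isT) => B PB /= ->; have [i|bs hbs <-] := IH; first exact: (h i.+1).
by exists (B :: bs) => // -[|i] //; apply: hbs.
Qed.

Lemma kappa_brick_tors V (t : seq (tors V)) : tors_kappa_exceptional t ->
  exists2 s, tau_exceptional V s & brick_tors V s = t.
Proof.
move: {2}(size t) (erefl (size t)) => n; elim: n V t => [|n IH] V [|T t] //=.
  by move=> _ _; exists [::].
move=> [tn] /kappa_consP[p [h1 h2 h3 h4]].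
case: (ji_tau_rigid A_finite (h1 0%N isT)) => M [iM rM /= TM].
rewrite -(rgen_beta iM rM) in TM; rewrite TM in h2 h3 h4.
rewrite (is_pop_unique iM h2) in h3 h4.
(* The remaining entries are labels of the interval, hence come from bricks of J(M); the classes of
   these bricks in tors(J(M)) form the shorter sequence. *)
have [i si|bs hbs tE] := map_lift (x0 := tors_bot V) (f := tgen V)
    (P := fun B => brick B /\ Jsub A_finite rM B) (t := t).
  by have [B [bB JB BE]] := jlabels_brick_ex (h3 i si); exists B.
move: h4; rewrite -tE join_map_tgen => [/kappa_reduction|i si]; last by case: (hbs i si).
have bn : size bs = n by rewrite -tn -tE size_map.
move=> /(IH (Jsub A_finite rM) _ (etrans (size_map _ _) bn))[s ts sE].
have ss : size s = size bs by move: (congr1 size sE); rewrite !size_map.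
exists (M :: s); first by split=> //; apply/rigid_Dtau.
rewrite TM (rgen_beta iM rM) /=; congr (_ :: _).
(* Equal classes in tors(J(M)) have isomorphic bricks, and isomorphic bricks generate the same
   torsion class of [V]. *)
apply: (@eq_from_nth _ (tors_bot V)); rewrite ?size_map // => i si.
rewrite nth_brick_tors // (nth_map zero_mod) -?ss //; apply: tgen_iso.
have [bN JN] := tau_exceptional_brick (V := Jsub A_finite rM) ts si.
have [bB JB] : brick (nth zero_mod bs i) /\ Jsub A_finite rM (nth zero_mod bs i).
  by apply: hbs; rewrite -ss.
apply: (tgen_inj (V := Jsub A_finite rM)) => //.
have := congr1 (fun l => nth (tors_bot (Jsub A_finite rM)) l i) sE.
by rewrite nth_brick_tors // (nth_map zero_mod) // -ss.
Qed.

(** The two classes are equal as predicates, so sequences with isomorphic heads continue in the same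
    wide subcategory. *)
Lemma Jperp_iso V M M' : Dtau V M M -> Dtau V M' M' -> mod_iso M M' -> Jperp V M = Jperp V M'.
Proof.
have Vw := wide_classP V.
have h N N' X : V N -> V N' -> mod_iso N N' -> Jperp V N X -> Jperp V N' X.
  move=> VN VN' iN /(JperpP Vw A_finite X VN)[NX DX].
  apply/(JperpP Vw A_finite X VN'); split; last exact: (Dtau_iso iN DX).
  have [f /bij_surj fs] := iN; move=> g y; have [x <-] := fs y; exact: (NX (g \o f)).
move=> [VM _] [VM' _] iM; apply/predeqP => X; split; apply: h => //; exact: mod_iso_sym.
Qed.

(** Isomorphic bricks give Gen M = Gen M', hence isomorphic heads and the same J(M). As [beta] does
    not refer to [V], the hypothesis on the tails survives the passage to J(M). *)
Lemma beta_iso_seq V s s' : tau_exceptional V s -> tau_exceptional V s' -> size s = size s' ->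
  (forall i, (i < size s)%N -> mod_iso (beta (nth zero_mod s i)) (beta (nth zero_mod s' i))) ->
  iso_seq s s'.
Proof.
elim: s s' V => [|M s IH] [|M' s'] V //.
move=> [iM /(rigid_Dtau V iM) rM ts] [iM' /(rigid_Dtau V iM') rM' ts'] [ss] h.
have Vw := wide_classP V.
have iMM : mod_iso M M'.
  apply: (Gen1_indecomposable_inj Vw rM.1 rM'.1) => // X.
  by rewrite -!(tgen_beta A_finite) // (tgen_iso (V := V) (h 0%N isT)).
rewrite -(Jperp_iso rM rM' iMM) in ts'.
have [_ hs] := IH s' (Jsub A_finite rM) ts ts' ss (fun i => h i.+1).
by split=> [|[|i] //]; [rewrite /= ss|apply: hs].
Qed.

Lemma brick_tors_inj V s s' : tau_exceptional V s -> tau_exceptional V s' ->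
  (brick_tors V s = brick_tors V s' <-> iso_seq s s').
Proof.
move=> ts ts'; split=> [e|[ss h]].
  have ss : size s = size s' by move: (congr1 size e); rewrite !size_map.
  apply: (beta_iso_seq ts ts' ss) => i si; have si' : (i < size s')%N by rewrite -ss.
  have [[bB VB] [bB' VB']] := (tau_exceptional_brick ts si, tau_exceptional_brick ts' si').
  apply: (tgen_inj (V := V)) => //; have := congr1 (fun l => nth (tors_bot V) l i) e.
  by rewrite !nth_brick_tors.
apply: (@eq_from_nth _ (tors_bot V)); rewrite !size_map // => i si.
by rewrite !nth_brick_tors -?ss //; apply/tgen_iso/beta_iso/h.
Qed.

End Sequences.

Theorem theorem8p10 (F : fieldType) (A : falgType F) (W : wide_subcat A)
    (A_basic : basic_algebra A) (A_finite : tau_tilting_finite A) :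
  exists rho : seq (lmodType A) -> seq (tors W),
    [/\ (* rho is a bijection from isomorphism classes *)
        forall s, tau_exceptional W s ->
          tors_kappa_exceptional (rho s),
        forall s s', tau_exceptional W s -> tau_exceptional W s' ->
          (rho s = rho s' <-> iso_seq s s'),
        forall t, tors_kappa_exceptional t ->
          exists2 s, tau_exceptional W s & rho s = t
      & forall s, tau_exceptional W s ->
        size (rho s) = size s /\
        forall i, (i < size s)%N ->
          let M := nth zero_mod s i in
          exists (V : wide_subcat A) (B : lmodType A) (T T' : tors V),
            [/\ (* V is W_i (counting from 0), T is Gen_V M, B is beta(M) *)
                forall X, V X <-> foldl Jperp W (take i s) X,
                forall X, T X <-> Gen1 V M X,
                tors_cji T
              & is_beta M B] /\
            [/\ (* T is identified with the i-th entry of rho s *)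
                is_brick_of T B,
                is_brick_of (nth (tors_bot W) (rho s) i) B,
                (* T' is the unique element covered by T *)
                tors_cover T' T,
                (forall U : tors V, tors_cover U T -> U = T')
              & brick_label T' T B]].
Proof.
exists (brick_tors W); split.
- exact: brick_tors_kappa.
- exact: brick_tors_inj.
- exact: kappa_brick_tors.
move=> s ts; split=> [|i si M]; first by rewrite size_map.
have [bB WB] := tau_exceptional_brick A_finite ts si.
have [V [VE _ iM rM]] := tau_exceptional_step A_finite ts si.
have Vw := wide_classP V; have VB := beta_V A_finite Vw rM.
have TB : is_brick_of (tgen V (beta M)) (beta M).
  by split=> // X; apply: tgenP.
have [L1 L2 L3] := And3 (@tlower_le _ _ V (beta M)) (tlower_proper bB VB) (tlower_max bB VB).
exists V, (beta M), (tgen V (beta M)), (tlower (beta M)); split; split=> //.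
- by move=> X; apply: (tgen_beta A_finite).
- exact: (lower_cji L2 L3).
- exact: (beta_is_beta (wide_fg Vw rM.1) iM).
- by split=> // X; rewrite nth_brick_tors //; apply: tgenP.
- exact: (lower_cover L1 L2 L3).
- exact: (lower_unique L1 L2 L3).
exists (tgen V (beta M)) => //; exact: (lower_jlabel L1 L2 L3).
Qed.
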